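(* Let $\rho$ be the unique real root of $x^3 = x+1$ and let $\lambda^* := \rho^{1/2} + \rho^{-1/2}$ ($\approx 2.01980$). For every real number $\lambda$, the family $\mathcal{G}(\lambda)$ of graphs with smallest eigenvalue at least $-\lambda$ has a finite forbidden subgraph characterization if and only if $\lambda < \lambda^*$.
   Context: Graphs are finite, simple and undirected, considered up to isomorphism. Eigenvalues of a graph are those of its adjacency matrix. All subgraphs are induced. Given a family $\mathcal{G}$ of graphs that is closed under taking (induced) subgraphs, a family $\mathcal{F}$ of graphs is a forbidden subgraph characterization of $\mathcal{G}$ if $\mathcal{G}$ consists exactly of the graphs that do not contain any member of $\mathcal{F}$ as an (induced) subgraph. The family $\mathcal{G}(\lambda)$ is closed under taking induced subgraphs by Cauchy interlacing. *)

(* Defs.v *)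
From mathcomp Require Import all_boot all_order all_algebra.
From mathcomp Require Import all_classical all_reals.
From mathcomp Require Import ring lra.

Set Implicit Arguments.
Unset Strict Implicit.
Unset Printing Implicit Defensive.

Import Order.TTheory GRing.Theory Num.Theory.
Local Open Scope classical_set_scope.
Local Open Scope ring_scope.

(* Fixing the vertex set to be {0, ..., n-1} gives finitely many graphs in each
   isomorphism class, so a set of graphs is finite iff it is finite up to
   isomorphism. The graph with no vertex, which has no eigenvalue, is excluded. *)
Record graph := Graph {
  gorder : nat;
  gorder_gt0 : (0 < gorder)%N;
  edge : 'I_gorder -> 'I_gorder -> bool;
  edge_sym : symmetric edge;
  edge_irr : irreflexive edge }.

Definition induced_subgraph (H G : graph) : Prop :=
  exists2 f : 'I_(gorder H) -> 'I_(gorder G),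
    injective f & forall x y, edge (f x) (f y) = edge x y.

Definition forbidden_subgraph_characterization (F C : set graph) : Prop :=
  forall G, C G <-> ~ exists2 H, F H & induced_subgraph H G.

Definition adjacency (R : realType) (G : graph) : 'M[R]_(gorder G) :=
  \matrix_(i, j) (edge i j)%:R.

Definition smallest_eigenvalue (R : realType) (G : graph) (m : R) : Prop :=
  eigenvalue (adjacency R G) m /\
  forall a, eigenvalue (adjacency R G) a -> m <= a.

Definition family_ge (R : realType) (lambda : R) : set graph :=
  [set G | exists2 m, smallest_eigenvalue G m & - lambda <= m].

Definition rho (R : realType) : R := xget 0 [set x : R | x ^+ 3 = x + 1].

Lemma rho_unique (R : realType) (x y : R) :
  x ^+ 3 = x + 1 -> y ^+ 3 = y + 1 -> x = y.
Proof.
move=> hx hy; apply/eqP; rewrite -subr_eq0; apply: contraT => nxy.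
have h : x ^+ 2 + x * y + y ^+ 2 = 1.
  apply: (mulfI nxy); rewrite mulr1.
  transitivity (x ^+ 3 - y ^+ 3); first by ring.
  by rewrite hx hy; ring.
have h1 : 4 - 3 * x ^+ 2 = (x + 2 * y) ^+ 2.
  transitivity (4 * (x ^+ 2 + x * y + y ^+ 2) - 3 * x ^+ 2); last by ring.
  by rewrite h; ring.
have h2 := sqr_ge0 (x + 2 * y).
have h3 : 0 <= 4 - 3 * x ^+ 2 by rewrite h1.
have h4 : x ^+ 2 * (x ^+ 2 - 1) ^+ 2 = 1.
  have e : x * (x ^+ 2 - 1) = 1.
    by transitivity (x ^+ 3 - x); [ring | rewrite hx; ring].
  by rewrite -exprMn e expr1n.
have h5 := sqr_ge0 x.
move: h3 h4 h5; set t := x ^+ 2 => h3 h4 h5.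
exfalso.
suff : t * (t - 1) ^+ 2 < 1 by rewrite h4 ltxx.
have h6 : (t - 1) ^+ 2 <= 1 by nra.
by case: (leP t (1/2)) => ?; nra.
Qed.

Lemma rhoE (R : realType) : rho R ^+ 3 = rho R + 1.
Proof.
rewrite /rho; case: xgetP => [x _ //|nex].
have [x _ /rootP] : exists2 x : R, 0 <= x <= 2 & root ('X^3 - 'X - 1) x.
  by apply: poly_ivt; [lra | rewrite !hornerE; apply/andP; split; lra].
rewrite !hornerE => e; case: (nex x) => /=.
by apply/eqP; rewrite -subr_eq0 -e; apply/eqP; ring.
Qed.

Definition lambda_star (R : realType) : R :=
  Num.sqrt (rho R) + (Num.sqrt (rho R))^-1.

(* Main.v *)
(* The smallest eigenvalue of a graph is at least -t iff the form t|x|^2 + x^T A x is positive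
   semidefinite; call the graph psd at level t. We have lambda_star = y + 1/y with y^2 = rho, and
   the Schur complement of an infinite path attached along a vertex set S, at that level,
   subtracts (sum_S x)^2 / y from the form.

   Let lambda < lambda_star, and let G be a large minimal graph that is not psd at level lambda.
   Averaging over the deletions of a vertex, G is psd at some level t < lambda_star. As G is
   large and connected, it has a far vertex or, by Ramsey's theorem, a large clique; either of
   them shows that every small vertex set remains positive definite at level lambda_star when an
   infinite path is attached to it along some nonempty set. This excludes twelve explicit
   induced subgraphs, also after grafting a path on G, and a graph with a grafted path that
   avoids these twelve is represented by integer vectors of norm 2, built level by level. Thus G
   is psd at level 2, which is absurd if lambda >= 2. If lambda < 2, the vectors are the edges of
   a signed graph without long paths, which has a depth-first tree of bounded depth; by Higman's
   lemma such graphs are well-quasi-ordered by induced subgraphs, so the minimal graphs are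
   bounded in this case as well.

   Let lambda >= lambda_star and l > lambda. Then some graph is psd at level l but not at level
   lambda: extend a small rooted graph greedily to a caterpillar of stars or cliques so that the
   Schur complement h at the root, taken at level l, stays above the fixed point of
   h -> l - 1/h. This map is expanding in the relevant region, so the complement taken at level
   lambda, which starts strictly smaller, would move away without bound. Letting l decrease to
   lambda rules out every finite family of forbidden subgraphs. *)

Require Import Defs.
From mathcomp Require Import all_classical all_reals.
From mathcomp Require Import all_boot all_order all_algebra.
From Stdlib Require ZArith.
From mathcomp Require Import ring lra zify ssrZ.

Set Implicit Arguments.
Unset Strict Implicit.
Unset Printing Implicit Defensive.

Import Order.TTheory GRing.Theory Num.Theory.
Local Open Scope ring_scope.

(** [lambda_star] is the critical level of one tree, with arms of lengths 1, 2 and infinity at a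
    branch vertex: at level [y + 1 / y] the infinite arm has Schur complement [1 / y], and
    eliminating the other arms makes the form singular exactly when [y ^+ 6 = y ^+ 2 + 1]. This tree
    governs both directions. Below [lambda_star] it is the only case of the twelve graphs without
    numerical slack; from [lambda_star] on, its finite part is the rooted graph that starts the
    caterpillars for the levels nearest to [lambda_star].

    The obstacle to finiteness is the passage from small vertex sets to the whole graph. Every small
    set carries a path along some set [S], but [S] depends on the small set, whereas building
    vectors level by level needs one path grafted on all of the graph. Anchors remove this
    dependence: an induced path on four vertices, or a clique of four, singles out one coordinate in
    every integer representation of every set that contains it, and the support of that coordinate
    is described by adjacency alone. The path is grafted along this support. *)

Ltac llia := repeat match goal with
  | H : @eq nat _ _ |- _ => revert H | H : is_true (leq _ _) |- _ => revert H end; clear; lia.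

(** * Quadratic forms *)

Definition qform (R : realType) (V : finType) (e : rel V) (t : R) (x : V -> R) : R :=
  t * (\sum_v x v ^+ 2) + \sum_u \sum_v (e u v)%:R * x u * x v.

Definition psd (R : realType) (V : finType) (e : rel V) (t : R) : Prop :=
  forall x : V -> R, 0 <= qform e t x.

Section Eigen.
Variables (R : realType) (n : nat).
Implicit Types (M B : 'M[R]_n) (u v : 'rV[R]_n).

Definition bil M u v : R := (u *m M *m v^T) 0 0.

Lemma bilE M u v : bil M u v = \sum_i \sum_j M i j * u 0 i * v 0 j.
Proof.
rewrite /bil mxE exchange_big /=; apply: eq_bigr => j _.
rewrite !mxE mulr_suml; apply: eq_bigr => i _; ring.
Qed.

Lemma discr_le (a b c : R) : 0 <= c -> (forall s, 0 <= a + 2 * s * b + s ^+ 2 * c) ->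
  b ^+ 2 <= a * c.
Proof.
rewrite le0r => /orP[/eqP c0|c0] h.
- rewrite c0 mulr0; case: (eqVneq b 0) => [->|b0]; first by rewrite expr0n.
  have := h (- (a + 1) / (2 * b)).
  rewrite c0 mulr0 addr0 (_ : a + _ = -1); first by lra.
  by field.
- have := h (- b / c).
  rewrite (_ : a + _ + _ = a - b ^+ 2 / c); last by field; rewrite gt_eqF.
  by rewrite subr_ge0 ler_pdivrMr.
Qed.

Lemma bil_lin M u v s : M^T = M ->
  bil M (u + s *: v) (u + s *: v) = bil M u u + 2 * s * bil M u v + s ^+ 2 * bil M v v.
Proof.
move=> sM; have -> : 2 * s * bil M u v = s * bil M u v + s * bil M v u.
  suff -> : bil M v u = bil M u v by ring.
  by rewrite /bil -[RHS]trace_mx11 -mxtrace_tr !trmx_mul trmxK sM trace_mx11 mulmxA.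
rewrite /bil linearD /= linearZ /= !mulmxDl !mulmxDr -!scalemxAl -!scalemxAr !mxE; ring.
Qed.

(** Cauchy-Schwarz for the form, applied to [u] and [y = u *m invmx M]: here [bil M u y] is the
    squared length [N] of [u], and [bil M y y] is at most [K * N], where [K] exceeds the sum of the
    absolute entries of the inverse. *)
Lemma psd_unitmx_lb M : M^T = M -> (forall u, 0 <= bil M u u) -> M \in unitmx ->
  exists2 c : R, 0 < c & forall u, c * (\sum_i u 0 i ^+ 2) <= bil M u u.
Proof.
move=> sM pM uM; pose B := invmx M.
pose K := 1 + \sum_i \sum_j `|B i j|.
have K0 : 0 < K.
  by rewrite /K; apply: ltr_pwDl => //; do 2![apply: sumr_ge0 => ? _].
exists K^-1; first by rewrite invr_gt0.
move=> u; set N := \sum_i _.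
have N0 : 0 <= N by apply: sumr_ge0 => i _; exact: sqr_ge0.
have uN i : u 0 i ^+ 2 <= N.
  by rewrite /N (bigD1 i) //= lerDl; apply: sumr_ge0 => j _; exact: sqr_ge0.
pose y := u *m B.
have e1 : bil M u y = N.
  have sB : B^T = B by rewrite /B trmx_inv sM.
  rewrite /bil /y trmx_mul sB -mulmxA (mulmxA M) mulmxV // mul1mx mxE.
  by apply: eq_bigr => i _; rewrite mxE expr2.
have e2 : bil M y y <= K * N.
  rewrite {1}/bil /y -(mulmxA u) mulVmx // mulmx1 trmx_mul.
  have -> : (u *m (B^T *m u^T)) 0 0 = bil B u u.
    by rewrite /bil -[LHS]trace_mx11 -mxtrace_tr !trmx_mul !trmxK trace_mx11.
  rewrite bilE /K mulrDl mul1r mulr_suml; apply: ler_wpDl => //.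
  apply: ler_sum => i _; rewrite mulr_suml; apply: ler_sum => j _.
  rewrite -mulrA; apply: le_trans (ler_norm _) _; rewrite normrM.
  apply: ler_wpM2l => //.
  have := uN i; have := uN j; rewrite -(real_normK (num_real (u 0 i))).
  rewrite -(real_normK (num_real (u 0 j))) normrM => h1 h2.
  have := sqr_ge0 (`|u 0 i| - `|u 0 j|); nra.
have h : N ^+ 2 <= bil M u u * bil M y y.
  by rewrite -e1; apply: discr_le => // s; rewrite -bil_lin.
have h2 : N ^+ 2 <= bil M u u * (K * N).
  by apply: le_trans h _; apply: ler_wpM2l.
rewrite mulrC ler_pdivrMr //; move: N0; rewrite le0r => /orP[/eqP ->|N0].
  by rewrite mulr_ge0 // ltW.
by rewrite -(ler_pM2r N0) -mulrA -expr2.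
Qed.

End Eigen.

Section SmallestEigenvalue.
Local Open Scope classical_set_scope.
Variables (R : realType) (G : graph).
Local Notation n := (gorder G).
Local Notation A := (adjacency R G).
Local Notation e := (@edge G).

Lemma bil_qform (t : R) (u : 'rV[R]_n) :
  bil (t%:M + A) u u = qform e t (fun i => u 0 i).
Proof.
rewrite bilE /qform mulr_sumr -big_split /=; apply: eq_bigr => i _.
rewrite (eq_bigr (fun j => (t *+ (i == j)) * u 0 i * u 0 j + (e i j)%:R * u 0 i * u 0 j)).
  rewrite big_split /= (bigD1 i) //= eqxx big1 ?addr0 => [|j /negPf]; last first.
    by rewrite eq_sym => ->; rewrite mulr0n !mul0r.
  by congr (_ + _); rewrite mulr1n; ring.
by move=> j _; rewrite !mxE mulrDl mulrDl.
Qed.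

Lemma symA (t : R) : (t%:M + A)^T = t%:M + A.
Proof. by apply/matrixP => i j; rewrite !mxE eq_sym edge_sym. Qed.

Lemma psd_bil (t : R) : psd e t <-> forall u, 0 <= bil (t%:M + A) u u.
Proof.
split=> h u; first by rewrite bil_qform.
have := h (\row_i u i); rewrite bil_qform.
by rewrite (_ : (fun i => (\row_i0 u i0) 0 i) = u) //; apply/funext => i; rewrite mxE.
Qed.

Lemma eigenvalue_ge (t a : R) : psd e t -> eigenvalue A a -> - t <= a.
Proof.
move=> /psd_bil h /eigenvalueP [v va v0].
have := h v; rewrite /bil mulmxDr va mul_mx_scalar -scalerDl -scalemxAl !mxE.
suff : 0 < \sum_j v 0 j * v^T j 0 by move=> N0; rewrite pmulr_lge0 //; lra.
rewrite lt_def sumr_ge0 ?andbT => [|i _]; last by rewrite mxE -expr2 sqr_ge0.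
apply: contra v0 => /eqP h0; apply/eqP/rowP => i; rewrite mxE.
have /psumr_eq0P/(_ h0 i isT) : forall j, true -> 0 <= v 0 j * v^T j 0.
  by move=> j _; rewrite mxE -expr2 sqr_ge0.
by rewrite mxE -expr2 => /eqP; rewrite sqrf_eq0 => /eqP.
Qed.

Lemma psd_le (V : finType) (r : rel V) (s t : R) : s <= t -> psd r s -> psd r t.
Proof.
move=> st h x; apply: le_trans (h x) _; rewrite /qform lerD2r.
by apply: ler_wpM2r => //; apply: sumr_ge0 => i _; exact: sqr_ge0.
Qed.

(** The infimum of the psd levels is itself a psd level, because the form is affine in [t]. If
    [t0%:M + A] were invertible, [psd_unitmx_lb] would leave room below [t0]; hence [- t0] is an
    eigenvalue. *)
Lemma min_psd : exists t0 : R,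
  [/\ psd e t0, eigenvalue A (- t0) & forall t, psd e t -> t0 <= t].
Proof.
pose S : set R := [set t | psd e t].
have lbS : lbound S 0.
  move=> t /psd_bil /(_ (\row_j (j == Ordinal (gorder_gt0 G))%:R)).
  set o := Ordinal _; rewrite bilE (bigD1 o) //= (bigD1 o) //= !mxE eqxx edge_irr.
  rewrite big1 => [|i /negPf h]; last by rewrite !mxE h mulr0.
  rewrite big1 => [|i /negPf h]; last by rewrite big1 // => j _; rewrite !mxE h mulr0 mul0r.
  by rewrite !addr0 mulr1n !mulr1.
have S0 : S !=set0.
  exists n%:R; move=> x; rewrite /qform.
  have E1 : n%:R * (\sum_v x v ^+ 2) = \sum_(u < n) \sum_(v < n) x v ^+ 2.
    by rewrite sumr_const card_ord mulr_natl.
  have E2 : n%:R * (\sum_v x v ^+ 2) = \sum_(u < n) \sum_(v < n) x u ^+ 2.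
    by rewrite exchange_big /= sumr_const card_ord mulr_natl.
  have : 0 <= \sum_(u < n) \sum_(v < n) (x u ^+ 2 + x v ^+ 2 + 2 * ((e u v)%:R * x u * x v)).
    apply: sumr_ge0 => u _; apply: sumr_ge0 => v _.
    have := sqr_ge0 (x u + x v); have := sqr_ge0 (x u); have := sqr_ge0 (x v).
    by case: (e u v) => /=; lra.
  under eq_bigr => u _ do rewrite !big_split /= -[X in _ + _ + X]mulr_sumr.
  rewrite !big_split /= -E1 -E2 -mulr_sumr; lra.
have hi : has_inf S by split => //; exists 0.
pose t0 := inf S.
have Pt0 : psd e t0.
  move=> x; rewrite leNgt; apply/negP => h.
  pose N := \sum_v x v ^+ 2.
  have N0 : 0 <= N by apply: sumr_ge0 => i _; exact: sqr_ge0.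
  have [|t St] := @inf_adherent _ S (- qform e t0 x / (N + 1)) _ hi.
    by rewrite divr_gt0 ?oppr_gt0 // ltr_wpDl.
  move=> h2; have := St x; rewrite leNgt => /negP; apply.
  have -> : qform e t x = qform e t0 x + (t - t0) * N by rewrite /qform -/N; ring.
  have h3 : t - t0 < - qform e t0 x / (N + 1) by rewrite -/t0 in h2; lra.
  have N1 : 0 < N + 1 by rewrite ltr_wpDl.
  move: h3; rewrite ltr_pdivlMr // => h3.
  have : 0 <= t - t0 by rewrite subr_ge0; apply: ge_inf => //; exists 0.
  nra.
have lt0 t : psd e t -> t0 <= t by move=> h; apply: ge_inf => //; exists 0.
exists t0; split => //.
rewrite /eigenvalue kermx_eq0 row_free_unit; apply/negP => uM.
have {}uM : t0%:M + A \in unitmx by rewrite addrC -[t0]opprK raddfN.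
have [c c0 hc] := psd_unitmx_lb (symA t0) (iffLR (psd_bil t0) Pt0) uM.
suff /lt0 : psd e (t0 - c) by lra.
apply/psd_bil => u; have := hc u; rewrite !bil_qform /qform; lra.
Qed.

Lemma family_geP (t : R) : family_ge t G <-> psd e t.
Proof.
have [t0 [p0 e0 m0]] := min_psd; split.
  case=> m [_ hm] tm; apply: psd_le p0.
  by have := hm _ e0; lra.
move=> h; exists (- t0); last by rewrite lerN2 m0.
by split => // a; exact: eigenvalue_ge.
Qed.

End SmallestEigenvalue.

Definition bform (R : realType) (V : finType) (e : rel V) (x y : V -> R) : R :=
  \sum_u \sum_v (e u v)%:R * x u * y v.

Section Forms.
Variables (R : realType) (V : finType) (e : rel V).
Hypotheses (es : symmetric e) (ei : irreflexive e).
Implicit Types (x y : V -> R) (T S : {set V}) (t : R).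

Lemma qformE t x : qform e t x = t * (\sum_v x v ^+ 2) + bform e x x.
Proof. by []. Qed.

Lemma bformC x y : bform e x y = bform e y x.
Proof.
rewrite /bform exchange_big /=; apply: eq_bigr => u _; apply: eq_bigr => v _.
by rewrite es; ring.
Qed.

Lemma bformDl x x' y : bform e (x \+ x') y = bform e x y + bform e x' y.
Proof.
rewrite /bform -big_split /=; apply: eq_bigr => u _; rewrite -big_split /=.
by apply: eq_bigr => v _; ring.
Qed.

Lemma bformZl s x y : bform e (s \*o x) y = s * bform e x y.
Proof.
rewrite /bform mulr_sumr; apply: eq_bigr => u _; rewrite mulr_sumr.
by apply: eq_bigr => v _ /=; ring.
Qed.

Lemma qformD t x y : qform e t (x \+ y) =
  qform e t x + qform e t y + 2 * (t * (\sum_v x v * y v) + bform e x y).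
Proof.
rewrite !qformE bformDl (bformC x) (bformC y) !bformDl (bformC y x).
rewrite (eq_bigr (fun v => x v ^+ 2 + y v ^+ 2 + 2 * (x v * y v))).
  rewrite !big_split /= -mulr_sumr; ring.
by move=> v _ /=; ring.
Qed.

Lemma qformZ t s x : qform e t (s \*o x) = s ^+ 2 * qform e t x.
Proof.
rewrite !qformE bformZl bformC bformZl.
rewrite (eq_bigr (fun v => s ^+ 2 * x v ^+ 2)) => [|v _ /=]; last by ring.
by rewrite -mulr_sumr; ring.
Qed.

Lemma eq_qform t x y : x =1 y -> qform e t x = qform e t y.
Proof. by move=> /funext ->. Qed.

Definition ind T : V -> R := fun v => (v \in T)%:R.

Lemma bform_ind x T : bform e x (ind T) = \sum_u x u * (\sum_(v in T) (e u v)%:R).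
Proof.
rewrite /bform; apply: eq_bigr => u _; rewrite mulr_sumr [RHS]big_mkcond /=.
by apply: eq_bigr => v _; rewrite /ind; case: (v \in T); rewrite ?mulr1 ?mulr0 // mulrC.
Qed.

Definition supp_in T x := forall v, v \notin T -> x v = 0.

Lemma supp_in_orth T S x : [disjoint T & S] -> supp_in T x ->
  \sum_v x v * ind S v = 0.
Proof.
move=> /pred0P d h; apply: big1 => v _; rewrite /ind.
case: (boolP (v \in S)) => vS; last by rewrite mulr0.
by rewrite h ?mul0r //; apply/negP => vT; have := d v; rewrite /= vT vS.
Qed.

Lemma qform_ind1 t p : qform e t (ind [set p]) = t.
Proof.
rewrite qformE bform_ind [X in _ + X]big1 ?addr0 => [|v _]; last first.
  by rewrite big_set1 /ind inE; case: eqP => [->|_]; rewrite ?ei ?mulr0 ?mul0r.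
rewrite (bigD1 p) //= big1 => [|v /negPf h]; last by rewrite /ind inE h expr0n.
by rewrite /ind inE eqxx expr1n addr0 mulr1.
Qed.

Lemma bform_ind1 x p T : p \notin T -> supp_in T x ->
  bform e x (ind [set p]) = \sum_(v in T :&: [set v | e p v]) x v.
Proof.
move=> pT sx; rewrite bform_ind [RHS]big_mkcond /=; apply: eq_bigr => u _.
rewrite big_set1 !inE es; case: (boolP (u \in T)) => uT /=; last by rewrite sx // mul0r.
by case: (e p u); rewrite ?mulr1 ?mulr0.
Qed.

(* [tailed t h T S] says that [T] stays positive semidefinite at level [t] when a
   tail whose Schur complement is [h] is attached along [S]. *)
Definition tailed t h T S := forall x, supp_in T x ->
  0 <= qform e t x - h * (\sum_(v in S) x v) ^+ 2.

Definition stailed t h T S := forall x, supp_in T x -> (exists v, x v != 0) ->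
  0 < qform e t x - h * (\sum_(v in S) x v) ^+ 2.

(** Minimize over the coordinate of [p]: the tail leaves the coefficient [t - h] at [p], and at the
    minimizer [- s / (t - h)] the vertex [p] together with its tail acts as a tail of coefficient
    [(t - h)^-1] along the neighbors of [p]. *)
Lemma tailed_step t h T p : h < t -> p \notin T ->
  tailed t h (p |: T) [set p] -> tailed t (t - h)^-1 T (T :&: [set v | e p v]).
Proof.
move=> ht pT h1 x sx; set s := \sum_(v in _) x v.
have := h1 (x \+ ((- s / (t - h)) \*o ind [set p])).
rewrite qformD qformZ qform_ind1 bformC bformZl bformC (bform_ind1 pT sx) -/s big_set1 /=.
rewrite (_ : \sum_v _ = 0); last first.
  have d : [disjoint T & [set p]] by rewrite disjoint_sym disjoints1.
  rewrite (eq_bigr (fun v => (- s / (t - h)) * (x v * ind [set p] v))) => [|v _ /=]; last by ring.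
  by rewrite -mulr_sumr (supp_in_orth d sx) mulr0.
rewrite sx // /ind inE eqxx mulr1 => h2.
have th : t - h != 0 by rewrite subr_eq0 gt_eqF.
have {}h2 := h2 _; apply: le_trans (h2 _) _.
  move=> v; rewrite !inE negb_or => /andP[/negPf vp vT].
  by rewrite /= sx // inE vp mulr0 addr0.
by rewrite le_eqVlt; apply/orP; left; apply/eqP; field.
Qed.

Lemma stailed_step t h T p : h < t -> p \notin T ->
  stailed t h (p |: T) [set p] -> stailed t (t - h)^-1 T (T :&: [set v | e p v]).
Proof.
move=> ht pT h1 x sx [w xw]; set s := \sum_(v in _) x v.
have := h1 (x \+ ((- s / (t - h)) \*o ind [set p])).
rewrite qformD qformZ qform_ind1 bformC bformZl bformC (bform_ind1 pT sx) -/s big_set1 /=.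
rewrite (_ : \sum_v _ = 0); last first.
  have d : [disjoint T & [set p]] by rewrite disjoint_sym disjoints1.
  rewrite (eq_bigr (fun v => (- s / (t - h)) * (x v * ind [set p] v))) => [|v _ /=]; last by ring.
  by rewrite -mulr_sumr (supp_in_orth d sx) mulr0.
rewrite sx // /ind inE eqxx mulr1 => h2.
have th : t - h != 0 by rewrite subr_eq0 gt_eqF.
apply: lt_le_trans (h2 _ _) _.
- move=> v; rewrite !inE negb_or => /andP[/negPf vp vT].
  by rewrite /= sx // inE vp mulr0 addr0.
- exists w; rewrite /= inE; case: (w =P p) => [wp|_]; last by rewrite mulr0 addr0.
  by rewrite -wp in pT; rewrite (sx _ pT) eqxx in xw.
by rewrite le_eqVlt; apply/orP; left; apply/eqP; field.
Qed.

Lemma tailed_sub t h T T' S : T' \subset T -> tailed t h T S -> tailed t h T' (S :&: T').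
Proof.
move=> TT h1 x sx; have sT : supp_in T x.
  by move=> v vT; apply: sx; apply: contra vT => /(subsetP TT).
have := h1 x sT; rewrite (_ : \sum_(v in S :&: T') x v = \sum_(v in S) x v) //.
rewrite big_mkcond [RHS]big_mkcond /=; apply: eq_bigr => v _; rewrite inE.
by case: (v \in S) => //=; case: (boolP (v \in T')) => // /sx ->.
Qed.

Lemma stailed_sub t h T T' S : T' \subset T -> stailed t h T S -> stailed t h T' (S :&: T').
Proof.
move=> TT h1 x sx xn; have sT : supp_in T x.
  by move=> v vT; apply: sx; apply: contra vT => /(subsetP TT).
have := h1 x sT xn; rewrite (_ : \sum_(v in S :&: T') x v = \sum_(v in S) x v) //.
rewrite big_mkcond [RHS]big_mkcond /=; apply: eq_bigr => v _; rewrite inE.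
by case: (v \in S) => //=; case: (boolP (v \in T')) => // /sx ->.
Qed.

Lemma tailed_mono t h h' T S : h' <= h -> tailed t h T S -> tailed t h' T S.
Proof.
move=> hh h1 x sx; apply: le_trans (h1 x sx) _.
by rewrite lerD2l lerN2; apply: ler_wpM2r => //; exact: sqr_ge0.
Qed.

Lemma sum_sq_gt0 x : (exists v, x v != 0) -> 0 < \sum_v x v ^+ 2.
Proof.
case=> v xv; rewrite (bigD1 v) //=; apply: ltr_pwDl; first by rewrite exprn_even_gt0.
by apply: sumr_ge0 => w _; exact: sqr_ge0.
Qed.

Lemma tailed_stailed t t' h T S : t < t' -> tailed t h T S -> stailed t' h T S.
Proof.
move=> tt h1 x sx xn; apply: le_lt_trans (h1 x sx) _.
by rewrite ltrD2r /qform ltrD2r ltr_pM2r // sum_sq_gt0.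
Qed.

Lemma bform_supp x T (Q : {set V}) : supp_in T x -> bform e x (ind Q) = \sum_(u in T) x u * (\sum_(v in Q) (e u v)%:R).
Proof.
move=> sx; rewrite bform_ind [RHS]big_mkcond /=; apply: eq_bigr => u _.
by case: (boolP (u \in T)) => // /sx ->; rewrite mul0r.
Qed.

Lemma qform_clique t (Q : {set V}) : {in Q &, forall u v, e u v = (u != v)} ->
  qform e t (ind Q) = (t + #|Q|%:R - 1) * #|Q|%:R.
Proof.
move=> cQ; rewrite qformE.
have -> : \sum_v ind Q v ^+ 2 = #|Q|%:R.
  rewrite -sum1_card natr_sum [RHS]big_mkcond /=; apply: eq_bigr => v _.
  by rewrite /ind; case: (v \in Q); rewrite ?expr1n ?expr0n.
have -> : bform e (ind Q) (ind Q) = \sum_(u in Q) (#|Q|%:R - 1).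
  rewrite bform_ind [RHS]big_mkcond /=; apply: eq_bigr => u _.
  rewrite /ind; case: (boolP (u \in Q)) => uQ; last by rewrite mul0r.
  rewrite mul1r -sum1_card natr_sum (bigD1 u) //= [in RHS](bigD1 u) //= ei add0r.
  rewrite addrAC subrr add0r; apply: eq_bigr => v /andP[vQ vu]; by rewrite cQ // eq_sym vu.
by rewrite sumr_const -mulr_natr; ring.
Qed.

(** Extend [x] by the best constant on [Q]. A clique of [m] vertices with the same neighbors in [T]
    thus acts as a tail of coefficient [m / (t + m - 1)], which tends to 1 as the clique grows and
    so passes [1 / y]. *)
Lemma tailed_clique t T (Q : {set V}) S : 0 < t -> psd e t -> S \subset T -> [disjoint T & Q] -> (0 < #|Q|)%N ->
  {in Q &, forall u v, e u v = (u != v)} ->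
  {in T & Q, forall u v, e u v = (u \in S)} ->
  tailed t (#|Q|%:R / (t + #|Q|%:R - 1)) T S.
Proof.
move=> t0 ps ST dTQ Q0 cQ TQ x sx; set s := \sum_(v in _) x v.
set m : R := #|Q|%:R.
have m1 : 1 <= m by rewrite ler1n.
have den : 0 < t + m - 1 by lra.
have := ps (x \+ ((- s / (t + m - 1)) \*o ind Q)).
rewrite qformD qformZ qform_clique // bformC bformZl bformC (bform_supp _ sx) -/m.
rewrite (_ : \sum_v _ = 0); last first.
  rewrite (eq_bigr (fun v => (- s / (t + m - 1)) * (x v * ind Q v))) => [|v _ /=]; last by ring.
  by rewrite -mulr_sumr (supp_in_orth dTQ sx) mulr0.
rewrite (_ : \sum_(u in T) _ = s * m); last first.
  rewrite /s mulr_suml big_mkcond [RHS]big_mkcond /=; apply: eq_bigr => u _.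
  case: (boolP (u \in T)) => uT; last first.
    by case: (boolP (u \in S)) => // uS; rewrite (subsetP ST _ uS) in uT.
  rewrite (eq_bigr (fun=> (u \in S)%:R)) => [|v vQ]; last by rewrite TQ.
  rewrite sumr_const -[X in _ * X]mulr_natl -/m.
  by case: (u \in S); rewrite ?mulr1 ?mulr0.
move=> h; apply: le_trans h _.
by rewrite le_eqVlt; apply/orP; left; apply/eqP; field; rewrite gt_eqF.
Qed.

End Forms.

(** * Twelve graphs *)

Section Certificates.
Import BinInt.
(* [BinInt] rebinds the scope keys of [int] and [nat]. *)
Delimit Scope Z_scope with BZ.
Delimit Scope nat_scope with N.

Definition cert_F1 : seq (seq Z) := [::
  [:: 2; -2; 2; -2; -1]]%BZ.
Definition edges_F1 : seq (nat * nat) := [:: (0, 1); (1, 2); (2, 3); (3, 0); (0, 4)]%N.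

Definition cert_F2 : seq (seq Z) := [::
  [:: -2; 1; 0; -1; 2; 1]; [:: 2; -2; 2; -2; 0; -1]; [:: -2; 0; -2; -1; -1; 0]; [:: 1; 1; -1; 2; -1; 0];
  [:: 2; 0; 2; -1; 0; -1]; [:: -1; 0; 1; -1; 1; 1]; [:: -1; 0; -2; 1; 0; -1]; [:: -1; 0; 1; 1; 0; 2];
  [:: 2; -1; 0; 1; 0; -1]; [:: 1; 0; -1; 2; 0; 1]; [:: -2; 2; -1; 0; 1; 1]; [:: 0; 3; -2; 1; 0; 2];
  [:: 0; 0; 1; -2; 3; 2]; [:: -1; 3; -1; -1; 3; 0]; [:: -2; 0; 2; -1; 3; 1]; [:: 2; -3; 1; -2; 0; -1];
  [:: 2; 0; -2; 4; -3; -1]; [:: -2; 3; -4; 2; 0; 1]; [:: -4; -1; 1; -2; 3; 2]; [:: 4; -3; 2; -1; 1; -2];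
  [:: -5; 3; -1; -1; 3; 1]; [:: -4; 3; -2; 2; 3; 2]; [:: -4; 3; 2; -2; 3; 2]; [:: -4; 3; -2; -2; 3; 2];
  [:: 5; -3; 1; 1; -3; -4]]%BZ.
Definition edges_F2 : seq (nat * nat) := [:: (0, 1); (1, 2); (2, 3); (3, 4); (4, 0); (0, 5)]%N.

Definition cert_F3 : seq (seq Z) := [::
  [:: 1; -2; 3; -2; 1; -2]; [:: -1; 0; -2; 1; -2; 0]; [:: -2; 0; -1; -2; 1; 0]; [:: 1; 0; 0; 0; 1; 1];
  [:: -2; 1; 0; -1; -1; 0]; [:: 1; -2; 1; 0; -1; 0]; [:: -1; 0; 1; -2; 1; 0]; [:: -1; -1; 0; 1; -2; 0];
  [:: -1; 2; 0; 1; 1; 0]; [:: 0; -1; 2; 0; 2; 1]; [:: -2; 0; -2; 1; 0; -1]; [:: -1; 2; 0; 2; -1; 0];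
  [:: -1; 2; -3; 2; -1; 0]; [:: -2; 0; 2; -1; 1; -3]; [:: 1; -1; 2; 0; -2; -3]; [:: 0; -1; 2; -4; 2; -3];
  [:: 2; -4; 2; -1; 0; -3]; [:: -1; 1; -6; 4; -2; 3]; [:: 2; -4; 6; -1; 1; -3]; [:: 1; -5; 6; -4; 2; -3];
  [:: 2; -4; 6; -5; 1; -3]]%BZ.
Definition edges_F3 : seq (nat * nat) := [:: (0, 1); (1, 2); (2, 3); (3, 4); (2, 5)]%N.

Definition cert_F4 : seq (seq Z) := [::
  [:: 2; -2; -1; 2; -1; -1]; [:: -1; 0; 2; 0; 2; 1]; [:: 1; 0; -1; 1; 0; 0]; [:: 2; 0; 0; -1; -1; 2];
  [:: 0; 0; 1; -2; -1; 1]; [:: -1; 0; 0; 1; 2; 1]; [:: 1; 0; 0; -1; 1; 2]; [:: 0; 1; 1; 1; 2; 0];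
  [:: 2; 0; 0; 1; -1; 1]; [:: -2; 0; 0; -2; 1; 1]; [:: 0; -3; 1; 1; -2; -1]; [:: 0; 1; -3; 1; -2; -1];
  [:: -1; -1; 3; 0; 1; 2]; [:: -1; 3; -1; 0; 1; 2]; [:: 2; -1; -2; 2; -1; -1]; [:: 4; -3; 1; 1; -2; -1];
  [:: 1; 1; -3; 4; -1; -2]; [:: -4; -1; 3; -1; 2; 1]; [:: 1; -3; 1; 4; -1; -2]; [:: 1; -3; -3; 4; -1; -2];
  [:: 4; -3; -3; 1; -2; -1]; [:: -5; 3; 3; -4; 1; 2]; [:: -4; 3; 3; -5; 2; 1]; [:: -5; 3; 3; -4; 4; 2];
  [:: 4; -3; -3; 5; -2; -4]]%BZ.
Definition edges_F4 : seq (nat * nat) := [:: (0, 1); (0, 2); (1, 2); (1, 3); (2, 3); (0, 4); (3, 5)]%N.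

Definition cert_F5 : seq (seq Z) := [::
  [:: -1; -1; -1; 2; 2; -1]; [:: 1; 1; 0; 0; -2; 2]; [:: 0; -1; 0; -2; -1; -2]; [:: 1; -1; 2; 0; -1; 2];
  [:: -2; 2; 2; -1; 1; 0]; [:: -2; -2; 2; 1; -1; 0]; [:: 0; -1; -1; 1; 2; -1]; [:: -1; -1; 0; 1; 2; -1];
  [:: -1; -1; 2; 0; 1; 1]; [:: -1; -1; -1; 0; 2; -1]; [:: 1; 0; 1; -1; -2; 1]; [:: -2; 1; 1; 0; -1; -1];
  [:: -1; 2; -1; 0; 1; 1]; [:: 1; -2; 1; 0; 2; -1]; [:: -2; -2; 1; 0; 2; -1]; [:: 2; -2; -2; -1; 1; 0];
  [:: 2; -1; 2; 0; -2; 1]; [:: 1; 1; 1; -3; 0; -2]; [:: 2; 2; 2; -3; -1; 1]; [:: 2; 2; -2; -3; -1; 1];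
  [:: -2; 2; -2; 3; 1; -1]; [:: 2; -2; -2; 3; 1; -1]; [:: -1; -1; -1; 3; 4; -2]; [:: -2; -2; -2; 3; 5; -1];
  [:: 5; 1; 1; -3; -4; 2]; [:: 1; 1; 5; -3; -4; 2]; [:: 1; 5; 1; -3; -4; 2]; [:: 2; 2; 2; -3; -5; 4]]%BZ.
Definition edges_F5 : seq (nat * nat) := [:: (0, 1); (0, 2); (1, 2); (0, 3); (1, 3); (2, 3); (0, 4); (1, 4); (2, 4); (4, 5)]%N.

Definition cert_F6 : seq (seq Z) := [::
  [:: -2; 2; 1; 2; -1; -1]; [:: -1; 0; 2; 0; 2; 1]; [:: -1; -1; 0; 0; 1; -1]; [:: 0; 0; 0; -1; 1; 1];
  [:: 1; 1; 0; 0; 1; 2]; [:: 0; 0; 1; 2; -1; -1]; [:: 2; -1; -1; 0; 0; 1]; [:: 1; 0; 1; 1; -1; 1];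
  [:: 0; 0; 2; 2; 1; -1]; [:: 0; 1; 2; -1; 2; 0]; [:: 2; 0; -1; -2; 1; 1]; [:: 2; 0; -1; -1; -2; -1];
  [:: -2; 0; 1; 2; 1; -1]; [:: 1; 0; -2; 1; -1; -2]; [:: 2; 0; -1; 2; -2; -1]; [:: -1; 3; 1; 0; -1; 2];
  [:: 0; -3; -2; -1; 2; 1]; [:: 4; 1; -2; -1; -2; 1]; [:: 1; -3; -1; -4; 1; 2]; [:: 4; -3; -2; -1; -2; 1];
  [:: -4; 3; 2; 1; -2; -1]; [:: -5; 3; 1; 4; -1; -2]; [:: -4; 3; 2; 5; -2; -1]; [:: -2; 3; 1; 4; -5; -2];
  [:: -5; 3; 4; 4; -1; -2]; [:: -4; 3; 2; 5; -2; -4]]%BZ.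
Definition edges_F6 : seq (nat * nat) := [:: (0, 1); (0, 2); (0, 3); (0, 4); (1, 4); (3, 4); (3, 5)]%N.

Definition cert_F7 : seq (seq Z) := [::
  [:: 1; -2; 1; 0; -1; 1]; [:: -1; 0; 2; -4; 3; -1]; [:: -1; 0; 1; 1; 0; 2]; [:: 2; 0; 1; 1; 0; -1];
  [:: -1; 0; -2; 1; 0; -1]; [:: 1; 1; 0; 2; 0; 1]; [:: -1; 1; 0; -1; 0; -1]; [:: 2; 0; 2; -1; 0; -1];
  [:: -1; 0; -1; 2; 0; 2]; [:: 1; 0; -2; 1; 0; -2]; [:: -1; 1; 0; -1; 2; -1]; [:: 2; 0; -1; 2; 0; -1];
  [:: -1; 3; -1; 2; 0; -1]; [:: -1; 0; 2; -1; 3; -1]; [:: 1; 3; -2; 1; 0; -2]; [:: -1; 0; -1; 2; -3; 2];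
  [:: -2; 3; -2; 1; 0; 1]; [:: 2; 0; -1; 2; -3; -1]; [:: 1; -3; 1; 1; -3; 1]; [:: 2; -3; 2; -1; 1; 2];
  [:: -1; 3; -4; 2; 0; -1]; [:: 2; 1; -1; 2; -3; 2]; [:: 1; -3; 1; 1; -3; 4]; [:: -2; 3; -2; 1; 3; -2];
  [:: 2; -3; -1; 2; -3; 2]; [:: 4; -3; 1; 1; -3; 1]; [:: 2; -3; 2; 2; -3; 2]]%BZ.
Definition edges_F7 : seq (nat * nat) := [:: (0, 1); (1, 2); (2, 3); (3, 4); (4, 0); (5, 0); (5, 1); (5, 4)]%N.

Definition cert_F8 : seq (seq Z) := [::
  [:: 2; 2; -2; -2; 2; -1]]%BZ.
Definition edges_F8 : seq (nat * nat) := [:: (2, 3); (0, 2); (0, 3); (1, 2); (1, 3); (4, 2); (4, 3); (4, 5)]%N.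

Definition cert_F9 : seq (seq Z) := [::
  [:: 2; 2; -3; -3; 5; -4]; [:: 1; 2; -2; -1; 2; 0]; [:: 2; 2; 1; -2; 2; 2]; [:: -1; 1; 0; -2; 1; -2];
  [:: 2; -2; -1; -1; -1; 0]; [:: -1; -1; 0; 0; -2; 1]; [:: -2; 1; 0; 0; 1; -2]; [:: -1; 2; 0; 0; -1; 2];
  [:: 2; -1; 0; 0; 2; -1]; [:: 1; 1; -2; -1; 2; -1]; [:: 1; 1; -1; -2; 2; -1]; [:: -1; -1; 3; -1; 0; 2];
  [:: 1; 1; 1; -3; 0; -2]; [:: 2; -2; 3; -1; -1; 1]; [:: -2; -2; 3; -1; -1; 1]; [:: 2; -2; 1; -3; 1; -1];
  [:: 2; -2; -1; 3; -1; 1]; [:: 2; -2; -3; 1; 1; -1]; [:: 2; 2; 1; -3; 1; -1]; [:: 1; 1; 1; -3; 4; -2];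
  [:: 2; 2; -3; -3; 1; -1]; [:: 1; 1; -3; 1; 4; -2]; [:: 1; 1; -3; -3; 4; -2]; [:: 2; 2; -3; -3; 5; -1];
  [:: 1; 5; -3; -3; 4; -2]; [:: -5; -1; 3; 3; -4; 2]]%BZ.
Definition edges_F9 : seq (nat * nat) := [:: (0, 1); (2, 3); (0, 2); (0, 3); (1, 2); (1, 3); (4, 2); (4, 3); (4, 5)]%N.

Definition cert_F10 : seq (seq Z) := [::
  [:: 2; -1; 2; -2; -1]]%BZ.
Definition edges_F10 : seq (nat * nat) := [:: (0, 1); (1, 2); (2, 3); (3, 0); (4, 0); (4, 1); (4, 2)]%N.

Definition cert_F11 : seq (seq Z) := [::
  [:: 3; -1; -1; -1; -2; 1]; [:: -2; 1; 1; 1; 1; 0]; [:: -2; 1; 1; 1; 2; -1]]%BZ.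
Definition edges_F11 : seq (nat * nat) := [:: (0, 1); (0, 2); (0, 3); (0, 4); (4, 5)]%N.

Definition cert_F12 : seq (seq Z) := [::
  [:: 3; -1; -1; -2; -2; 1]; [:: 2; -1; 1; 0; -1; 2]; [:: 1; 1; -1; 0; 0; 1]; [:: -1; 2; 2; 0; 1; 2];
  [:: 0; -1; -1; 0; -2; 1]; [:: -2; 1; 0; -1; 0; -2]; [:: 0; -1; 2; 0; 2; -1]; [:: 0; 2; -1; 0; -1; 2];
  [:: 0; -1; 2; 0; -1; 2]; [:: 0; -2; 1; 0; -2; 1]; [:: -3; 1; 1; 0; 2; -1]; [:: -2; -2; 2; -1; 1; 0];
  [:: 2; -2; 2; 1; -1; 0]; [:: -2; 1; 1; 3; 0; 2]; [:: 1; -2; -2; -3; -1; 0]; [:: -2; 1; 1; 3; 4; -2];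
  [:: 6; -2; -2; -3; -1; 1]; [:: 6; -1; -1; -3; -4; 2]; [:: 6; -2; -2; -3; -5; 1]; [:: 8; -1; -6; -4; -5; 3];
  [:: 8; -6; -1; -4; -5; 3]; [:: 12; -4; -4; -6; -10; 9]]%BZ.
Definition edges_F12 : seq (nat * nat) := [:: (0, 1); (0, 2); (0, 3); (0, 4); (1, 2); (4, 5)]%N.

(* Attach an infinite path to a graph of this list along any nonempty set of vertices: at the
   critical level the form is not positive definite. Each [cert_Fi] contains, for every such
   set, an integer vector on which it is nonpositive (the path being replaced by its Schur
   complement), except for the two sets in [tight], which are exactly critical. *)
Definition forbidden : seq (nat * seq (nat * nat) * seq (seq Z)) := [::
  (5%N, edges_F1, cert_F1);
  (6%N, edges_F2, cert_F2);
  (6%N, edges_F3, cert_F3);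
  (6%N, edges_F4, cert_F4);
  (6%N, edges_F5, cert_F5);
  (6%N, edges_F6, cert_F6);
  (6%N, edges_F7, cert_F7);
  (6%N, edges_F8, cert_F8);
  (6%N, edges_F9, cert_F9);
  (5%N, edges_F10, cert_F10);
  (6%N, edges_F11, cert_F11);
  (6%N, edges_F12, cert_F12)].

Definition adj (E : seq (nat * nat)) (i j : nat) : bool := ((i, j) \in E) || ((j, i) \in E).

Fixpoint bitseqs (n : nat) : seq bitseq :=
  if n is n'.+1 then map (cons true) (bitseqs n') ++ map (cons false) (bitseqs n') else [:: [::]].

Lemma mem_bitseqs (m : bitseq) : m \in bitseqs (size m).
Proof.
elim: m => //= b m IH; rewrite mem_cat; apply/orP.
by case: b; [left|right]; apply/mapP; exists m.
Qed.

Definition sumZ (n : nat) (f : nat -> Z) : Z := foldr (fun i s => (f i + s)%BZ) 0%BZ (iota 0 n).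

(* The rational constants come from the bounds [y^2 + 1 <= 93/40] and [61/53 < y < 38/33]. *)
Definition cert_bound (a b c : Z) : bool :=
  ((93 * 33 * 53) * a + (if 0 <=? b then (38 * 40 * 53) * b else (61 * 40 * 33) * b)
    <=? (40 * 33 * 53) * (c * c))%BZ.

Definition cert_ok (n : nat) (E : seq (nat * nat)) (m : bitseq) (x : seq Z) : bool :=
  let X i := nth 0%BZ x i in
  let a := sumZ n (fun i => X i * X i)%BZ in
  let b := sumZ n (fun i => sumZ n (fun j => if adj E i j then X i * X j else 0))%BZ in
  let c := sumZ n (fun i => if nth false m i then X i else 0%BZ) in
  (0 <? a)%BZ &&
  cert_bound a b c.

(** [edges_F3] is the tree with arms of lengths 1, 2 and 2, and the two sets are the ends of its
    arms of length 2. An infinite path attached there gives the tree with arms 1, 2 and infinity,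
    critical exactly at [lambda_star]; rational bounds with slack cannot certify it. *)
Definition tight (E : seq (nat * nat)) (m : bitseq) : bool :=
  (E == edges_F3) &&
  (m \in [:: [:: true; false; false; false; false; false];
             [:: false; false; false; false; true; false]]).

Definition all_certified : bool :=
  all (fun F : nat * seq (nat * nat) * seq (seq Z) =>
    let: (n, E, xs) := F in
    all (fun m => [|| ~~ has id m, tight E m | has (cert_ok n E m) xs]) (bitseqs n)) forbidden.

Lemma all_certifiedT : all_certified.
Proof. by vm_compute. Qed.

Section Plastic.
Variables (R : realType) (y : R).
Hypotheses (y0 : 0 < y) (y6 : y ^+ 6 = y ^+ 2 + 1).

(** The square [u] of [y] satisfies [u * (u ^+ 2 - 1) = 1], and the left side increases beyond 1, so
    evaluating it at a rational point compares that point with [u]. Here 102/77 lies between the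
    square of 61/53 and [u], and 53/40 between [u] and the square of 38/33. *)
Lemma root_bounds : [/\ 61 / 53 < y, y < 38 / 33 & y ^+ 2 + 1 <= 93 / 40].
Proof.
have yp := y0; have [u Eu] : exists u, u = y ^+ 2 by exists (y ^+ 2).
have u3 : u * (u ^+ 2 - 1) = 1.
  by rewrite Eu -exprM; have := y6; rewrite (_ : y ^+ 6 = y ^+ 2 * y ^+ 4); [lra | ring].
have u0 : 0 < u by rewrite Eu exprn_gt0.
have mono (a b : R) : 0 <= a -> a <= b -> 1 <= b -> a * (a ^+ 2 - 1) <= b * (b ^+ 2 - 1).
  move=> a0 ab b1.
  have b2 : 0 <= (b - 1) * (b + 1) by apply: mulr_ge0; lra.
  have bu : 0 <= b * a by apply: mulr_ge0; lra.
  have : 0 <= (b - a) * (b ^+ 2 + b * a + a ^+ 2 - 1).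
    by apply: mulr_ge0; have := sqr_ge0 a; lra.
  lra.
have ub : u <= 53 / 40.
  rewrite leNgt; apply/negP => h.
  have := @mono (53 / 40) u; rewrite u3 => /(_ _ _ _) h1.
  have {h1} := h1 _ _ _; lra.
split; last by rewrite -Eu; lra.
- rewrite ltNge; apply/negP => h.
  have h2 : u <= 102 / 77.
    have : 0 <= (61 / 53 - y) * (61 / 53 + y) by apply: mulr_ge0; lra.
    rewrite Eu; lra.
  have := @mono u (102 / 77); rewrite u3 => h1; have {h1} := h1 _ _ _; lra.
- rewrite ltNge; apply/negP => h.
  have : 0 <= (y - 38 / 33) * (38 / 33 + y) by apply: mulr_ge0; lra.
  rewrite Eu in ub; lra.
Qed.

Definition evZ (z : Z) : R := (int_of_Z z)%:~R.

Lemma evZ_sum n f : evZ (sumZ n f) = \sum_(i < n) evZ (f i).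
Proof.
rewrite -(big_mkord xpredT (fun i => evZ (f i))) /index_iota subn0 /sumZ.
elim: (iota 0 n) => [|i s IH]; first by rewrite big_nil.
by rewrite big_cons /= -IH /evZ -rmorphD -rmorphD.
Qed.

Lemma evZ_ge0 z : (0 <=? z)%BZ -> 0 <= evZ z.
Proof. by rewrite /evZ ler0z => h; lia. Qed.

Lemma evZM a b : evZ (a * b)%BZ = evZ a * evZ b.
Proof. by rewrite /evZ -rmorphM -rmorphM. Qed.

Lemma cert_bound_sound a b c : (0 <? a)%BZ -> cert_bound a b c ->
  (y ^+ 2 + 1) * evZ a + y * evZ b <= evZ c ^+ 2.
Proof.
move=> a0 h; have [y1 y2 y3] := root_bounds.
have a0' : 0 <= evZ a by apply: evZ_ge0; lia.
have D u v : evZ (u + v)%BZ = evZ u + evZ v by rewrite /evZ -rmorphD -rmorphD.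
have {}h : 93 / 40 * evZ a + (if (0 <=? b)%BZ then 38 / 33 * evZ b else 61 / 53 * evZ b) <= evZ c ^+ 2.
  have hz : evZ ((93 * 33 * 53) * a + (if (0 <=? b)%BZ then (38 * 40 * 53) * b else (61 * 40 * 33) * b))%BZ
      <= evZ ((40 * 33 * 53) * (c * c))%BZ.
    by rewrite /evZ ler_int; move: h; rewrite /cert_bound; clear; lia.
  have e93 : evZ 93%BZ = 93 by [].
  have e33 : evZ 33%BZ = 33 by [].
  have e53 : evZ 53%BZ = 53 by [].
  have e38 : evZ 38%BZ = 38 by [].
  have e40 : evZ 40%BZ = 40 by [].
  have e61 : evZ 61%BZ = 61 by [].
  move: hz; rewrite D; case: (0 <=? b)%BZ; rewrite !evZM ?e93 ?e33 ?e53 ?e38 ?e40 ?e61; lra.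
have h1 := ler_wpM2r a0' y3.
case: ifP h => [/evZ_ge0 b0|bN] h.
  by have h2 := ler_wpM2r b0 (ltW y2); lra.
have b0 : evZ b <= 0 by rewrite /evZ lerz0; lia.
by have h2 := ler_wnM2r b0 (ltW y1); lra.
Qed.

Lemma cert_sound n E m x : cert_ok n E m x ->
  exists2 X : 'I_n -> R, (exists i, X i != 0) &
   (y ^+ 2 + 1) * (\sum_(i < n) X i ^+ 2) + y * (\sum_(i < n) \sum_(j < n) (adj E i j)%:R * X i * X j)
     <= (\sum_(i < n | nth false m i) X i) ^+ 2.
Proof.
rewrite /cert_ok; set a := sumZ n _; set b := sumZ n _; set c := sumZ n _.
case/andP=> a0 h; pose X (i : 'I_n) := evZ (nth 0%BZ x i).
have Ea : \sum_(i < n) X i ^+ 2 = evZ a.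
  by rewrite evZ_sum; apply: eq_bigr => i _; rewrite evZM expr2.
have Eb : \sum_(i < n) \sum_(j < n) (adj E i j)%:R * X i * X j = evZ b.
  rewrite evZ_sum; apply: eq_bigr => i _; rewrite evZ_sum; apply: eq_bigr => j _.
  by case: (adj E i j); rewrite ?mul0r ?mul1r ?evZM.
have Ec : \sum_(i < n | nth false m i) X i = evZ c.
  by rewrite big_mkcond evZ_sum; apply: eq_bigr => i _; case: (nth false m i).
exists X.
  apply/existsP; apply: contraLR a0 => /existsPn h0.
  have : evZ a = 0.
    by rewrite -Ea big1 // => i _; have := h0 i; rewrite negbK => /eqP ->; rewrite expr0n.
  by move=> /eqP; rewrite /evZ intr_eq0; lia.
by rewrite Ea Eb Ec; apply: cert_bound_sound.
Qed.

Lemma F3_form (X : 'I_6 -> R) (a0 a1 a2 a3 a4 a5 : R) :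
  (forall i : 'I_6, X i = [:: a0; a1; a2; a3; a4; a5]`_i) ->
  \sum_(i < 6) \sum_(j < 6) (adj edges_F3 i j)%:R * X i * X j =
  2 * (a0 * a1 + a1 * a2 + a2 * a3 + a3 * a4 + a2 * a5).
Proof.
move=> hX.
pose f (i j : nat) : R := (adj edges_F3 i j)%:R * [:: a0; a1; a2; a3; a4; a5]`_i * [:: a0; a1; a2; a3; a4; a5]`_j.
rewrite (eq_bigr (fun i : 'I_6 => \sum_(0 <= j < 6) f i j)) => [|i _]; last first.
  by rewrite big_mkord; apply: eq_bigr => j _; rewrite /f !hX.
rewrite -(big_mkord xpredT (fun i => \sum_(0 <= j < 6) f i j)).
rewrite /index_iota /= !big_cons !big_nil /f /adj !inE /=; ring.
Qed.

(** The vectors are restrictions of the null vector of the tree with arms 1, 2 and infinity at the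
    critical level. Its signs alternate, and its absolute values grow by the factor [y] along the
    infinite arm up to the branch vertex. Equality therefore holds; it is checked by reducing powers
    of [z = y ^+ 2] modulo [z ^+ 3 = z + 1]. *)
Lemma tight_sound (E : seq (nat * nat)) (m : bitseq) : tight E m ->
  exists2 X : 'I_6 -> R, (exists i, X i != 0) &
   (y ^+ 2 + 1) * (\sum_(i < 6) X i ^+ 2) + y * (\sum_(i < 6) \sum_(j < 6) (adj E i j)%:R * X i * X j)
     <= (\sum_(i < 6 | nth false m i) X i) ^+ 2.
Proof.
case/andP=> /eqP -> hm.
have [z Ez] : exists z, z = y ^+ 2 by exists (y ^+ 2).
have z3 : z ^+ 3 = z + 1 by rewrite Ez -exprM y6.
have z4 : z ^+ 4 = z ^+ 2 + z by rewrite exprS z3; ring.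
have z5 : z ^+ 5 = z ^+ 2 + z + 1 by rewrite exprS z4 mulrDr -exprS z3; ring.
have z6 : z ^+ 6 = z ^+ 2 + 2 * z + 1 by rewrite exprS z5 !mulrDr -exprS z3; ring.
have z7 : z ^+ 7 = 2 * z ^+ 2 + 2 * z + 1 by rewrite exprS z6 !mulrDr -exprS z3; ring.
have z8 : z ^+ 8 = 2 * z ^+ 2 + 3 * z + 2.
  by rewrite exprS z7 !mulrDr (mulrCA z) -exprS z3; ring.
have z9 : z ^+ 9 = 3 * z ^+ 2 + 4 * z + 2.
  by rewrite exprS z8 !mulrDr (mulrCA z) -exprS z3; ring.
have z10 : z ^+ 10 = 4 * z ^+ 2 + 5 * z + 3.
  by rewrite exprS z9 !mulrDr (mulrCA z) -exprS z3; ring.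
have z11 : z ^+ 11 = 5 * z ^+ 2 + 7 * z + 4.
  by rewrite exprS z10 !mulrDr (mulrCA z) -exprS z3; ring.
have key (s : seq R) (i : nat) : (i < 6)%N -> (i == 0)%N || (i == 4)%N ->
    s = (if i == 0%N then [:: y ^+ 6; - y ^+ 7; y ^+ 8; - y ^+ 5; 1; - y ^+ 3]
         else [:: 1; - y ^+ 5; y ^+ 8; - y ^+ 7; y ^+ 6; - y ^+ 3]) ->
    m = mkseq (eq_op^~ i) 6 ->
    exists2 X : 'I_6 -> R, (exists i, X i != 0) &
   (y ^+ 2 + 1) * (\sum_(i < 6) X i ^+ 2) + y * (\sum_(i < 6) \sum_(j < 6) (adj edges_F3 i j)%:R * X i * X j)
     <= (\sum_(i < 6 | nth false m i) X i) ^+ 2.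
  move=> i6 i04 Es ->; exists (fun k => s`_k).
    exists (inord 2); rewrite inordK // Es.
    by case: (i == 0)%N; rewrite /= expf_neq0 // gt_eqF.
  have Ei : \sum_(k < 6 | nth false (mkseq (eq_op^~ i) 6) k) s`_k = s`_i.
    rewrite (bigD1 (Ordinal i6)) ?nth_mkseq ?eqxx //= big1 ?addr0 // => k.
    by rewrite nth_mkseq // => /andP[/eqP ki /negP[]]; apply/eqP/val_inj.
  rewrite Ei.
  have -> : \sum_(k < 6) s`_k ^+ 2 =
      s`_0 ^+ 2 + s`_1 ^+ 2 + s`_2 ^+ 2 + s`_3 ^+ 2 + s`_4 ^+ 2 + s`_5 ^+ 2.
    by rewrite -(big_mkord xpredT (fun k => s`_k ^+ 2)) /index_iota /= !big_cons big_nil; ring.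
  rewrite (@F3_form _ s`_0 s`_1 s`_2 s`_3 s`_4 s`_5); last first.
    by case=> [[|[|[|[|[|[|]]]]]]].
  have e : y ^+ 2 + 1 = y ^+ 6 by rewrite y6.
  have fin : z ^+ 3 * (z ^+ 6 + z ^+ 7 + z ^+ 8 + z ^+ 5 + 1 + z ^+ 3)
      - 2 * (2 * z ^+ 7 + z ^+ 8 + z ^+ 3 + z ^+ 6) = z ^+ 6.
    transitivity (z ^+ 9 + z ^+ 10 + z ^+ 11 + z ^+ 8 + z ^+ 3 + z ^+ 6
      - 2 * (2 * z ^+ 7 + z ^+ 8 + z ^+ 3 + z ^+ 6)); first by ring.
    by rewrite z3 z6 z7 z8 z9 z10 z11; ring.
  rewrite le_eqVlt; apply/orP; left; apply/eqP; rewrite e Es.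
  case/orP: i04 => /eqP -> /=; rewrite Ez in fin.
  - by transitivity ((y ^+ 2) ^+ 6); [rewrite -fin | ]; ring.
  - by transitivity ((y ^+ 2) ^+ 6); [rewrite -fin | ]; ring.
move: hm; rewrite !inE => /orP[] /eqP hm.
  by apply: (key _ 0%N _ _ erefl).
by apply: (key _ 4%N _ _ erefl).
Qed.

Lemma forbidden_not_tailed F (S : pred nat) : F \in forbidden -> (exists2 i, (i < F.1.1)%N & S i) ->
  exists2 X : 'I_F.1.1 -> R, (exists i, X i != 0) &
   (y ^+ 2 + 1) * (\sum_i X i ^+ 2)
     + y * (\sum_(i < F.1.1) \sum_(j < F.1.1) (adj F.1.2 i j)%:R * X i * X j)
     <= (\sum_(i < F.1.1 | S i) X i) ^+ 2.
Proof.
move=> hF [i iF Si].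
have := allP all_certifiedT F hF; case: F hF iF => [[n E] xs] /= hF iF.
pose m := mkseq S n.
have sm : size m = n by rewrite size_mkseq.
have eqS : (fun k : 'I_n => nth false m k) =1 (fun k : 'I_n => S k).
  by move=> k; rewrite nth_mkseq.
move=> /allP /(_ m); rewrite -{1}sm mem_bitseqs => /(_ isT) /or3P[].
- by case/hasP; exists (S i) => //; apply/mapP; exists i; rewrite // mem_iota.
- move=> ti; have [n6 EE] : n = 6 /\ E = edges_F3.
    split; last by case/andP: ti => /eqP.
    by rewrite -sm; case/andP: ti => _; rewrite !inE => /orP[] /eqP ->.
  clearbody m; clear sm; subst n; have [X h1 h2] := tight_sound ti; exists X => //.
  by rewrite (eq_bigl _ _ eqS) in h2.
- case/hasP => x _ /cert_sound [X h1 h2]; exists X => //.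
  by rewrite (eq_bigl _ _ eqS) in h2.
Qed.

End Plastic.

End Certificates.

Local Notation Z := BinInt.Z.

Section Copies.
Variables (V : finType) (e : rel V).

Definition copy_of (n : nat) (E : seq (nat * nat)) : Prop :=
  exists2 f : 'I_n -> V, injective f & forall i j : 'I_n, e (f i) (f j) = adj E i j.

Definition forbidden_free : Prop := forall F, F \in forbidden -> ~ copy_of F.1.1 F.1.2.

(** Phrased by cuts, which is the form needed to enlarge a vertex set by one adjacent vertex at a
    time. *)
Definition connected_graph : Prop := forall T : {set V},
  T != set0 -> T != setT -> exists2 p, p \notin T & exists2 q, q \in T & e p q.

End Copies.

Section Push.
Variables (R : realType) (U V : finType) (e : rel V) (f : U -> V) (X : U -> R).
Hypothesis fi : injective f.

Definition push (v : V) : R := \sum_(i | f i == v) X i.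

Lemma push_f i : push (f i) = X i.
Proof. by rewrite /push (big_pred1 i) // => j; rewrite /= (inj_eq fi) eq_sym. Qed.

Lemma push_supp : supp_in (f @: setT) push.
Proof.
move=> v hv; rewrite /push big_pred0 // => i; apply: contraNF hv => /eqP <-.
exact: imset_f.
Qed.

Lemma sum_push (F : V -> R) : (forall v, v \notin f @: setT -> F v = 0) ->
  \sum_v F v = \sum_i F (f i).
Proof.
move=> h; rewrite (bigID (mem (f @: setT))) /= addrC big1 ?add0r //.
rewrite big_imset /=; last by move=> ? ? _ _ /fi.
by apply: eq_bigl => i; rewrite inE.
Qed.

Lemma qform_push (t : R) : qform e t push = qform (fun i j => e (f i) (f j)) t X.
Proof.
rewrite /qform sum_push => [|v /push_supp ->]; last by rewrite expr0n.
rewrite sum_push => [|v hv]; last first.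
  by apply: big1 => u _; rewrite (push_supp hv) mulr0 mul0r.
congr (_ * _ + _); first by apply: eq_bigr => i _; rewrite push_f.
apply: eq_bigr => i _; rewrite sum_push => [|v /push_supp ->]; last by rewrite mulr0.
by apply: eq_bigr => j _; rewrite !push_f.
Qed.

Lemma sum_push_in (S : {set V}) : \sum_(v in S) push v = \sum_(i | f i \in S) X i.
Proof.
rewrite big_mkcond sum_push => [|v /push_supp ->]; last by case: ifP.
by rewrite [RHS]big_mkcond; apply: eq_bigr => i _; rewrite push_f.
Qed.

End Push.

(** * Graphs that carry an infinite path at the critical level *)

Section ForbiddenFree.
Variables (R : realType) (y : R).
Hypotheses (y0 : 0 < y) (y6 : y ^+ 6 = y ^+ 2 + 1).
Variables (V : finType) (e : rel V).
Hypotheses (es : symmetric e) (ei : irreflexive e).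
Local Notation ls := (y + y^-1).

Definition tail_attached (T : {set V}) : Prop :=
  exists S : {set V}, [/\ S != set0, S \subset T & stailed e ls y^-1 T S].

(** If [S] meets [T], restriction suffices. Otherwise [S] consists of [p] alone, and eliminating [p]
    preserves the coefficient: [1 / y] is a fixed point of [h -> (ls - h)^-1]. The tail is then
    attached along the neighbors of [p] in [T], a nonempty set. *)
Lemma tail_attached_step (T : {set V}) p : p \notin T -> (exists2 q, q \in T & e p q) ->
  tail_attached (p |: T) -> tail_attached T.
Proof.
move=> pT [q qT epq] [S [S0 ST hS]].
have yi : 0 < y^-1 by rewrite invr_gt0.
case: (eqVneq (S :&: T) set0) => [ST0|]; last first.
  by exists (S :&: T); split; rewrite ?subsetIr //; apply: stailed_sub hS; exact: subsetUr.
have {ST}ES : S = [set p].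
  apply/eqP; rewrite eqEsubset sub1set; apply/andP; split.
    apply/subsetP => v vS; have := subsetP ST v vS; rewrite !inE => /orP[//|vT].
    by have := in_set0 v; rewrite -ST0 inE vS vT.
  case/set0Pn: S0 => v vS; have := subsetP ST v vS; rewrite !inE => /orP[/eqP <- //|vT].
  by have := in_set0 v; rewrite -ST0 inE vS vT.
exists (T :&: [set v | e p v]); split.
- by apply/set0Pn; exists q; rewrite !inE qT.
- exact: subsetIl.
- have := @stailed_step R V e es ei ls y^-1 T p; rewrite addrK ES in hS *.
  by apply => //; have := y0; rewrite ltrDr.
Qed.

Lemma tail_attachedT (S : {set V}) : connected_graph e -> S != set0 ->
  stailed e ls y^-1 setT S -> forall T : {set V}, T != set0 -> tail_attached T.
Proof.
move=> conn S0 hS T; have [k] := ubnP #|~: T|; elim: k T => // k IH T kT T0.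
case: (eqVneq T setT) => [->|TT]; first by exists S; split; rewrite ?subsetT.
have [p pT hp] := conn T T0 TT; apply: (tail_attached_step pT hp); apply: IH.
  rewrite ltnS in kT; apply: leq_trans kT; apply: proper_card.
  apply/properP; split; last by exists p; rewrite !inE ?eqxx.
  by rewrite setCS subsetUr.
by apply/set0Pn; exists p; rewrite !inE eqxx.
Qed.

Lemma tail_attached_no_copy n E c : (n, E, c) \in forbidden ->
  (forall T : {set V}, T != set0 -> (#|T| <= 6)%N -> tail_attached T) -> ~ copy_of e n E.
Proof.
move=> hF hT [f fi fE].
have [n0 n6] : (0 < n)%N /\ (n <= 6)%N.
  have : all (fun F : nat * seq (nat * nat) * seq (seq Z) => (0 < F.1.1 <= 6)%N) forbidden by [].
  by move=> /allP /(_ _ hF) /andP[].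
have T0 : f @: setT != set0.
  by apply/set0Pn; exists (f (Ordinal n0)); exact: imset_f.
have T6 : (#|f @: setT| <= 6)%N by rewrite card_imset // cardsT card_ord.
have [S [S0 ST hS]] := hT _ T0 T6.
pose P (k : nat) := [exists i : 'I_n, (i == k :> nat) && (f i \in S)].
have PE (i : 'I_n) : P i = (f i \in S).
  apply/existsP/idP => [[j /andP[/eqP/val_inj -> //]]|h]; by exists i; rewrite eqxx.
have [|X hX le] := @forbidden_not_tailed R y y0 y6 (n, E, c) P hF.
  case/set0Pn: S0 => v vS; have /imsetP[i _ Ev] := subsetP ST v vS.
  by exists i; rewrite ?PE -?Ev.
rewrite /= in X hX le.
have := hS (push f X) (@push_supp R _ V f X) _.
rewrite qform_push // sum_push_in //.
have -> : \sum_(i | f i \in S) X i = \sum_(i < n | P i) X i by apply: eq_bigl => i; rewrite PE.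
have -> : qform (fun i j => e (f i) (f j)) ls X = ls * (\sum_i X i ^+ 2) +
    \sum_(i < n) \sum_(j < n) (adj E i j)%:R * X i * X j.
  congr (_ + _); apply: eq_bigr => i _; apply: eq_bigr => j _; by rewrite fE.
set A := \sum_i _ in le *; set B := \sum_i \sum_j _ in le *; set C := (\sum_(i < n | _) _) in le *.
move=> h; have {h} : 0 < ls * A + B - y^-1 * C ^+ 2.
  apply: h; case: hX => i Xi; exists (f i); by rewrite push_f.
rewrite -(pmulr_rgt0 _ y0) ltNge => /negP; apply.
rewrite (_ : y * _ = (y ^+ 2 + 1) * A + y * B - C ^+ 2); first by rewrite subr_le0.
by field; rewrite gt_eqF.
Qed.

Lemma stailed_forbidden_free (S : {set V}) : connected_graph e -> S != set0 ->
  stailed e ls y^-1 setT S -> forbidden_free e.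
Proof.
move=> conn S0 hS [[n E] c] hF; apply: (tail_attached_no_copy hF) => T T0 _.
exact: tail_attachedT hS _ T0.
Qed.

End ForbiddenFree.

(** * Integer representations from levels *)

Lemma mem_F1 : (5%N, edges_F1, cert_F1) \in forbidden.
Proof. by vm_compute. Qed.
Lemma mem_F2 : (6%N, edges_F2, cert_F2) \in forbidden.
Proof. by vm_compute. Qed.
Lemma mem_F3 : (6%N, edges_F3, cert_F3) \in forbidden.
Proof. by vm_compute. Qed.
Lemma mem_F4 : (6%N, edges_F4, cert_F4) \in forbidden.
Proof. by vm_compute. Qed.
Lemma mem_F5 : (6%N, edges_F5, cert_F5) \in forbidden.
Proof. by vm_compute. Qed.
Lemma mem_F6 : (6%N, edges_F6, cert_F6) \in forbidden.
Proof. by vm_compute. Qed.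
Lemma mem_F7 : (6%N, edges_F7, cert_F7) \in forbidden.
Proof. by vm_compute. Qed.
Lemma mem_F8 : (6%N, edges_F8, cert_F8) \in forbidden.
Proof. by vm_compute. Qed.
Lemma mem_F9 : (6%N, edges_F9, cert_F9) \in forbidden.
Proof. by vm_compute. Qed.
Lemma mem_F10 : (5%N, edges_F10, cert_F10) \in forbidden.
Proof. by vm_compute. Qed.
Lemma mem_F11 : (6%N, edges_F11, cert_F11) \in forbidden.
Proof. by vm_compute. Qed.
Lemma mem_F12 : (6%N, edges_F12, cert_F12) \in forbidden.
Proof. by vm_compute. Qed.

(* [zrep e]: the graph is represented by integer vectors of norm 2; such vectors are
   of the form [+- e_i +- e_j], so this says that the graph is a generalized line graph. *)
Definition zrep (V : finType) (e : rel V) : Prop :=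
  exists (C : finType) (phi : V -> C -> int),
    forall u v, \sum_c phi u c * phi v c = (u == v)%:Z *+ 2 + (e u v)%:Z.

Section Levels.
Variables (V : finType) (e : rel V).
Hypotheses (es : symmetric e) (ei : irreflexive e) (ff : forbidden_free e).

Lemma no_copy_seq n E c (x0 : V) (s : seq V) : (n, E, c) \in forbidden -> size s = n -> uniq s ->
  (forall i j, (i < j < n)%N -> e (nth x0 s i) (nth x0 s j) = adj E i j) ->
  (forall i, (i < n)%N -> adj E i i = false) -> False.
Proof.
move=> hF sz us h h0; apply: (ff hF); exists (fun i : 'I_n => nth x0 s i).
  by move=> i j /eqP; rewrite nth_uniq ?sz // => /eqP/val_inj.
move=> i j /=; have [ij|ij|ij] := ltngtP i j; first by rewrite h // ij /=.
- by rewrite es h ?ij /= // /adj orbC.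
- by rewrite (val_inj ij) ei h0.
Qed.

Lemma adj_neq u v : e u v -> u != v.
Proof. by apply: contraTN => /eqP ->; rewrite ei. Qed.

Ltac solve_copy H :=
  apply: H;
  [ by []
  | rewrite /= !inE !negb_or;
    repeat (apply/andP; split); first [assumption | by [] | by apply: adj_neq; assumption]
  | case=> [|[|[|[|[|[|?]]]]]] // [|[|[|[|[|[|?]]]]]] //=;
    rewrite ?andbF //
  | by case=> [|[|[|[|[|[|?]]]]]] // ].

Lemma no_F1 v0 v1 v2 v3 v4 :
  e v0 v1 -> e v0 v2 = false -> e v0 v3 -> e v0 v4 -> e v1 v2 -> e v1 v3 = false -> e v1 v4 = false -> e v2 v3 -> e v2 v4 = false -> e v3 v4 = false ->
  v0 != v2 -> v1 != v3 -> v1 != v4 -> v2 != v4 -> v3 != v4 -> False.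
Proof. by move=> *; solve_copy (no_copy_seq (x0 := v0) (s := [:: v0; v1; v2; v3; v4]) mem_F1). Qed.

Lemma no_F2 v0 v1 v2 v3 v4 v5 :
  e v0 v1 -> e v0 v2 = false -> e v0 v3 = false -> e v0 v4 -> e v0 v5 -> e v1 v2 -> e v1 v3 = false -> e v1 v4 = false -> e v1 v5 = false -> e v2 v3 -> e v2 v4 = false -> e v2 v5 = false -> e v3 v4 -> e v3 v5 = false -> e v4 v5 = false ->
  v0 != v2 -> v0 != v3 -> v1 != v3 -> v1 != v4 -> v1 != v5 -> v2 != v4 -> v2 != v5 -> v3 != v5 -> v4 != v5 -> False.
Proof. by move=> *; solve_copy (no_copy_seq (x0 := v0) (s := [:: v0; v1; v2; v3; v4; v5]) mem_F2). Qed.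

Lemma no_F3 v0 v1 v2 v3 v4 v5 :
  e v0 v1 -> e v0 v2 = false -> e v0 v3 = false -> e v0 v4 = false -> e v0 v5 = false -> e v1 v2 -> e v1 v3 = false -> e v1 v4 = false -> e v1 v5 = false -> e v2 v3 -> e v2 v4 = false -> e v2 v5 -> e v3 v4 -> e v3 v5 = false -> e v4 v5 = false ->
  v0 != v2 -> v0 != v3 -> v0 != v4 -> v0 != v5 -> v1 != v3 -> v1 != v4 -> v1 != v5 -> v2 != v4 -> v3 != v5 -> v4 != v5 -> False.
Proof. by move=> *; solve_copy (no_copy_seq (x0 := v0) (s := [:: v0; v1; v2; v3; v4; v5]) mem_F3). Qed.

Lemma no_F4 v0 v1 v2 v3 v4 v5 :
  e v0 v1 -> e v0 v2 -> e v0 v3 = false -> e v0 v4 -> e v0 v5 = false -> e v1 v2 -> e v1 v3 -> e v1 v4 = false -> e v1 v5 = false -> e v2 v3 -> e v2 v4 = false -> e v2 v5 = false -> e v3 v4 = false -> e v3 v5 -> e v4 v5 = false ->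
  v0 != v3 -> v0 != v5 -> v1 != v4 -> v1 != v5 -> v2 != v4 -> v2 != v5 -> v3 != v4 -> v4 != v5 -> False.
Proof. by move=> *; solve_copy (no_copy_seq (x0 := v0) (s := [:: v0; v1; v2; v3; v4; v5]) mem_F4). Qed.

Lemma no_F5 v0 v1 v2 v3 v4 v5 :
  e v0 v1 -> e v0 v2 -> e v0 v3 -> e v0 v4 -> e v0 v5 = false -> e v1 v2 -> e v1 v3 -> e v1 v4 -> e v1 v5 = false -> e v2 v3 -> e v2 v4 -> e v2 v5 = false -> e v3 v4 = false -> e v3 v5 = false -> e v4 v5 ->
  v0 != v5 -> v1 != v5 -> v2 != v5 -> v3 != v4 -> v3 != v5 -> False.
Proof. by move=> *; solve_copy (no_copy_seq (x0 := v0) (s := [:: v0; v1; v2; v3; v4; v5]) mem_F5). Qed.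

Lemma no_F6 v0 v1 v2 v3 v4 v5 :
  e v0 v1 -> e v0 v2 -> e v0 v3 -> e v0 v4 -> e v0 v5 = false -> e v1 v2 = false -> e v1 v3 = false -> e v1 v4 -> e v1 v5 = false -> e v2 v3 = false -> e v2 v4 = false -> e v2 v5 = false -> e v3 v4 -> e v3 v5 -> e v4 v5 = false ->
  v0 != v5 -> v1 != v2 -> v1 != v3 -> v1 != v5 -> v2 != v3 -> v2 != v4 -> v2 != v5 -> v4 != v5 -> False.
Proof. by move=> *; solve_copy (no_copy_seq (x0 := v0) (s := [:: v0; v1; v2; v3; v4; v5]) mem_F6). Qed.

Lemma no_F7 v0 v1 v2 v3 v4 v5 :
  e v0 v1 -> e v0 v2 = false -> e v0 v3 = false -> e v0 v4 -> e v0 v5 -> e v1 v2 -> e v1 v3 = false -> e v1 v4 = false -> e v1 v5 -> e v2 v3 -> e v2 v4 = false -> e v2 v5 = false -> e v3 v4 -> e v3 v5 = false -> e v4 v5 ->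
  v0 != v2 -> v0 != v3 -> v1 != v3 -> v1 != v4 -> v2 != v4 -> v2 != v5 -> v3 != v5 -> False.
Proof. by move=> *; solve_copy (no_copy_seq (x0 := v0) (s := [:: v0; v1; v2; v3; v4; v5]) mem_F7). Qed.

Lemma no_F8 v0 v1 v2 v3 v4 v5 :
  e v0 v1 = false -> e v0 v2 -> e v0 v3 -> e v0 v4 = false -> e v0 v5 = false -> e v1 v2 -> e v1 v3 -> e v1 v4 = false -> e v1 v5 = false -> e v2 v3 -> e v2 v4 -> e v2 v5 = false -> e v3 v4 -> e v3 v5 = false -> e v4 v5 ->
  v0 != v1 -> v0 != v4 -> v0 != v5 -> v1 != v4 -> v1 != v5 -> v2 != v5 -> v3 != v5 -> False.
Proof. by move=> *; solve_copy (no_copy_seq (x0 := v0) (s := [:: v0; v1; v2; v3; v4; v5]) mem_F8). Qed.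

Lemma no_F9 v0 v1 v2 v3 v4 v5 :
  e v0 v1 -> e v0 v2 -> e v0 v3 -> e v0 v4 = false -> e v0 v5 = false -> e v1 v2 -> e v1 v3 -> e v1 v4 = false -> e v1 v5 = false -> e v2 v3 -> e v2 v4 -> e v2 v5 = false -> e v3 v4 -> e v3 v5 = false -> e v4 v5 ->
  v0 != v4 -> v0 != v5 -> v1 != v4 -> v1 != v5 -> v2 != v5 -> v3 != v5 -> False.
Proof. by move=> *; solve_copy (no_copy_seq (x0 := v0) (s := [:: v0; v1; v2; v3; v4; v5]) mem_F9). Qed.

Lemma no_F10 v0 v1 v2 v3 v4 :
  e v0 v1 -> e v0 v2 = false -> e v0 v3 -> e v0 v4 -> e v1 v2 -> e v1 v3 = false -> e v1 v4 -> e v2 v3 -> e v2 v4 -> e v3 v4 = false ->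
  v0 != v2 -> v1 != v3 -> v3 != v4 -> False.
Proof. by move=> *; solve_copy (no_copy_seq (x0 := v0) (s := [:: v0; v1; v2; v3; v4]) mem_F10). Qed.

Lemma no_F11 v0 v1 v2 v3 v4 v5 :
  e v0 v1 -> e v0 v2 -> e v0 v3 -> e v0 v4 -> e v0 v5 = false -> e v1 v2 = false -> e v1 v3 = false -> e v1 v4 = false -> e v1 v5 = false -> e v2 v3 = false -> e v2 v4 = false -> e v2 v5 = false -> e v3 v4 = false -> e v3 v5 = false -> e v4 v5 ->
  v0 != v5 -> v1 != v2 -> v1 != v3 -> v1 != v4 -> v1 != v5 -> v2 != v3 -> v2 != v4 -> v2 != v5 -> v3 != v4 -> v3 != v5 -> False.
Proof. by move=> *; solve_copy (no_copy_seq (x0 := v0) (s := [:: v0; v1; v2; v3; v4; v5]) mem_F11). Qed.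

Lemma no_F12 v0 v1 v2 v3 v4 v5 :
  e v0 v1 -> e v0 v2 -> e v0 v3 -> e v0 v4 -> e v0 v5 = false -> e v1 v2 -> e v1 v3 = false -> e v1 v4 = false -> e v1 v5 = false -> e v2 v3 = false -> e v2 v4 = false -> e v2 v5 = false -> e v3 v4 = false -> e v3 v5 = false -> e v4 v5 ->
  v0 != v5 -> v1 != v3 -> v1 != v4 -> v1 != v5 -> v2 != v3 -> v2 != v4 -> v2 != v5 -> v3 != v4 -> v3 != v5 -> False.
Proof. by move=> *; solve_copy (no_copy_seq (x0 := v0) (s := [:: v0; v1; v2; v3; v4; v5]) mem_F12). Qed.

(* [lev] is the distance to the end of a path of four vertices grafted on the graph. *)
Variable lev : V -> nat.
Hypotheses (lev_edge : forall u v, e u v -> (lev u <= (lev v).+1)%N)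
  (lev_parent : forall v, (0 < lev v)%N -> exists2 u, e u v & lev v = (lev u).+1)
  (lev_single : forall u v, lev u = lev v -> (lev u <= 3)%N -> u = v).

Lemma far k i j u v : lev u = (k + i)%N -> lev v = (k + j)%N ->
  (i.+1 < j)%N || (j.+1 < i)%N -> e u v = false.
Proof.
move=> lu lv h; apply/negP => uv; have := lev_edge uv; have := lev_edge (etrans (es v u) uv).
by rewrite lu lv; case/orP: h; lia.
Qed.

Lemma lev_neq k i j u v : lev u = (k + i)%N -> lev v = (k + j)%N -> i != j -> u != v.
Proof. by move=> lu lv; apply: contraNneq => uv; move: lu; rewrite uv lv; lia. Qed.

Lemma adj_neq3 u v w : e u w -> e v w = false -> u != v.
Proof. by move=> h h'; apply: contraTneq h => ->; rewrite h'. Qed.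

Lemma parent k i v : lev v = (k + i.+1)%N -> exists2 u, e u v & lev u = (k + i)%N.
Proof. by move=> lv; have [|u uv luv] := @lev_parent v; [lia | exists u => //; lia]. Qed.

Lemma lev_ge4 p q : lev p = lev q -> p != q -> exists k, lev p = (k + 4)%N /\ lev q = (k + 4)%N.
Proof.
move=> pq nq; have h : (3 < lev p)%N by rewrite ltnNge; apply: contra nq => /(lev_single pq) ->.
by exists (lev p - 4)%N; lia.
Qed.

Definition par p v := e p v && (lev v == (lev p).+1).
Definition cp p q := [exists u, par u p && par u q].

Lemma par_lev p v k i : lev p = (k + i)%N -> lev v = (k + i.+1)%N -> par p v = e p v.
Proof. by rewrite /par => -> ->; rewrite addnS eqxx andbT. Qed.

Lemma cpP k p q : lev p = (k + 4)%N -> lev q = (k + 4)%N ->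
  reflect (exists u, [/\ e u p, e u q & lev u = (k + 3)%N]) (cp p q).
Proof.
move=> lp lq; apply: (iffP existsP).
  case=> u /andP[/andP[up /eqP h] /andP[uq _]]; exists u; split => //; lia.
case=> u [up uq lu]; exists u; rewrite !(par_lev lu) ?up ?uq //; lia.
Qed.

Lemma ncp k p q u : cp p q = false -> lev p = (k + 4)%N -> lev q = (k + 4)%N -> lev u = (k + 3)%N ->
  e u p -> e u q = false.
Proof.
move=> h lp lq lu up; apply/negP => uq; have : cp p q by apply/(cpP lp lq); exists u.
by rewrite h.
Qed.

Lemma cp_sym p q : cp p q = cp q p.
Proof. by apply: eq_existsb => u; rewrite andbC. Qed.

(** These tactics supply the side conditions of a forbidden copy. Nonadjacency comes from levels at
    least two apart, or from the absence of a common parent; distinctness from different levels, or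
    from a third vertex adjacent to only one of the two. *)
Ltac adjs := first
  [ assumption | rewrite es; assumption
  | eapply far; [eassumption | eassumption | reflexivity] ].
Ltac ncp_with H := eapply (ncp H); [eassumption | eassumption | eassumption | adjs].
Ltac ncps := match goal with
  | H : cp ?a ?b = false |- e ?u ?b = false => solve [ncp_with H]
  | H : cp ?b ?a = false |- e ?u ?b = false => solve [ncp_with (etrans (cp_sym a b) H)]
  | H : cp ?a ?b = false |- e ?b ?u = false => solve [rewrite es; ncp_with H]
  | H : cp ?b ?a = false |- e ?b ?u = false => solve [rewrite es; ncp_with (etrans (cp_sym a b) H)]
  end.
Ltac neqs := first
  [ assumption | rewrite eq_sym; assumption
  | eapply lev_neq; [eassumption | eassumption | reflexivity]
  | match goal with
    | H1 : is_true (e ?x ?w) |- is_true (?x != ?y) => apply: (adj_neq3 H1); solve [adjs | ncps]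
    | H1 : is_true (e ?w ?x) |- is_true (?x != ?y) =>
        apply: (@adj_neq3 x y w); [rewrite es; exact: H1 | solve [adjs | ncps]]
    | H1 : is_true (e ?y ?w) |- is_true (?x != ?y) =>
        rewrite eq_sym; apply: (adj_neq3 H1); solve [adjs | ncps]
    | H1 : is_true (e ?w ?y) |- is_true (?x != ?y) =>
        rewrite eq_sym; apply: (@adj_neq3 y x w); [rewrite es; exact: H1 | solve [adjs | ncps]]
    end ].
Ltac kill H := apply: H; solve [adjs | ncps | neqs].

(** Distinct vertices on one level are at level at least 4, because the levels up to 3 are
    singletons. Writing the level as [k + 4] ensures that the chains of ancestors that complete the
    forbidden copies, here and below, exist; they go up to level [k + 1]. *)
Lemma coparents_adj k p q w : lev p = (k + 4)%N -> lev q = (k + 4)%N -> lev w = (k + 5)%N ->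
  p != q -> e p w -> e q w -> cp p q -> e p q.
Proof.
move=> lp lq lw pq pw qw /(cpP lp lq) [u [up uq lu]]; apply: contraT => /negbTE npq.
have [u1 u1u lu1] := @parent k 2 u lu.
by exfalso; kill (@no_F1 u p w q u1).
Qed.

Lemma child_transfer k p q w : lev p = (k + 4)%N -> lev q = (k + 4)%N -> lev w = (k + 5)%N ->
  e p q -> cp p q = false -> e p w -> e q w.
Proof.
move=> lp lq lw pq npq pw; apply: contraT => /negbTE nqw; exfalso.
have [u up lu] := @parent k 3 p lp; have [u' uq lu'] := @parent k 3 q lq.
have [u1 u1u lu1] := @parent k 2 u lu.
have [uu|uu] := boolP (e u u'); first by kill (@no_F1 p q u' u w).
move/negbTE: uu => uu; have [uu1|/negbTE uu1] := boolP (e u1 u').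
  by kill (@no_F2 p q u' u1 u w).
by kill (@no_F3 u' q p u u1 w).
Qed.

Lemma negative_barren k p q w : lev p = (k + 4)%N -> lev q = (k + 4)%N -> lev w = (k + 5)%N ->
  p != q -> e p q = false -> cp p q -> e p w = false.
Proof.
move=> lp lq lw nq npq cpq; apply/negP => pw.
have /(cpP lp lq) [u [up uq lu]] := cpq.
have [u1 u1u lu1] := @parent k 2 u lu; have [u2 u2u lu2] := @parent k 1 u1 lu1.
have [qw|/negbTE qw] := boolP (e q w).
  by have := coparents_adj lp lq lw nq pw qw cpq; rewrite npq.
by kill (@no_F3 w p u u1 u2 q).
Qed.

Lemma two_sided k p q w b : lev p = (k + 4)%N -> lev q = (k + 4)%N -> lev w = (k + 5)%N ->
  p != q -> e p w -> e q w -> e p q = cp p q ->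
  e b w -> e b p = false -> e b q = false -> lev b = (k + 5)%N \/ lev b = (k + 6)%N -> False.
Proof.
move=> lp lq lw pq pw qw D bw bp bq lb.
have [u up lu] := @parent k 3 p lp.
have far_b x i : (i <= 3)%N -> lev x = (k + i)%N -> e b x = false.
  by case: lb => lb i3 lx; apply: (far lb lx); apply/orP; right; lia.
have neq_b x i : (i <= 4)%N -> lev x = (k + i)%N -> b != x.
  by case: lb => lb i3 lx; apply: (lev_neq lb lx); lia.
have bu := @far_b u 3 isT lu; have nbu := @neq_b u 3 isT lu.
have nbp := @neq_b p 4 isT lp; have nbq := @neq_b q 4 isT lq.
have [npq|/negbTE npq] := boolP (e p q); rewrite npq in D.
  have /(cpP lp lq) [v [vp vq lv]] : cp p q by rewrite -D.
  have [v1 v1v lv1] := @parent k 2 v lv.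
  have bv := @far_b v 3 isT lv; have bv1 := @far_b v1 2 isT lv1.
  have nbv := @neq_b v 3 isT lv; have nbv1 := @neq_b v1 2 isT lv1.
  by kill (@no_F4 w p q v b v1).
have {}D := esym D; have [u' uq lu'] := @parent k 3 q lq.
have bu' := @far_b u' 3 isT lu'; have nbu' := @neq_b u' 3 isT lu'.
have [uu|/negbTE uu] := boolP (e u u'); first by kill (@no_F2 w p u u' q b).
by kill (@no_F3 u p w q u' b).
Qed.

Lemma forced_adj k p q w b : lev p = (k + 4)%N -> lev q = (k + 4)%N -> lev w = (k + 5)%N ->
  lev b = (k + 5)%N -> p != q -> e p w -> e q w -> e p q = cp p q ->
  b != w -> e p b -> e q b = false -> e w b.
Proof.
move=> lp lq lw lb pq pw qw D bw pb qb; apply: contraT => /negbTE wb; exfalso.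
have [npq|/negbTE npq] := boolP (e p q); rewrite npq in D.
  have /(cpP lp lq) [v [vp vq lv]] : cp p q by rewrite -D.
  have [v1 v1v lv1] := @parent k 2 v lv.
  by kill (@no_F6 p w b v q v1).
have {}D := esym D; have [u up lu] := @parent k 3 p lp; have [u1 u1u lu1] := @parent k 2 u lu.
by kill (@no_F3 q w p u u1 b).
Qed.

Lemma no_double k p q w b : lev p = (k + 4)%N -> lev q = (k + 4)%N -> lev w = (k + 5)%N ->
  lev b = (k + 5)%N -> p != q -> e p w -> e q w -> e p q = cp p q ->
  b != w -> e p b -> e q b -> False.
Proof.
move=> lp lq lw lb pq pw qw D bw pb qb.
have [npq|/negbTE npq] := boolP (e p q); rewrite npq in D.
  have /(cpP lp lq) [v [vp vq lv]] : cp p q by rewrite -D.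
  have [v1 v1v lv1] := @parent k 2 v lv.
  have [wb|/negbTE wb] := boolP (e w b); first by kill (@no_F9 w b p q v v1).
  by kill (@no_F8 w b p q v v1).
have {}D := esym D; have [u up lu] := @parent k 3 p lp; have [u' uq lu'] := @parent k 3 q lq.
have [wb|/negbTE wb] := boolP (e w b); last by kill (@no_F1 p w q b u).
have [uu|/negbTE uu] := boolP (e u u'); first by kill (@no_F7 w p u u' q b).
by kill (@no_F4 p w b q u u').
Qed.

(* Such a [v] will be represented by the coordinates of its two classes of parents, with no
   coordinate of its own. *)
Definition two_sided_at v := [exists p, [exists q, [&& p != q, par p v, par q v & e p q == cp p q]]].

(** A two-sided vertex gets no coordinate of its own, so it has nothing to share with a child; this
    lemma shows that it has no child. *)
Lemma fertileN k p w : lev p = (k + 4)%N -> lev w = (k + 5)%N -> e p w -> two_sided_at p = false.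
Proof.
move=> lp lw pw; apply: (introF idP) => /existsP[a /existsP[b /and4P[ab /andP[ap /eqP la] /andP[bp /eqP lb] /eqP D]]].
have [k' [la' lb']] : exists k, lev a = (k + 4)%N /\ lev b = (k + 4)%N by apply: lev_ge4 => //; lia.
by apply: (@two_sided k' a b p w) => //; [lia | rewrite es | apply: (@far k' 6 4); lia | apply: (@far k' 6 4); lia | lia].
Qed.

Lemma parP p v : par p v -> e p v /\ lev v = (lev p).+1.
Proof. by case/andP=> -> /eqP. Qed.

Lemma parE p v : e p v -> lev v = (lev p).+1 -> par p v.
Proof. by rewrite /par => -> ->; rewrite eqxx. Qed.

Lemma one_sided_parents v u u' : ~~ two_sided_at v -> par u v -> par u' v -> u != u' ->
  e u u' /\ cp u u' = false.
Proof.
move=> h1 uv u'v nu; have [euv luv] := parP uv; have [eu'v lu'v] := parP u'v.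
have [k [lu lu']] : exists k, lev u = (k + 4)%N /\ lev u' = (k + 4)%N by apply: lev_ge4 => //; llia.
have lv : lev v = (k + 5)%N by llia.
have ne : e u u' != cp u u'.
  apply: contra h1 => /eqP D; apply/existsP; exists u; apply/existsP; exists u'.
  by rewrite nu uv u'v D eqxx.
case: (boolP (cp u u')) ne => [c|c].
  by rewrite (coparents_adj lu lu' lv nu euv eu'v c).
by case: (e u u').
Qed.

Lemma one_sided_children v u u' w : ~~ two_sided_at v -> par u v -> par u' v -> par u w -> par u' w.
Proof.
move=> h1 uv u'v uw; case: (eqVneq u u') => [<- //|nu].
have [eu nc] := one_sided_parents h1 uv u'v nu.
have [euv luv] := parP uv; have [eu'v lu'v] := parP u'v; have [euw luw] := parP uw.
have [k [lu lu']] : exists k, lev u = (k + 4)%N /\ lev u' = (k + 4)%N by apply: lev_ge4 => //; llia.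
apply: parE; last by llia.
by apply: (child_transfer lu lu' _ eu nc euw); llia.
Qed.

Lemma cp_parents p q u : ~~ two_sided_at p -> cp p q -> par u p -> par u q.
Proof.
move=> h1 /existsP[v /andP[vp vq]] up; exact: one_sided_children h1 vp up vq.
Qed.

Lemma cp_trans p q s : ~~ two_sided_at q -> cp p q -> cp q s -> cp p s.
Proof.
move=> h1; rewrite (cp_sym p) => qp /existsP[v /andP[vq vs]].
by apply/existsP; exists v; rewrite vs (cp_parents h1 qp vq).
Qed.

Lemma par_one_sided p w : par p w -> (3 < lev p)%N -> ~~ two_sided_at p.
Proof.
move=> /parP[pw lw] h; rewrite (@fertileN (lev p - 4) p w) //; llia.
Qed.

(** For distinct parents, [e p q = cp p q] means that their own coordinates differ. Three such
    parents would give [w] three coordinates, hence norm at least 3. *)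
Lemma three_parents w p q s : par p w -> par q w -> par s w -> p != q -> q != s -> p != s ->
  e p q = cp p q -> e q s = cp q s -> e p s = cp p s -> False.
Proof.
move=> hp hq hs npq nqs nps.
have [pw lpw] := parP hp; have [qw lqw] := parP hq; have [sw lsw] := parP hs.
have [k [lp lq]] : exists k, lev p = (k + 4)%N /\ lev q = (k + 4)%N by apply: lev_ge4 => //; llia.
have ls : lev s = (k + 4)%N by llia.
have lw : lev w = (k + 5)%N by llia.
have h1p : ~~ two_sided_at p by apply: (par_one_sided hp); llia.
have h1q : ~~ two_sided_at q by apply: (par_one_sided hq); llia.
have h1s : ~~ two_sided_at s by apply: (par_one_sided hs); llia.
have [u up lu] := @parent k 3 p lp; have [u' uq lu'] := @parent k 3 q lq.
have [u1 u1u lu1] := @parent k 2 u lu.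
have pu : par u p by apply: parE => //; llia.
have key a b c (la : lev a = (k + 4)%N) (lb : lev b = (k + 4)%N) (lc : lev c = (k + 4)%N)
    (aw : e a w) (bw : e b w) (cw : e c w) (nab : a != b) (nbc : b != c) (nac : a != c) :
    e a b -> cp a b -> e a c = false -> e b c = false -> cp a c = false -> cp b c = false -> False.
  move=> ab /(cpP la lb) [v [va vb lv]] ac bc cac cbc.
  have [v1 v1v lv1] := @parent k 2 v lv.
  have vc : e v c = false by ncps.
  by kill (@no_F4 w a b v c v1).
case: (boolP (cp p q)) => cpq; case: (boolP (cp q s)) => cqs; case: (boolP (cp p s)) => cps epq eqs eps.
- have uq' : e u q by have /parP[] := cp_parents h1p cpq pu.
  have us' : e u s by have /parP[] := cp_parents h1p cps pu.
  by kill (@no_F5 p q s w u u1).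
- by rewrite (cp_trans h1q cpq cqs) in cps.
- by rewrite (cp_trans h1p _ cps) // cp_sym in cqs.
- by apply: (key p q s) => //; first [by apply/negbTE | by rewrite cp_sym; apply/negbTE | by rewrite es | by rewrite eq_sym].
- by rewrite (cp_trans h1s cps _) // cp_sym in cpq.
- by apply: (key q s p) => //; first [by apply/negbTE | by rewrite cp_sym; apply/negbTE | by rewrite es | by rewrite eq_sym].
- by apply: (key p s q) => //; first [by apply/negbTE | by rewrite cp_sym; apply/negbTE | by rewrite es | by rewrite eq_sym].
move/negbTE: cpq => cpq; move/negbTE: cqs => cqs; move/negbTE: cps => cps.
have [uu|/negbTE uu] := boolP (e u u'); first by kill (@no_F2 w p u u' q s).
by kill (@no_F3 u p w q u' s).
Qed.

(* The product of the signs with which [p] and [q], on the same level, enter a common own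
   coordinate; 0 if their own coordinates differ. *)
Definition D p q : int := if p == q then 1 else (e p q)%:Z - (cp p q)%:Z.

Lemma D_sym p q : D p q = D q p.
Proof. by rewrite /D eq_sym es cp_sym. Qed.

(** Required by the reading of [D] as a product of two signs; each way to violate it contains a
    forbidden graph. It makes [D p q != 0] an equivalence on the one-sided vertices of a level,
    whose classes are the own coordinates. *)
Lemma D_trans p q s : lev p = lev q -> lev q = lev s ->
  ~~ two_sided_at p -> ~~ two_sided_at q -> ~~ two_sided_at s ->
  D p q != 0 -> D q s != 0 -> D p s = D p q * D q s.
Proof.
move=> epq eqs h1p h1q h1s.
case: (eqVneq p q) => [<-|npq]; first by rewrite [D p p]/D eqxx mul1r.
case: (eqVneq q s) => [<-|nqs]; first by rewrite [D q q]/D eqxx mulr1.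
have [k [lp lq]] := lev_ge4 epq npq; have ls : lev s = (k + 4)%N by rewrite -eqs.
have [u up lu] := @parent k 3 p lp; have [u' uq lu'] := @parent k 3 q lq; have [u'' us lu''] := @parent k 3 s ls.
have [u1 u1u lu1] := @parent k 2 u lu; have [u2 u2u lu2] := @parent k 1 u1 lu1.
have pu : par u p by apply: parE => //; llia.
have qu : par u' q by apply: parE => //; llia.
have su : par u'' s by apply: parE => //; llia.
rewrite [D p q]/D [D q s]/D (negPf npq) (negPf nqs).
case: (boolP (cp p q)) => cpq; case: (boolP (cp q s)) => cqs.
- have cps := cp_trans h1q cpq cqs.
  have uq' : e u q by have /parP[] := cp_parents h1p cpq pu.
  have us' : e u s by have /parP[] := cp_parents h1p cps pu.
  case: (boolP (e p q)) => // /negbTE pq; case: (boolP (e q s)) => // /negbTE qs _ _.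
  case: (eqVneq p s) => [<-|nps]; first by rewrite /D eqxx.
  exfalso; case: (boolP (e p s)) => [ps|/negbTE ps]; first by kill (@no_F12 u p s q u1 u2).
  by kill (@no_F11 u p q s u1 u2).
- case: (boolP (e p q)) => // /negbTE pq; case: (boolP (e q s)) => // qs _ _.
  case: (eqVneq p s) => [ps|nps]; first by rewrite -ps es pq in qs.
  move/negbTE: cqs => cqs; exfalso.
  have cps : cp p s = false by apply: (introF idP) => cps; rewrite cp_sym in cpq; move: (cp_trans h1p cpq cps); rewrite cqs.
  have uq' : e u q by have /parP[] := cp_parents h1p cpq pu.
  have us' : e u s = false by ncps.
  case: (boolP (e p s)) => [ps|/negbTE ps]; first by kill (@no_F1 u p s q u1).
  by kill (@no_F3 s q u u1 u2 p).
- case: (boolP (e p q)) => // pq; case: (boolP (e q s)) => // /negbTE qs _ _.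
  case: (eqVneq p s) => [ps|nps]; first by rewrite ps es qs in pq.
  move/negbTE: cpq => cpq; exfalso.
  have cps : cp p s = false by apply: (introF idP) => cps; rewrite cp_sym in cqs; move: (cp_trans h1s cps cqs); rewrite cpq.
  have us' : e u' s by have /parP[] := cp_parents h1q cqs qu.
  have up' : e u' p = false by ncps.
  have [v1 v1u lv1] := @parent k 2 u' lu'; have [v2 v2u lv2] := @parent k 1 v1 lv1.
  case: (boolP (e p s)) => [ps|/negbTE ps]; first by kill (@no_F1 u' q p s v1).
  by kill (@no_F3 p q u' v1 v2 s).
move/negbTE: cpq => cpq; move/negbTE: cqs => cqs.
case: (boolP (e p q)) => // pq; case: (boolP (e q s)) => // qs _ _.
case: (eqVneq p s) => [<-|nps]; first by rewrite /D eqxx.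
rewrite /D (negPf nps); case: (boolP (cp p s)) => [cps|/negbTE cps].
  exfalso; have us' : e u s by have /parP[] := cp_parents h1p cps pu.
  have uq' : e u q = false by ncps.
  have u'p : e u' p = false by ncps.
  have u's : e u' s = false by ncps.
  case: (boolP (e p s)) => [ps|/negbTE ps]; last by kill (@no_F1 u p q s u1).
  have [uu|/negbTE uu] := boolP (e u u'); first by kill (@no_F10 q p u u' s).
  have [uu1|/negbTE uu1] := boolP (e u1 u'); first by kill (@no_F7 p q u' u1 u s).
  by kill (@no_F4 q p s u u' u1).
case: (boolP (e p s)) => // /negbTE ps; exfalso.
have u'p : e u' p = false by ncps.
have u's : e u' s = false by ncps.
have uq' : e u q = false by ncps.
have us' : e u s = false by ncps.
have u''p : e u'' p = false by ncps.
have u''q : e u'' q = false by ncps.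
have [uu|/negbTE uu] := boolP (e u u'); first by kill (@no_F1 q p u u' s).
have [uu2|/negbTE uu2] := boolP (e u' u''); first by kill (@no_F1 q s u'' u' p).
have [uu3|/negbTE uu3] := boolP (e u u''); first by kill (@no_F2 q p u u'' s u').
by kill (@no_F3 u p q s u'' u').
Qed.

Local Notation ts := two_sided_at.

Lemma two_sidedP v : ts v -> exists p q, [/\ p != q, par p v, par q v & D p q = 0].
Proof.
case/existsP => p /existsP[q /and4P[npq pv qv /eqP h]]; exists p, q; split => //.
by rewrite /D (negPf npq) h subrr.
Qed.

Lemma D0P p q : D p q = 0 -> p != q /\ e p q = cp p q.
Proof. by rewrite /D; case: eqVneq => // _; case: (e p q); case: cp. Qed.

Lemma DP p q : D p q = 0 \/ D p q = 1 \/ D p q = -1.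
Proof. by rewrite /D; case: eqVneq => _; [|case: (e p q); case: cp]; auto. Qed.

Lemma D1P p q : D p q = 1 -> p != q -> e p q /\ cp p q = false.
Proof. by move=> h /negPf n; move: h; rewrite /D n; case: (e p q); case: cp. Qed.

Lemma DN1P p q : D p q = -1 -> [/\ p != q, e p q = false & cp p q].
Proof. by rewrite /D; case: eqVneq => // _; case: (e p q); case: cp. Qed.

Lemma Dxx p : D p p = 1.
Proof. by rewrite /D eqxx. Qed.

Lemma same_parents_lev p q v : par p v -> par q v -> lev p = lev q.
Proof. by move=> /parP[_ h] /parP[_]; rewrite h => -[]. Qed.

Lemma par_type1 p v : par p v -> ~~ ts p.
Proof.
move=> pv; case: (leqP (lev p) 3) => h; last exact: par_one_sided pv h.
apply: contraT; rewrite negbK => /two_sidedP [a [b [nab ap bp _]]].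
have lab := same_parents_lev ap bp; have [_ lp] := parP ap.
have [k [la _]] := lev_ge4 lab nab; llia.
Qed.

Lemma coparents_D p q v : par p v -> par q v -> D p q != 0 -> D p q = 1.
Proof.
move=> pv qv; case: (DP p q) => [->//|[//|/DN1P [npq ne c]]] _.
have [k [lp lq]] := lev_ge4 (same_parents_lev pv qv) npq.
have [epv lv] := parP pv; have [eqv _] := parP qv.
have lv5 : lev v = (k + 5)%N by llia.
by have := coparents_adj lp lq lv5 npq epv eqv c; rewrite ne.
Qed.

Lemma D_par p v w : par p v -> lev w = lev p -> D w p != 0 -> par w v /\ D w p = 1.
Proof.
move=> pv lwp; case: (eqVneq p w) => [<- _|npw]; first by rewrite Dxx.
have [k [lp lw]] := lev_ge4 (esym lwp) npw; have [epv lv] := parP pv.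
have lv5 : lev v = (k + 5)%N by llia.
rewrite D_sym; case: (DP p w) => [->//|[h|/DN1P [_ ne c]]] _.
  have [ew c] := D1P h npw; split=> //; apply: parE; last by llia.
  exact: child_transfer lp lw lv5 ew c epv.
by have := negative_barren lp lw lv5 npw ne c; rewrite epv.
Qed.

Definition equiv v w := [&& lev v == lev w, ~~ ts w & D v w != 0].
Definition rep v := odflt v [pick w | equiv v w].
Definition sg v := D v (rep v).

Lemma repP v : ~~ ts v -> equiv v (rep v).
Proof.
move=> tv; rewrite /rep; case: pickP => [w //|/(_ v)].
by rewrite /equiv eqxx tv Dxx.
Qed.

Lemma rep_eq v w : ~~ ts v -> ~~ ts w -> lev v = lev w -> D v w != 0 -> rep v = rep w.
Proof.
move=> tv tw lvw dvw; have h : equiv v =1 equiv w.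
  move=> x; rewrite /equiv lvw; case: (eqVneq (lev w) (lev x)) => //= lwx; case: (boolP (ts x)) => //= tx.
  apply/idP/idP => dx.
    by rewrite (@D_trans w v x) ?mulf_neq0 // 1?D_sym // lvw.
  by rewrite (@D_trans v w x) ?mulf_neq0.
rewrite /rep (eq_pick h); case: pickP => // /(_ w); by rewrite /equiv eqxx tw Dxx.
Qed.

Lemma lev_rep v : ~~ ts v -> lev (rep v) = lev v.
Proof. by move=> /repP /and3P[/eqP]. Qed.

Lemma rep_inj v w : ~~ ts v -> ~~ ts w -> rep v = rep w -> lev v = lev w /\ D v w = sg v * sg w.
Proof.
move=> tv tw h; have lvw : lev v = lev w by rewrite -(lev_rep tv) h lev_rep.
split=> //; have /and3P[/eqP l1 t1 d1] := repP tv; have /and3P[/eqP l2 t2 d2] := repP tw.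
rewrite /sg [D w _]D_sym -h; apply: D_trans => //; first by rewrite -l1.
by rewrite D_sym h.
Qed.

Lemma sg_sq v : ~~ ts v -> sg v * sg v = 1.
Proof. by move=> tv; have [_ <-] := rep_inj tv tv erefl; rewrite Dxx. Qed.

(** Coordinates are indexed by class representatives. Viewing [v] as an edge of a root graph,
    [out v] is its far end, which is missing for a two-sided [v], and [inn v] collects its near
    ends, the own coordinates of its parents. A two-sided edge has two near ends. Choosing any
    parent of a class is harmless by [sg_eq]. *)
Definition out v c : int := if ~~ ts v && (rep v == c) then sg v else 0.
Definition inn v c : int := if [pick p | par p v && (rep p == c)] is Some p then sg p else 0.

Lemma sg_eq p q v : par p v -> par q v -> rep p = rep q -> sg p = sg q.
Proof.
move=> pv qv h; have tp := par_type1 pv; have tq := par_type1 qv.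
have [_ d] := rep_inj tp tq h.
have nz : D p q != 0.
  by rewrite d; apply: mulf_neq0; apply/eqP => z; [have := sg_sq tp | have := sg_sq tq]; rewrite z.
rewrite (coparents_D pv qv nz) in d.
by rewrite -[RHS]mul1r -(sg_sq tp) -mulrA -d mulr1.
Qed.

Lemma inn_rep p v : par p v -> inn v (rep p) = sg p.
Proof.
move=> pv; rewrite /inn; case: pickP => [q /andP[qv /eqP h]|/(_ p)]; first exact: sg_eq qv pv h.
by rewrite pv eqxx.
Qed.

Lemma inn_eq0 v c : (forall p, par p v -> rep p != c) -> inn v c = 0.
Proof. by move=> h; rewrite /inn; case: pickP => // q /andP[/h /negPf ->]. Qed.

Lemma sum_out v (g : V -> int) : \sum_c out v c * g c = if ts v then 0 else sg v * g (rep v).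
Proof.
rewrite /out; case: (ts v) => /=; first by rewrite big1 // => c _; rewrite mul0r.
rewrite (bigD1 (rep v)) //= eqxx big1 ?addr0 // => c; by rewrite eq_sym => /negPf ->; rewrite mul0r.
Qed.

Lemma sum_inn1 v p (g : V -> int) : ~~ ts v -> par p v -> \sum_c inn v c * g c = sg p * g (rep p).
Proof.
move=> tv pv; rewrite (bigD1 (rep p)) //= inn_rep // big1 ?addr0 // => c hc.
rewrite inn_eq0 ?mul0r // => q qv; suff <- : rep p = rep q by rewrite eq_sym.
apply: (rep_eq (par_type1 pv) (par_type1 qv) (same_parents_lev pv qv)).
case: (eqVneq p q) => [<-|npq]; first by rewrite Dxx.
by have [h1 h2] := one_sided_parents tv pv qv npq; rewrite /D (negPf npq) h1 h2.
Qed.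

Lemma sum_inn2 v p q (g : V -> int) : par p v -> par q v -> D p q = 0 ->
  \sum_c inn v c * g c = sg p * g (rep p) + sg q * g (rep q).
Proof.
move=> pv qv d; have tp := par_type1 pv; have tq := par_type1 qv.
have npq : rep p != rep q.
  apply/eqP => h; have [_] := rep_inj tp tq h; rewrite d => /esym/eqP.
  by rewrite mulf_eq0 => /orP[] /eqP z; [have := sg_sq tp | have := sg_sq tq]; rewrite z.
rewrite (bigD1 (rep p)) //= inn_rep // (bigD1 (rep q)) 1?eq_sym //= inn_rep // big1 ?addr0 // => c /andP[h1 h2].
rewrite inn_eq0 ?mul0r // => s sv.
case: (eqVneq (D s p) 0) => dsp; last first.
  by rewrite (rep_eq (par_type1 sv) tp (same_parents_lev sv pv) dsp) eq_sym.
case: (eqVneq (D s q) 0) => dsq; last first.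
  by rewrite (rep_eq (par_type1 sv) tq (same_parents_lev sv qv) dsq) eq_sym.
have [n1 e1] := D0P d; have [n2 e2] := D0P dsp; have [n3 e3] := D0P dsq.
by exfalso; apply: (three_parents sv pv qv).
Qed.

Lemma out_rep u w : ~~ ts w -> sg w * out u (rep w) = if (lev u == lev w) && ~~ ts u then D u w else 0.
Proof.
move=> tw; rewrite /out; case: (boolP (ts u)) => /= tu; first by rewrite andbF mulr0.
rewrite andbT; case: (eqVneq (rep u) (rep w)) => h.
  by have [-> ->] := rep_inj tu tw h; rewrite eqxx mulrC.
rewrite mulr0; case: eqP => // l; apply/esym/eqP; apply: contraT => nz.
by rewrite (rep_eq tu tw l nz) eqxx in h.
Qed.

Lemma inn_repE u w : ~~ ts w -> sg w * inn u (rep w) = if lev u == (lev w).+1 then (e w u)%:Z else 0.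
Proof.
move=> tw; rewrite /inn; case: pickP => [p /andP[pu /eqP h]|none].
  have tp := par_type1 pu; have [l d] := rep_inj tp tw h; have [epu lu] := parP pu.
  rewrite lu l eqxx mulrC -d; have nz : D w p != 0.
    by rewrite D_sym d; apply: mulf_neq0; apply/eqP => z; [have := sg_sq tp | have := sg_sq tw]; rewrite z.
  by have [/parP[-> _]] := D_par pu (esym l) nz; rewrite D_sym => ->.
rewrite mulr0; case: eqP => // l; case: (boolP (e w u)) => // wu.
by have := none w; rewrite (parE wu l) eqxx.
Qed.

(** The extra coordinate is the near end of the vertex of level 0, which has no parent; without it
    that vector would have norm 1. *)
Definition phi v (o : V + unit) : int :=
  match o with inl c => out v c + inn v c | inr _ => (lev v == 0%N)%:Z end.

Lemma sum_phi u v : \sum_o phi u o * phi v o =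
  \sum_c out v c * (out u c + inn u c) + \sum_c inn v c * (out u c + inn u c)
   + ((lev u == 0%N) && (lev v == 0%N))%:Z.
Proof.
rewrite big_sumType /=; congr (_ + _); last first.
  by rewrite big_const card_unit /= addr0; case: (lev u == 0%N); case: (lev v == 0%N).
by rewrite -big_split /=; apply: eq_bigr => c _; rewrite -mulrDl mulrC.
Qed.

Lemma two_sided_other u v : ts v -> par u v -> exists2 q, par q v & D u q = 0.
Proof.
move=> /two_sidedP [p [q [npq pv qv d]]] uv.
case: (eqVneq (D u p) 0) => dup; first by exists p.
exists q => //; apply/eqP; apply: contraT => duq.
rewrite D_sym in dup.
have := @D_trans p u q (same_parents_lev pv uv) (same_parents_lev uv qv)
  (par_type1 pv) (par_type1 uv) (par_type1 qv) dup duq.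
by rewrite d => /esym/eqP; rewrite mulf_eq0 (negPf dup) (negPf duq).
Qed.

Lemma par_exists v : (0 < lev v)%N -> exists p, par p v.
Proof. by move=> /lev_parent [p pv lv]; exists p; exact: parE. Qed.

Lemma inn_sum_child u v : lev v = (lev u).+1 ->
  \sum_c inn v c * (out u c + inn u c) = (e u v)%:Z.
Proof.
move=> lv.
have term p : par p v -> sg p * (out u (rep p) + inn u (rep p)) = if ts u then 0 else D u p.
  move=> pv; have tp := par_type1 pv; have [_ lp] := parP pv.
  rewrite mulrDr out_rep // inn_repE //.
  have -> : lev u = lev p by llia.
  by rewrite eqxx (_ : (_ == _.+1) = false) ?addr0 //=; [case: (ts u) | apply/eqP; llia].
case: (boolP (e u v)) => uv.
  have pu : par u v by exact: parE.
  have tu := par_type1 pu.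
  case: (boolP (ts v)) => tv.
    have [q qv d] := two_sided_other tv pu.
    by rewrite (sum_inn2 _ pu qv d) !term // (negPf tu) Dxx d addr0.
  by rewrite (sum_inn1 _ tv pu) term // (negPf tu) Dxx.
have zero p : par p v -> (if ts u then 0 else D u p) = 0.
  move=> pv; case: (ts u) => //; apply/eqP; apply: contraT => nz.
  have lup : lev u = lev p by have [_ lp] := parP pv; llia.
  by have [/parP[h _] _] := D_par pv lup nz; rewrite h in uv.
case: (boolP (ts v)) => tv.
  have [p [q [_ pv qv d]]] := two_sidedP tv.
  by rewrite (sum_inn2 _ pv qv d) !term // !zero.
have [p pv] : exists p, par p v by apply: par_exists; rewrite lv.
by rewrite (sum_inn1 _ tv pv) term // zero.
Qed.

Lemma inn_sum_far u v : ((lev u).+1 < lev v)%N -> \sum_c inn v c * (out u c + inn u c) = 0.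
Proof.
move=> l; have term p : par p v -> sg p * (out u (rep p) + inn u (rep p)) = 0.
  move=> pv; have tp := par_type1 pv; have [_ lp] := parP pv.
  have n1 : (lev u == lev p) = false by apply/eqP; llia.
  have n2 : (lev u == (lev p).+1) = false by apply/eqP; llia.
  by rewrite mulrDr out_rep // inn_repE // n1 n2.
case: (boolP (ts v)) => tv.
  by have [p [q [_ pv qv d]]] := two_sidedP tv; rewrite (sum_inn2 _ pv qv d) !term.
have [p pv] : exists p, par p v by apply: par_exists; llia.
by rewrite (sum_inn1 _ tv pv) term.
Qed.

Lemma out_sum u v : (lev u <= lev v)%N ->
  \sum_c out v c * (out u c + inn u c) = if (lev u == lev v) && ~~ ts u && ~~ ts v then D u v else 0.
Proof.
move=> l; rewrite sum_out; case: (boolP (ts v)) => tv; first by rewrite andbF.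
rewrite mulrDr out_rep // inn_repE // (_ : (lev u == _.+1) = false) ?addr0 ?andbT //.
by apply/eqP; llia.
Qed.

Lemma inn_sum_same2 u v : lev u = lev v -> ts v ->
  \sum_c inn v c * (out u c + inn u c) = (u == v)%:Z *+ 2 + (e u v)%:Z.
Proof.
move=> l tv; have [p [q [npq pv qv d]]] := two_sidedP tv.
have term a : par a v -> sg a * (out u (rep a) + inn u (rep a)) = (e a u)%:Z.
  move=> av; have ta := par_type1 av; have [_ la] := parP av.
  rewrite mulrDr out_rep // inn_repE // l la eqxx (_ : (_.+1 == _) = false) ?add0r //.
  by apply/eqP; llia.
rewrite (sum_inn2 _ pv qv d) !term //.
have [epv lv] := parP pv; have [eqv _] := parP qv.
case: (eqVneq u v) => [->|nuv]; first by rewrite epv eqv ei.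
have [k [lp lq]] := lev_ge4 (same_parents_lev pv qv) npq.
have lv5 : lev v = (k + 5)%N by llia.
have lu5 : lev u = (k + 5)%N by llia.
have [_ ed] := D0P d.
case: (boolP (e p u)) => pu; case: (boolP (e q u)) => qu.
- by exfalso; apply: (no_double lp lq lv5 lu5 npq epv eqv ed nuv pu qu).
- by rewrite es (forced_adj lp lq lv5 lu5 npq epv eqv ed nuv pu (negbTE qu)).
- rewrite es (@forced_adj k q p v u) // 1?eq_sym //; last exact: negbTE.
  by rewrite es cp_sym.
- case: (boolP (e u v)) => // uv; exfalso.
  by apply: (two_sided lp lq lv5 npq epv eqv ed uv); rewrite 1?es; [exact: negbTE | exact: negbTE | left].
Qed.

Lemma phi_gram u v : \sum_o phi u o * phi v o = (u == v)%:Z *+ 2 + (e u v)%:Z.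
Proof.
wlog l : u v / (lev u <= lev v)%N.
  move=> H; case: (leqP (lev u) (lev v)) => h; first exact: H.
  rewrite eq_sym es -H 1?ltnW //; by apply: eq_bigr => c _; rewrite mulrC.
rewrite sum_phi out_sum //.
move: l; rewrite leq_eqVlt => /orP[/eqP l|l]; last first.
  have nuv : u != v by apply: contraTneq l => ->; rewrite ltnn.
  rewrite (negPf nuv) mul0rn add0r (_ : (lev u == lev v) = false) ?add0r; last by apply/eqP; llia.
  rewrite (_ : (lev v == 0%N) = false) ?andbF ?addr0; last by apply/eqP; llia.
  move: l; rewrite leq_eqVlt => /orP[/eqP l|l]; first exact: inn_sum_child.
  rewrite inn_sum_far // (@far 0 (lev u) (lev v)) ?add0n //; by apply/orP; left.
have sum0 w : lev w = 0%N -> forall g : V -> int, \sum_c inn w c * g c = 0.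
  move=> lw g; apply: big1 => c _; rewrite inn_eq0 ?mul0r // => p /parP[_]; by rewrite lw.
case: (posnP (lev v)) => lv0.
  have uv : u = v by apply: lev_single; rewrite l lv0.
  have tv : ~~ ts v.
    apply: contraT; rewrite negbK => /two_sidedP [a [b [_ /parP[_]]]]; by rewrite lv0.
  by rewrite uv sum0 // !eqxx tv /= Dxx lv0 ei /=.
rewrite l (_ : (lev v == 0%N) = false) ?eqxx ?addr0 /=; last by apply/eqP; llia.
case: (boolP (ts v)) => tv; first by rewrite andbF add0r inn_sum_same2.
case: (boolP (ts u)) => tu /=.
  have lz : (lev v == 0%N) = false by apply/eqP; llia.
  have := sum_phi u v; have := sum_phi v u.
  rewrite !out_sum ?l // tu tv eqxx /= lz andbF !addr0 !add0r inn_sum_same2 // => E1 <-.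
  by rewrite eq_sym es -E1; apply: eq_bigr => c _; rewrite mulrC.
have [p pv] := par_exists lv0; have tp := par_type1 pv; have [epv lpv] := parP pv.
rewrite (sum_inn1 _ tv pv) mulrDr out_rep // inn_repE // l lpv eqxx.
rewrite (_ : (_.+1 == _) = false) ?add0r /=; last by apply/eqP; llia.
case: (eqVneq u v) => [->|nuv]; first by rewrite Dxx epv ei.
rewrite /D (negPf nuv) mul0rn add0r.
suff -> : cp u v = e p u by rewrite subrK.
apply/idP/idP => [/existsP[a /andP[au av]]|pu].
  by have /parP[] := one_sided_children tv av pv au.
by apply/existsP; exists p; rewrite pv andbT; apply: parE => //; rewrite l.
Qed.

Theorem forbidden_free_zrep : zrep e.
Proof. by exists (V + unit)%type, phi; exact: phi_gram. Qed.

End Levels.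

(** * Large connected graphs *)

Section Distance.
Variables (V : finType) (e : rel V).
Hypotheses (es : symmetric e) (conn : connected_graph e).
Variable T : {set V}.
Hypothesis T0 : T != set0.

Definition nbhd (A : {set V}) : {set V} := A :|: [set v | [exists u in A, e u v]].
Definition ball i := iter i nbhd T.
Definition dist v := find (fun i => v \in ball i) (iota 0 #|V|.+1).

Lemma ball_mono i j : (i <= j)%N -> ball i \subset ball j.
Proof.
elim: j => [|j IH]; first by rewrite leqn0 => /eqP ->.
rewrite leq_eqVlt => /orP[/eqP -> //|/IH h]; apply: subset_trans h _; exact: subsetUl.
Qed.

Lemma card_ball i : (minn i.+1 #|V| <= #|ball i|)%N.
Proof.
elim: i => [|i IH].
  by apply: leq_trans (geq_minl _ _) _; rewrite card_gt0.
have sub := ball_mono (leqnSn i).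
case: (eqVneq (ball i) setT) => [E|N].
  have : ball i.+1 = setT by apply/eqP; rewrite eqEsubset subsetT -E.
  by move=> ->; rewrite cardsT geq_minr.
have b0 : ball i != set0.
  case/set0Pn: T0 => v vT; apply/set0Pn; exists v.
  by have /subsetP := ball_mono (leq0n i); apply.
have [p pb [q qb epq]] := conn b0 N.
have lt : (#|ball i| < #|ball i.+1|)%N.
  apply: proper_card; apply/properP; split=> //; exists p => //.
  rewrite !inE; apply/orP; right; apply/existsP; exists q; by rewrite qb es.
rewrite geq_min; case: (leqP #|V| i.+1) => h; last first.
  apply/orP; left; apply: leq_trans lt; rewrite ltnS; apply: leq_trans IH.
  by rewrite leq_min leqnn ltnW.
by apply/orP; right; apply: leq_trans (ltnW lt); apply: leq_trans IH; rewrite leq_min leqnn h.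
Qed.

Lemma ball_full : ball #|V| = setT.
Proof.
apply/eqP; rewrite eqEcard subsetT cardsT.
by apply: leq_trans (card_ball #|V|); rewrite leq_min leqnn leqnSn.
Qed.

Lemma mem_ball v i : (v \in ball i) = (dist v <= i)%N.
Proof.
have hasv : has (fun i => v \in ball i) (iota 0 #|V|.+1).
  by apply/hasP; exists #|V|; rewrite ?mem_iota ?ball_full ?inE //= ltnS leqnn.
have dl : (dist v < #|V|.+1)%N by move: hasv; rewrite has_find size_iota.
have din : v \in ball (dist v) by have := nth_find 0%N hasv; rewrite nth_iota ?add0n.
apply/idP/idP => [vi|di]; last by apply: (subsetP (ball_mono di)).
rewrite leqNgt; apply/negP => h; have := before_find 0%N h.
by rewrite nth_iota ?add0n ?vi // (ltn_trans h).
Qed.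

Lemma dist0 v : (dist v == 0%N) = (v \in T).
Proof. by rewrite -leqn0 -mem_ball. Qed.

Lemma dist_edge u v : e u v -> (dist u <= (dist v).+1)%N.
Proof.
move=> uv; rewrite -mem_ball !inE; apply/orP; right; apply/existsP; exists v.
by rewrite es uv mem_ball leqnn.
Qed.

Lemma dist_parent v : (0 < dist v)%N -> exists2 u, e u v & dist v = (dist u).+1.
Proof.
case E : (dist v) => [//|i] _; have : v \in ball i.+1 by rewrite mem_ball E.
rewrite !inE mem_ball E ltnn /= => /existsP[u /andP[ub uv]]; exists u => //.
have := dist_edge (etrans (es v u) uv); rewrite mem_ball in ub; rewrite E; lia.
Qed.

Lemma card_ball_le d i : (forall v, #|[set w | e v w]| <= d)%N -> (#|ball i| <= #|T| * d.+1 ^ i)%N.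
Proof.
move=> hd; elim: i => [|i IH]; first by rewrite muln1.
apply: leq_trans (_ : #|ball i| + \sum_(u in ball i) #|[set w | e u w]| <= _)%N.
  rewrite /= /nbhd; apply: leq_trans (leq_card_setU _ _) _; rewrite leq_add2l.
  have : [set v | [exists u in ball i, e u v]] \subset \bigcup_(u in ball i) [set w | e u w].
    apply/subsetP => v; rewrite inE => /existsP[u /andP[ub uv]].
    by apply/bigcupP; exists u; rewrite ?inE.
  move=> /subset_leq_card h; apply: leq_trans h _.
  elim/big_ind2: _ => [|n1 A1 n2 A2 h1 h2|u _]; rewrite ?cards0 //.
  by apply: leq_trans (leq_card_setU _ _) _; exact: leq_add.
apply: leq_trans (_ : #|ball i| + \sum_(u in ball i) d <= _)%N.
  by rewrite leq_add2l; apply: leq_sum => u _.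
rewrite sum_nat_const -mulnS expnSr mulnA; exact: leq_mul.
Qed.

End Distance.

Lemma ramsey (V : finType) (e : rel V) (es : symmetric e) (ei : irreflexive e) s m (A : {set V}) : (2 ^ (s + m) <= #|A|)%N ->
  (exists2 I : {set V}, I \subset A & #|I| = s /\ {in I &, forall u v, e u v = false}) \/
  (exists2 Q : {set V}, Q \subset A & #|Q| = m /\ {in Q &, forall u v, u != v -> e u v}).
Proof.
have [n] := ubnP (s + m)%N; elim: n s m A => // n IH [|s] [|m] A nA hA.
- by left; exists set0; rewrite ?sub0set // cards0; split => // u v; rewrite inE.
- by left; exists set0; rewrite ?sub0set // cards0; split => // u v; rewrite inE.
- by right; exists set0; rewrite ?sub0set // cards0; split => // u v; rewrite inE.
have [v vA] : exists v, v \in A.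
  by apply/set0Pn; rewrite -card_gt0; apply: leq_trans hA; rewrite expn_gt0.
pose B := (A :\ v) :&: [set w | e v w]; pose C := (A :\ v) :\: [set w | e v w].
have cBC : (#|A| = (#|B| + #|C|).+1)%N.
  by rewrite (cardsD1 v) vA add1n -(cardsID [set w | e v w] (A :\ v)).
have [hB|hC] : (2 ^ (s.+1 + m) <= #|B|)%N \/ (2 ^ (s + m.+1) <= #|C|)%N.
  move: hA; rewrite cBC !addSn !addnS expnS; set X := (2 ^ _)%N; clear; lia.
- case: (IH s.+1 m B _ hB) => [|[I IB hI]|[Q QB [cQ hQ]]]; first by lia.
    by left; exists I => //; apply: subset_trans IB _; rewrite subIset // subD1set.
  have vQ : v \notin Q by apply/negP => /(subsetP QB); rewrite !inE eqxx.
  right; exists (v |: Q).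
    apply/subsetP => w; rewrite !inE => /orP[/eqP -> //|/(subsetP QB)]; by rewrite !inE => /andP[/andP[]].
  rewrite cardsU1 vQ cQ; split=> // a b; rewrite !inE => /orP[/eqP ->|aQ] /orP[/eqP ->|bQ].
  + by rewrite eqxx.
  + by have := subsetP QB _ bQ; rewrite !inE => /andP[].
  + by have := subsetP QB _ aQ; rewrite !inE es => /andP[].
  + exact: hQ.
- case: (IH s m.+1 C _ hC) => [|[I IB [cI hI]]|[Q QB hQ]]; first by lia.
    have vI : v \notin I by apply/negP => /(subsetP IB); rewrite !inE eqxx andbF.
    left; exists (v |: I).
      apply/subsetP => w; rewrite !inE => /orP[/eqP -> //|/(subsetP IB)]; by rewrite !inE => /andP[_ /andP[]].
    rewrite cardsU1 vI cI; split=> // a b; rewrite !inE => /orP[/eqP ->|aQ] /orP[/eqP ->|bQ].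
    + by rewrite ei.
    + by have := subsetP IB _ bQ; rewrite !inE => /andP[/negbTE].
    + by have := subsetP IB _ aQ; rewrite !inE es => /andP[/negbTE].
    + exact: hI.
  by right; exists Q => //; apply: subset_trans QB _; rewrite subDset subsetU // subD1set orbT.
Qed.

(** * Finite tails stronger than the infinite path *)

Section Tails.
Variables (R : realType) (y : R).
Hypotheses (y1 : 1 < y).
Local Notation g := (y^-1).
Local Notation ls := (y + y^-1).

Fixpoint tailcoef (t : R) (i : nat) : R := if i is i'.+1 then (t - tailcoef t i')^-1 else 0.

Lemma inv_bounds : [/\ 0 < g, g < 1 & g * y = 1].
Proof.
have h := y1; have y0 : 0 < y by lra.
by split; rewrite ?invr_gt0 ?invf_lt1 ?mulVf // gt_eqF.
Qed.

(** [tailcoef t i] is the Schur complement of a path with [i] vertices. Below level [ls], the map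
    [h -> (t - h)^-1] has no fixed point in [[0, g]], since [1 - t * h + h ^+ 2] is positive there;
    the iterates gain a fixed amount until they pass [g]. *)
Lemma tailcoef_reach t : 2 <= t -> t < ls ->
  exists l, g <= tailcoef t l /\ forall i, (i < l)%N -> 0 <= tailcoef t i /\ tailcoef t i < g.
Proof.
move=> t2 tl; have [g0 g1 gy] := inv_bounds.
(* A lower bound for the gain in one step, from [1 - t * h + h ^+ 2 = (ls - t) * h + (g - h) * (y -
   h)]: the first summand serves for [h] above [g / 2], the second is at least 1/4 below it.
   Dividing by [t] replaces the larger factor [(t - h)^-1]. *)
pose d := Num.min ((ls - t) * (g / 2)) (1 / 4) / t.
have d0 : 0 < d.
  rewrite divr_gt0 //; last by lra.
  by rewrite lt_min; apply/andP; split; [apply: mulr_gt0; lra | lra].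
have step h : 0 <= h -> h < g -> h + d <= (t - h)^-1.
  move=> h0 hg; have th : 0 < t - h by lra.
  have E : (t - h)^-1 = h + (1 - t * h + h ^+ 2) / (t - h) by field; rewrite gt_eqF.
  rewrite {}E lerD2l /d.
  have num : Num.min ((ls - t) * (g / 2)) (1 / 4) <= 1 - t * h + h ^+ 2.
    rewrite ge_min; apply/orP; have E : 1 - t * h + h ^+ 2 = (ls - t) * h + (g - h) * (y - h).
      by rewrite mulrBr !mulrBl gy; ring.
    have p1 : 0 <= (g - h) * (y - h) by apply: mulr_ge0; lra.
    case: (leP (g / 2) h) => hh; [left|right]; rewrite E.
      by have := ler_wpM2l (_ : 0 <= ls - t) hh; lra.
    have p2 : 0 <= (ls - t) * h by apply: mulr_ge0; lra.
    have p3 : 0 <= (g / 2 - h) * (y - h) by apply: mulr_ge0; lra.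
    have p4 : 0 <= (g / 2) * (g / 2 - h) by apply: mulr_ge0; lra.
    have p5 : 0 <= g * (1 - g) by apply: mulr_ge0; lra.
    have p6 : g / 2 * y = 1 / 2 by rewrite mulrAC gy.
    lra.
  have num0 : 0 <= Num.min ((ls - t) * (g / 2)) (1 / 4).
    by rewrite le_min; apply/andP; split; [apply: mulr_ge0; lra | lra].
  have i1 : t^-1 <= (t - h)^-1 by rewrite lef_pV2 ?posrE //; lra.
  apply: le_trans (_ : (1 - t * h + h ^+ 2) / t <= _).
    by rewrite ler_pM2r // invr_gt0; lra.
  by apply: ler_wpM2l => //; apply: le_trans num.
have ex : exists l, g <= tailcoef t l.
  apply: contrapT => nex.
  have lt l : tailcoef t l < g by rewrite ltNge; apply/negP => h; apply: nex; exists l.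
  have lb l : l%:R * d <= tailcoef t l.
    elim: l => [|l IH] /=; first by rewrite mul0r.
    apply: le_trans (step _ _ (lt l)).
      by rewrite -natr1 mulrDl mul1r lerD2r.
    by apply: le_trans IH; rewrite mulr_ge0 // ltW.
  have := lb (Num.bound (g / d)); have := lt (Num.bound (g / d)).
  have : g / d < (Num.bound (g / d))%:R.
    by apply: archi_boundP; apply: divr_ge0; apply: ltW.
  rewrite ltr_pdivrMr //; lra.
pose l := ex_minn ex; have [hl ml] : g <= tailcoef t l /\ forall i, (i < l)%N -> tailcoef t i < g.
  rewrite /l; case: ex_minnP => m hm mm; split=> // i im; rewrite ltNge; apply/negP => /mm; lia.
exists l; split=> // i il; split; last exact: ml.
elim: i il => [|i IH] il //=.
rewrite invr_ge0; have := ml i (ltnW il); lra.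
Qed.

End Tails.

Section LargeGraphs.
Variables (R : realType) (y : R).
Hypotheses (y1 : 1 < y) (yl : y + y^-1 < 20 / 9).
Local Notation g := (y^-1).
Local Notation ls := (y + y^-1).

Section OneGraph.
Variables (V : finType) (e : rel V) (t : R).
Hypotheses (es : symmetric e) (ei : irreflexive e) (conn : connected_graph e).
Hypotheses (t2 : 2 <= t) (tl : t < ls) (ps : psd e t).

Definition wtailed (T : {set V}) : Prop :=
  exists S : {set V}, [/\ S != set0, S \subset T & tailed e t g T S].

Lemma psd_tailed0 (T S : {set V}) : tailed e t 0 T S.
Proof. by move=> x _; rewrite mul0r subr0. Qed.

(** At a level [t < ls] the coefficient [g] is no longer fixed but increases, as [(t - g)^-1]
    exceeds [(ls - g)^-1 = g]; it may be lowered back to [g]. *)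
Lemma wtailed_step (T : {set V}) p : p \notin T -> (exists2 q, q \in T & e p q) ->
  wtailed (p |: T) -> wtailed T.
Proof.
move=> pT [q qT epq] [S [S0 ST hS]].
have [g0 g1 gy] := inv_bounds y1; have h1 := y1; have h2 := t2; have h3 := tl.
case: (eqVneq (S :&: T) set0) => [ST0|]; last first.
  by exists (S :&: T); split; rewrite ?subsetIr //; apply: tailed_sub hS; exact: subsetUr.
have {ST}ES : S = [set p].
  apply/eqP; rewrite eqEsubset sub1set; apply/andP; split.
    apply/subsetP => v vS; have := subsetP ST v vS; rewrite !inE => /orP[//|vT].
    by have := in_set0 v; rewrite -ST0 inE vS vT.
  case/set0Pn: S0 => v vS; have := subsetP ST v vS; rewrite !inE => /orP[/eqP <- //|vT].
  by have := in_set0 v; rewrite -ST0 inE vS vT.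
exists (T :&: [set v | e p v]); split.
- by apply/set0Pn; exists q; rewrite !inE qT.
- exact: subsetIl.
apply: (@tailed_mono _ _ _ t (t - g)^-1).
  by rewrite lef_pV2 ?posrE; lra.
by rewrite ES in hS; apply: tailed_step => //; lra.
Qed.

(** A shortest path toward [T] serves as the tail. At each elimination only the next path vertex and
    the vertices strictly closer to [T] are kept, so the vertex just eliminated has a single
    neighbor among them and its coefficient passes from [tailcoef t i] to [tailcoef t i.+1]. *)
Lemma far_wtailed (T : {set V}) l : T != set0 -> (0 < l)%N -> g <= tailcoef t l ->
  (forall i, (i < l)%N -> 0 <= tailcoef t i /\ tailcoef t i < g) ->
  (exists v, l <= dist e T v)%N -> wtailed T.
Proof.
move=> T0 l0 hl hi [v0 hv0].
have [g0 g1 gy] := inv_bounds y1; have h2 := t2.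
have lti i : (i < l)%N -> tailcoef t i < t by move=> /hi[]; lra.
have desc i : exists v, dist e T v = (dist e T v0 - i)%N.
  elim: i => [|i [v hv]]; first by exists v0; rewrite subn0.
  case: (posnP (dist e T v)) => hz; first by exists v; llia.
  by have [u _ hu] := dist_parent es conn T0 hz; exists u; llia.
have [vl hvl] : exists v, dist e T v = l.
  have [v hv] := desc (dist e T v0 - l)%N; exists v; llia.
have key i : (i < l)%N -> exists2 p, dist e T p = (l - i)%N &
    tailed e t (tailcoef t i) (p |: [set v | (dist e T v < l - i)%N]) [set p].
  elim: i => [|i IH] il; first by exists vl; rewrite ?subn0 //; exact: psd_tailed0.
  have [p dp hp] := IH (ltnW il).
  have pn : p \notin [set v | (dist e T v < l - i)%N] by rewrite inE dp ltnn.
  have := @tailed_step _ _ _ es ei _ _ _ p (lti _ (ltnW il)) pn hp.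
  have [|u pu du] := @dist_parent _ _ es conn T T0 p; first by llia.
  move=> h; exists u; first by llia.
  have sub : u |: [set v | (dist e T v < l - i.+1)%N] \subset [set v | (dist e T v < l - i)%N].
    by apply/subsetP => w; rewrite !inE => /orP[/eqP ->|]; llia.
  have := tailed_sub sub h; rewrite -[(t - _)^-1]/(tailcoef t i.+1).
  set A := (_ :&: _ :&: _)%SET; suff -> : A = [set u] by [].
  apply/setP => w; rewrite !inE; apply/idP/eqP => [/andP[/andP[h1 h3] /orP[/eqP //|h4]]|->].
    by have := dist_edge es conn T0 h3; llia.
  by rewrite eqxx es pu /= andbT; apply/eqP; llia.
have [|p dp hp] := key l.-1; first by rewrite prednK.
have E1 : (l - l.-1 = 1)%N by llia.
rewrite E1 in dp hp.
have ET : [set v | (dist e T v < 1)%N] = T by apply/setP => v; rewrite inE ltnS leqn0 dist0.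
rewrite ET in hp.
have pT : p \notin T by rewrite -(dist0 es conn T0) dp.
have := @tailed_step _ _ _ es ei _ _ _ p (lti l.-1 _) pT hp; rewrite -[(t - _)^-1]/(tailcoef t l.-1.+1) prednK //.
move=> h; exists (T :&: [set v | e p v]); split; last by apply: tailed_mono hl (h _).
- have [|u pu du] := @dist_parent _ _ es conn T T0 p; first by llia.
  by apply/set0Pn; exists u; rewrite !inE -(dist0 es conn T0) es pu andbT; apply/eqP; llia.
- exact: subsetIl.
Qed.

Lemma reach_wtailed (T : {set V}) q i : T != set0 -> dist e T q = i ->
  exists T' : {set V}, [/\ q \in T', (#|T'| <= #|T| + i)%N & wtailed T' -> wtailed T].
Proof.
move=> T0; elim: i q => [|i IH] q dq.
  exists T; split=> //; last by rewrite addn0.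
  by rewrite -(dist0 es conn T0) dq.
have [|u qu du] := @dist_parent _ _ es conn T T0 q; first by llia.
have [|T' [uT cT' hT']] := IH u; first by llia.
case: (boolP (q \in T')) => qT'; first by exists T'; split=> //; llia.
exists (q |: T'); split; first by rewrite !inE eqxx.
  by rewrite cardsU1 qT' addnS ltnS.
by move=> h; apply: hT'; apply: wtailed_step h => //; exists u; rewrite // es.
Qed.

(** The vector with -2 at the center and 1 at the five leaves has form [9 * t - 20], negative
    because [ls < 20 / 9]. This is the origin of the bound [yl]. *)
Lemma no_star (c : V) (I : {set V}) : #|I| = 5 -> {in I &, forall u v, e u v = false} ->
  (forall v, v \in I -> e c v) -> False.
Proof.
move=> I5 indep star; have [g0 g1 gy] := inv_bounds y1.
have cI : c \notin I by apply/negP => /star; rewrite ei.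
have := ps ((-2) \*o ind R [set c] \+ ind R I).
rewrite qformD // qformZ // qform_ind1 //.
have -> : qform e t (ind R I) = t * 5.
  rewrite qformE; have -> : \sum_v ind R I v ^+ 2 = 5.
    have -> : (5 : R) = #|I|%:R by rewrite I5.
    rewrite -sum1_card natr_sum [RHS]big_mkcond /=; apply: eq_bigr => v _.
    by rewrite /ind; case: (v \in I); rewrite ?expr1n ?expr0n.
  rewrite bform_ind big1 ?addr0 // => u _; rewrite /ind.
  case: (boolP (u \in I)) => uI; last by rewrite mul0r.
  by rewrite big1 ?mulr0 // => v vI; rewrite indep.
rewrite (_ : \sum_v _ = 0); last first.
  apply: big1 => v _ /=; rewrite /ind inE; case: eqP => [->|_]; last by rewrite !mulr0 mul0r.
  by rewrite (negPf cI) mulr0.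
rewrite bformZl bform_ind (bigD1 c) //= [X in -2 * (_ + X)]big1; last first.
  by move=> v /negPf vc; rewrite /ind !inE vc mul0r.
have -> : \sum_(v in I) (e c v)%:R = 5 :> R.
  by rewrite (eq_bigr (fun=> 1)) ?sumr_const ?I5 // => v vI; rewrite star.
rewrite /ind inE eqxx mul1r => h; have := tl; have := yl; lra.
Qed.

Lemma clique_exists (A : {set V}) (c : V) m : (forall v, v \in A -> e c v) -> (2 ^ (5 + m) <= #|A|)%N ->
  exists Q : {set V}, #|Q| = m /\ {in Q &, forall u v, e u v = (u != v)}.
Proof.
move=> cA /(ramsey es ei) [[I IA [I5 hI]]|[Q QA [cQ hQ]]].
  by exfalso; apply: (no_star I5 hI) => v vI; apply: cA; exact: (subsetP IA).
exists Q; split=> // u v uQ vQ; case: (eqVneq u v) => [->|]; first by rewrite ei.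
exact: hQ.
Qed.

(** Sort the vertices of [Q] outside [T] by their neighborhoods in [T]. Some class has at least [m]
    members, and [tailed_clique] applies to it. The vertex [q], common to [T] and [Q], makes the
    neighborhood of this class nonempty. *)
Lemma clique_wtailed (T Q : {set V}) (q : V) m : q \in T -> q \in Q -> (0 < m)%N ->
  g <= m%:R / (t + m%:R - 1) ->
  {in Q &, forall u v, e u v = (u != v)} -> (#|T| + m.+1 * 2 ^ #|T| <= #|Q|)%N -> wtailed T.
Proof.
move=> qT qQ m0 hm cQ big.
pose f (u : V) := T :&: [set v | e u v].
have dQ : (m.+1 * 2 ^ #|T| <= #|Q :\: T|)%N.
  by rewrite -(leq_add2l #|T|); apply: leq_trans big _; rewrite -(cardsID T Q) leq_add2r subset_leq_card // subsetIr.
have [S hS] : exists S : {set V}, (m <= #|(Q :\: T) :&: [set u | f u == S]|)%N /\ S \in powerset T.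
  apply: contrapT => nex.
  have lt S : S \in powerset T -> (#|(Q :\: T) :&: [set u | f u == S]| <= m)%N.
    by move=> ST; apply: ltnW; rewrite ltnNge; apply/negP => h; apply: nex; exists S.
  have : (#|Q :\: T| <= \sum_(S in powerset T) #|(Q :\: T) :&: [set u | f u == S]|)%N.
    have sub : Q :\: T \subset \bigcup_(S in powerset T) ((Q :\: T) :&: [set u | f u == S]).
      apply/subsetP => u uQ; apply/bigcupP; exists (f u); first by rewrite inE subsetIl.
      by rewrite inE uQ inE eqxx.
    apply: leq_trans (subset_leq_card sub) _.
    elim/big_ind2: _ => [|n1 A1 n2 A2 h1 h2|S _]; rewrite ?cards0 //.
    by apply: leq_trans (leq_card_setU _ _) _; exact: leq_add.
  move=> h; have := leq_trans dQ (leq_trans h (leq_sum _ lt)).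
  rewrite sum_nat_const card_powerset mulnC leq_pmul2l ?expn_gt0 //; by rewrite ltnn.
case: hS => hS; rewrite inE => ST.
set Q' := _ :&: _ in hS.
have [u uQ'] : exists u, u \in Q' by apply/set0Pn; rewrite -card_gt0; exact: leq_trans m0 hS.
have Q'P v : v \in Q' -> [/\ v \in Q, v \notin T & f v = S].
  by rewrite !inE => /andP[/andP[h1 h2] /eqP].
have qS : q \in S.
  have [uQ uT <-] := Q'P u uQ'; rewrite !inE qT cQ //.
  by apply: contraNneq uT => ->.
have [g0 g1 gy] := inv_bounds y1; have h2 := t2.
exists S; split=> //; first by apply/set0Pn; exists q.
apply: (@tailed_mono _ _ _ t (#|Q'|%:R / (t + #|Q'|%:R - 1))); last first.
  apply: (tailed_clique es ei) => //; [lra | | exact: leq_trans m0 hS | |].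
  - rewrite -setI_eq0; apply/eqP/setP => v; rewrite [in RHS]inE; apply/negbTE; rewrite inE.
    by apply/negP => /andP[vT /Q'P[_]]; rewrite vT.
  - by move=> a b /Q'P[aQ _ _] /Q'P[bQ _ _]; exact: cQ.
  - by move=> a b aT /Q'P[bQ _ <-]; rewrite !inE aT es.
apply: le_trans hm _.
have m1 : 1 <= m%:R :> R by rewrite ler1n.
have mQ : m%:R <= #|Q'|%:R :> R by rewrite ler_nat.
rewrite ler_pdivrMr; last by lra.
rewrite mulrAC ler_pdivlMr; last by lra.
have := ler_wpM2r (_ : 0 <= t - 1) mQ; lra.
Qed.

(** Without a far vertex, balls around [T] of radius [l] cover the graph and force a degree of at
    least [d]. Stars with five leaves being excluded, Ramsey's theorem finds a large clique among
    these neighbors; a shortest path from [T] to it provides the common vertex that [clique_wtailed]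
    needs. *)
Lemma large_wtailed_with (T : {set V}) l m k d : T != set0 -> (0 < l)%N -> (0 < m)%N -> g <= tailcoef t l ->
  (forall i, (i < l)%N -> 0 <= tailcoef t i /\ tailcoef t i < g) ->
  g <= m%:R / (t + m%:R - 1) -> (#|T| <= k)%N ->
  d = (2 ^ (5 + (k + l + m.+1 * 2 ^ (k + l))))%N -> (k * d ^ l < #|V|)%N -> wtailed T.
Proof.
move=> T0 l0 m0 hl hi hm Tk Ed big.
case: (pselect (exists v, l <= dist e T v)%N) => [ex|nex]; first exact: far_wtailed ex.
have near v : (dist e T v < l)%N by rewrite ltnNge; apply/negP => h; apply: nex; exists v.
have [c hc] : exists c : V, (d <= #|[set w | e c w]|)%N.
  apply: contrapT => nexc.
  have d0 : (0 < d)%N by rewrite Ed expn_gt0.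
  have deg v : (#|[set w | e v w]| <= d.-1)%N.
    by rewrite -ltnS prednK // ltnNge; apply/negP => h; apply: nexc; exists v.
  have := card_ball_le T l deg; rewrite prednK //.
  have -> : ball e T l = setT.
    by apply/setP => v; rewrite inE (mem_ball es conn T0) ltnW.
  rewrite cardsT => h; have := leq_trans big (leq_trans h (leq_mul Tk (leqnn _))).
  by rewrite ltnn.
rewrite Ed in hc.
have [|Q [cQ hQ]] := clique_exists (_ : forall v, v \in [set w | e c w] -> e c v) hc.
  by move=> v; rewrite inE.
have [q qQ] : exists q, q \in Q.
  apply/set0Pn; rewrite -card_gt0 cQ addn_gt0; apply/orP; right; by rewrite muln_gt0 expn_gt0.
have [T' [qT' cT' hT']] := reach_wtailed T0 (erefl (dist e T q)).
apply: hT'; apply: (clique_wtailed qT' qQ m0 hm hQ); rewrite cQ.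
have cT'' : (#|T'| <= k + l)%N.
  apply: leq_trans cT' _; apply: leq_add => //; exact: ltnW.
by apply: leq_add => //; rewrite leq_mul2l leq_exp2l // cT'' orbT.
Qed.

End OneGraph.

Lemma large_wtailed t k : 2 <= t -> t < ls -> exists N, forall (V : finType) (e : rel V),
  symmetric e -> irreflexive e -> connected_graph e -> psd e t -> (N <= #|V|)%N ->
  forall T : {set V}, T != set0 -> (#|T| <= k)%N -> wtailed e t T.
Proof.
move=> t2 tl; have [g0 g1 gy] := inv_bounds y1.
have [l [hl hi]] := tailcoef_reach y1 t2 tl.
have l0 : (0 < l)%N by case: l hl {hi} => //=; lra.
(* [m / (t + m - 1)] tends to 1, which exceeds [g]; solving the inequality for [m] gives this
   bound. *)
pose m := (Num.bound (g * (t - 1) / (1 - g))).+1.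
have hm : g <= m%:R / (t + m%:R - 1).
  have m1 : 1 <= m%:R :> R by rewrite ler1n.
  rewrite ler_pdivlMr; last by lra.
  have : g * (t - 1) / (1 - g) < m%:R.
    apply: lt_le_trans (archi_boundP _) _; last by rewrite ler_nat.
    by apply: divr_ge0; [apply: mulr_ge0|]; lra.
  rewrite ltr_pdivrMr; lra.
exists (k * (2 ^ (5 + (k + l + m.+1 * 2 ^ (k + l)))) ^ l).+1 => V e es ei conn ps big T T0 Tk.
exact: (large_wtailed_with es ei conn t2 tl ps T0 l0 (ltn0Sn _) hl hi hm Tk erefl big).
Qed.

(* A fixed tail strictly inside the critical one can be replaced by the infinite path. *)
Lemma large_tail_attached t k : t < ls -> exists N, forall (V : finType) (e : rel V),
  symmetric e -> irreflexive e -> connected_graph e -> psd e t -> (N <= #|V|)%N ->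
  forall T : {set V}, T != set0 -> (#|T| <= k)%N -> tail_attached y e T.
Proof.
move=> tl; have y2 : 2 < ls.
  have [g0 g1 gy] := inv_bounds y1.
  have : 0 < (1 - g) * (y - 1) by apply: mulr_gt0; have := y1; lra.
  rewrite mulrBr !mulrBl gy; lra.
have [t2|t2] := leP 2 t; last first.
  have [N hN] := @large_wtailed 2 k (lexx _) y2; exists N => V e es ei conn ps big T T0 Tk.
  have [S [S0 ST hS]] := hN V e es ei conn (psd_le (ltW t2) ps) big T T0 Tk.
  by exists S; split=> //; exact: tailed_stailed hS.
have [N hN] := @large_wtailed t k t2 tl; exists N => V e es ei conn ps big T T0 Tk.
have [S [S0 ST hS]] := hN V e es ei conn ps big T T0 Tk.
by exists S; split=> //; exact: tailed_stailed hS.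
Qed.

End LargeGraphs.

(** * Grafting the first vertices of the path *)

Section Pendant.
Variables (U : finType) (e : rel U) (S : {set U}).
Hypotheses (es : symmetric e) (ei : irreflexive e).

Definition pend : rel (option U) := fun x y =>
  match x, y with
  | Some u, Some v => e u v
  | None, Some v => v \in S
  | Some u, None => u \in S
  | None, None => false
  end.

Lemma pend_sym : symmetric pend.
Proof. by case=> [u|] [v|] //=. Qed.

Lemma pend_irr : irreflexive pend.
Proof. by case=> [u|] //=. Qed.

Lemma pend_conn : S != set0 -> connected_graph e -> connected_graph pend.
Proof.
move=> S0 conn T T0 TT; pose T' := [set u | Some u \in T].
have [s sS] := set0Pn _ S0.
case: (boolP (None \in T)) => NT.
  case: (boolP (Some s \in T)) => sT; last by exists (Some s) => //; exists None => //=.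
  have T'0 : T' != set0 by apply/set0Pn; exists s; rewrite inE.
  have [|p pT [q qT epq]] := conn T' T'0.
    apply: contra TT => /eqP E; apply/eqP/setP => -[u|]; rewrite ?NT !inE //.
    by have := in_setT u; rewrite -E inE.
  rewrite !inE in pT qT; by exists (Some p) => //; exists (Some q).
have [s' s'T] : exists u, Some u \in T.
  by case/set0Pn: T0 => -[u|] h; [exists u | rewrite h in NT].
case: (boolP (Some s \in T)) => sT; first by exists None => //; exists (Some s).
have T'0 : T' != set0 by apply/set0Pn; exists s'; rewrite inE.
have [|p pT [q qT epq]] := conn T' T'0.
  by apply: contra sT => /eqP E; have := in_setT s; rewrite -E inE.
rewrite !inE in pT qT; by exists (Some p) => //; exists (Some q).
Qed.

Variable R : realType.

Lemma sum_option (F : option U -> R) : \sum_v F v = F None + \sum_u F (Some u).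
Proof.
rewrite (bigD1 None) //=; congr (_ + _).
rewrite (reindex_omap Some id) /=; last by case.
by apply: eq_bigl => u; rewrite eqxx.
Qed.

Lemma qform_pend (t : R) x : qform pend t x =
  qform e t (fun u => x (Some u)) + 2 * x None * (\sum_(u in S) x (Some u)) + t * x None ^+ 2.
Proof.
rewrite /qform sum_option (sum_option (fun u => \sum_v _)) sum_option /= mul0r mul0r add0r.
set sg := \sum_(u in S) _.
have -> : \sum_u (u \in S)%:R * x None * x (Some u) = x None * sg.
  rewrite /sg mulr_sumr [RHS]big_mkcond /=; apply: eq_bigr => u _.
  by case: (u \in S); rewrite ?mul1r ?mul0r.
have -> : \sum_u \sum_v (pend (Some u) v)%:R * x (Some u) * x v =
    x None * sg + \sum_u \sum_v (e u v)%:R * x (Some u) * x (Some v).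
  rewrite /sg mulr_sumr [X in X + _]big_mkcond -big_split /=; apply: eq_bigr => u _.
  rewrite sum_option /=; congr (_ + _); case: (u \in S); rewrite ?mul1r ?mul0r // mulrC //.
ring.
Qed.

Variable y : R.
Hypothesis y0 : 0 < y.

(** The first vertex of the infinite path is made explicit and the same infinite path remains behind
    it: the new form is the old one plus [y * (s + y^-1 * sg) ^+ 2]. *)
Lemma pend_stailed : stailed e (y + y^-1) y^-1 setT S ->
  stailed pend (y + y^-1) y^-1 setT [set None].
Proof.
move=> h x _ [w xw]; pose z u := x (Some u); pose s := x None.
have -> : \sum_(v in [set None]) x v = s by rewrite big_set1.
rewrite qform_pend -/s -/z; set sg := \sum_(u in S) _; have Esg : sg = \sum_(u in S) z u by [].
have yi : 0 < y^-1 by rewrite invr_gt0.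
have yn : y != 0 by rewrite gt_eqF.
rewrite (_ : _ - _ = (qform e (y + y^-1) z - y^-1 * sg ^+ 2) + y * (s + y^-1 * sg) ^+ 2); last by field.
case: (pselect (exists u, z u != 0)) => [zn|nz].
  apply: ltr_wpDr; first by rewrite mulr_ge0 ?sqr_ge0 // ltW.
  by apply: h => //; move=> v; rewrite inE.
have z0 u : z u = 0 by apply/eqP; apply: contrapT => /negP zu; apply: nz; exists u.
have sg0 : sg = 0 by rewrite Esg big1.
have -> : qform e (y + y^-1) z = 0.
  rewrite /qform !big1 ?mulr0 ?addr0 // => u _; first by rewrite big1 // => v _; rewrite z0 mulr0 mul0r.
  by rewrite z0 expr0n.
rewrite sg0 expr0n /= !mulr0 subr0 add0r addr0 mulr_gt0 // exprn_even_gt0 //=.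
by case: w xw => [u|] //; rewrite -/(z u) z0 eqxx.
Qed.

End Pendant.

Section FourPendants.
Variables (U : finType) (e : rel U) (S : {set U}).
Hypotheses (es : symmetric e) (ei : irreflexive e).

(** Four vertices, so that the levels 0 to 3 counted from the outer end are singletons, as
    [lev_single] demands. *)
Definition pend4 := pend (pend (pend (pend e S) [set None]) [set None]) [set None].

Let W := option (option (option (option U))).
Definition depth (w : W) : nat :=
  match w with None => 0 | Some None => 1 | Some (Some None) => 2
  | Some (Some (Some None)) => 3 | _ => 4 end.

Lemma pend4_sym : symmetric pend4. Proof. by do 4!apply: pend_sym. Qed.
Lemma pend4_irr : irreflexive pend4. Proof. by do 4!apply: pend_irr. Qed.

Lemma none_neq0 (X : finType) : [set None : option X] != set0.
Proof. by apply/set0Pn; exists None; rewrite inE. Qed.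

Lemma pend4_conn : S != set0 -> connected_graph e -> connected_graph pend4.
Proof. by move=> S0 conn; do 3!(apply: pend_conn; first exact: none_neq0); exact: pend_conn. Qed.

Lemma depth_edge u v : pend4 u v -> (depth u <= (depth v).+1)%N.
Proof.
by case: u => [[[[u|]|]|]|]; case: v => [[[[v|]|]|]|]; rewrite /pend4 /= ?inE.
Qed.

Lemma pend4_zrep : S != set0 -> connected_graph e -> forbidden_free pend4 -> zrep e.
Proof.
move=> S0 conn ff; have c4 := pend4_conn S0 conn.
pose T : {set W} := [set None]; have T0 : T != set0 by exact: none_neq0.
pose lv := dist pend4 T.
have ge w : (depth w <= lv w)%N.
  rewrite /lv; have [i hi] : exists i, (dist pend4 T w <= i)%N by exists (dist pend4 T w).
  elim: i w hi => [|i IH] w h.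
    by have := dist0 pend4_sym c4 T0 w; rewrite -leqn0 h => /esym; rewrite inE => /eqP ->.
  case: (posnP (dist pend4 T w)) => z; first by apply: leq_trans (IH w _) _; rewrite ?z.
  have [u uw du] := dist_parent pend4_sym c4 T0 z.
  have := IH u; have := depth_edge (etrans (pend4_sym w u) uw); lia.
have le0 : lv None = 0%N by apply/eqP; rewrite dist0 ?inE //; exact: pend4_sym.
have le1 : (lv (Some None) <= 1)%N.
  by rewrite -le0; apply: dist_edge => //; [exact: pend4_sym | rewrite /pend4 /= inE].
have le2 : (lv (Some (Some None)) <= 2)%N.
  apply: (leq_trans (dist_edge pend4_sym c4 T0 (v := Some None) _)) => //.
  by rewrite /pend4 /= inE.
have le3 : (lv (Some (Some (Some None))) <= 3)%N.
  apply: (leq_trans (dist_edge pend4_sym c4 T0 (v := Some (Some None)) _)) => //.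
  by rewrite /pend4 /= inE.
have [|C [phi hphi]] := forbidden_free_zrep pend4_sym pend4_irr ff (dist_edge pend4_sym c4 T0)
  (dist_parent pend4_sym c4 T0) _.
  move=> u v huv h3; rewrite -/lv in huv h3; have h3' : (lv v <= 3)%N by rewrite -huv.
  have gu := ge u; have gv := ge v; clear ge; clearbody lv; move: le0 le1 le2 le3 huv h3 h3' gu gv; clear.
  by case: u => [[[[u|]|]|]|]; case: v => [[[[v|]|]|]|] //=; lia.
exists C, (fun u => phi (Some (Some (Some (Some u))))) => u v; rewrite hphi.
by rewrite /pend4 /=.
Qed.

Lemma stailed_zrep (R : realType) (y : R) : 0 < y -> y ^+ 6 = y ^+ 2 + 1 ->
  S != set0 -> connected_graph e -> stailed e (y + y^-1) y^-1 setT S -> zrep e.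
Proof.
move=> y0 y6 S0 conn h; apply: pend4_zrep => //.
apply: (stailed_forbidden_free y0 y6 pend4_sym pend4_irr (S := [set None])).
- exact: pend4_conn.
- exact: none_neq0.
by apply: pend_stailed => //; apply: pend_stailed => //; apply: pend_stailed => //; apply: pend_stailed.
Qed.

End FourPendants.

(** * Anchors *)

Definition zrep_on (V : finType) (e : rel V) (T : {set V}) : Prop :=
  exists (C : finType) (phi : V -> C -> int),
    {in T &, forall u v, \sum_c phi u c * phi v c = (u == v)%:Z *+ 2 + (e u v)%:Z}.

Definition connected_in (V : finType) (e : rel V) (T : {set V}) : Prop :=
  forall A : {set V}, A \subset T -> A != set0 -> A != T ->
    exists2 p, p \in T :\: A & exists2 q, q \in A & e p q.

Section Restrict.
Variables (R : realType) (y : R).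
Hypotheses (y0 : 0 < y) (y6 : y ^+ 6 = y ^+ 2 + 1).
Variables (V : finType) (e : rel V) (T : {set V}).
Hypotheses (es : symmetric e) (ei : irreflexive e).
Let U : finType := {x | x \in T}.
Definition restr : rel {x | x \in T} := fun a b => e (val a) (val b).

Lemma restr_sym : symmetric restr. Proof. by move=> a b; rewrite /restr es. Qed.
Lemma restr_irr : irreflexive restr. Proof. by move=> a; rewrite /restr ei. Qed.

Lemma restr_conn : connected_in e T -> connected_graph restr.
Proof.
move=> conn A A0 AT; have [|||p pA [q qA epq]] := conn (val @: A).
- by apply/subsetP => v /imsetP[u _ ->]; exact: valP.
- by case/set0Pn: A0 => a aA; apply/set0Pn; exists (val a); exact: imset_f.
- apply: contra AT => /eqP E; apply/eqP/setP => a; rewrite inE.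
  by have : val a \in val @: A; [rewrite E; exact: valP | rewrite mem_imset //; exact: val_inj].
move: pA; rewrite inE => /andP[pA pT]; exists (Sub p pT).
  by apply: contra pA => h; apply/imsetP; exists (Sub p pT); rewrite ?SubK.
by case/imsetP: qA => a aA Eq; exists a => //; rewrite /restr SubK -Eq.
Qed.

Lemma restr_stailed (t h : R) (S : {set V}) : S \subset T -> stailed e t h T S ->
  stailed restr t h setT [set u | val u \in S].
Proof.
move=> ST hS x _ [w xw].
rewrite (eq_bigl (fun i : U => val i \in S)); last by move=> i; rewrite inE.
have vi : injective (val : U -> V) by exact: val_inj.
have := hS (push (val : U -> V) x) _ _; rewrite qform_push // sum_push_in //.
apply; last by exists (val w); rewrite push_f.
move=> v vT; apply: push_supp; apply: contra vT => /imsetP[a _ ->]; exact: valP.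
Qed.

Lemma restr_forbidden_free (S : {set V}) : S != set0 -> S \subset T -> connected_in e T ->
  stailed e (y + y^-1) y^-1 T S -> forbidden_free (pend4 restr [set u | val u \in S]).
Proof.
move=> S0 ST conn hS.
have S0' : [set u : U | val u \in S] != set0.
  by case/set0Pn: S0 => s sS; apply/set0Pn; exists (Sub s (subsetP ST s sS)); rewrite inE SubK.
have p0 : 0 < y by exact: y0.
apply: (stailed_forbidden_free y0 y6 (pend4_sym _ restr_sym) (pend4_irr _ restr_irr) (S := [set None])).
- by apply: pend4_conn => //; exact: restr_conn.
- exact: none_neq0.
do 4!(apply: pend_stailed => //); exact: restr_stailed.
Qed.

Lemma stailed_zrep_on (S : {set V}) : S != set0 -> S \subset T -> connected_in e T ->
  stailed e (y + y^-1) y^-1 T S -> zrep_on e T.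
Proof.
move=> S0 ST conn hS.
have S0' : [set u : U | val u \in S] != set0.
  by case/set0Pn: S0 => s sS; apply/set0Pn; exists (Sub s (subsetP ST s sS)); rewrite inE SubK.
have [C [phi hphi]] := stailed_zrep restr_sym restr_irr y0 y6 S0' (restr_conn conn) (restr_stailed ST hS).
exists C, (fun v => if insub v is Some u then phi u else fun=> 0) => u v uT vT.
by rewrite (insubT (mem T) uT) (insubT (mem T) vT) hphi /restr !SubK.
Qed.

End Restrict.

(** * Integer vectors of norm 2 *)

Section IntVectors.
Variable C : finType.
Implicit Types a b : C -> int.

Lemma sq_int (x : int) : x ^+ 2 <= 2 -> [\/ x = 0, x = 1 | x = -1].
Proof. by move=> h; case: (ltgtP x 0) => hx; [constructor 3 | constructor 2 | constructor 1]; nia. Qed.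

Lemma sum_sq_sub a (s : seq C) : uniq s -> \sum_(c <- s) a c ^+ 2 <= \sum_c a c ^+ 2.
Proof.
move=> us; rewrite [X in _ <= X](bigID (mem s)) /= -big_uniq //= lerDl.
by apply: sumr_ge0 => c _; exact: sqr_ge0.
Qed.

Section NormTwo.
Variable a : C -> int.
Hypothesis ha : \sum_c a c * a c = 2.

Let ha' : \sum_c a c ^+ 2 = 2.
Proof. by rewrite -[RHS]ha; apply: eq_bigr => c _; rewrite expr2. Qed.

Lemma norm2_val c : [\/ a c = 0, a c = 1 | a c = -1].
Proof.
by apply: sq_int; rewrite -ha' (bigD1 c) //= lerDl; apply: sumr_ge0 => i _; exact: sqr_ge0.
Qed.

Lemma norm2_sq c : a c != 0 -> a c ^+ 2 = 1.
Proof. by case: (norm2_val c) => ->. Qed.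

Lemma norm2_two c d b : c != d -> a c != 0 -> a d != 0 ->
  \sum_i a i * b i = a c * b c + a d * b d.
Proof.
move=> cd ac ad; rewrite (bigD1 c) //= (bigD1 d) 1?eq_sym //= addrA big1 ?addr0 // => i /andP[ic id].
case: (eqVneq (a i) 0) => [->|ai]; first by rewrite mul0r.
have := @sum_sq_sub a [:: c; d; i]; rewrite ha' !big_cons big_nil !norm2_sq // => hh.
by have := hh _; rewrite /= !inE !negb_or cd (eq_sym c) ic (eq_sym d) id => /(_ isT).
Qed.

Lemma norm2_other c : a c != 0 -> exists2 d, c != d & a d != 0.
Proof.
move=> ac; apply: contrapT => nex; have : \sum_c a c ^+ 2 = 1.
  rewrite (bigD1 c) //= norm2_sq // big1 ?addr0 // => i ic.
  case: (eqVneq (a i) 0) => [->|ne]; first by rewrite expr0n.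
  by exfalso; apply: nex; exists i; rewrite // eq_sym.
by rewrite ha'.
Qed.

Lemma norm2_nz : exists c, a c != 0.
Proof.
apply: contrapT => nex; have : \sum_c a c ^+ 2 = 0.
  by apply: big1 => c _; case: (eqVneq (a c) 0) => [->|ne]; [rewrite expr0n | exfalso; apply: nex; exists c].
by rewrite ha'.
Qed.

Lemma norm2_le3 c d i : c != d -> c != i -> d != i -> a c ^+ 2 + a d ^+ 2 + a i ^+ 2 <= 2.
Proof.
move=> cd ci di; have := @sum_sq_sub a [:: c; d; i]; rewrite ha' !big_cons big_nil addr0 addrA; apply.
by rewrite /= !inE !negb_or cd ci di.
Qed.

End NormTwo.

(** Such vectors have two nonzero entries, each 1 or -1. Inner product 1 forces exactly one common
    coordinate, entered with the same sign: with two common coordinates the product would be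
    even. *)
Lemma common_coord a b : \sum_c a c * a c = 2 -> \sum_c b c * b c = 2 -> \sum_c a c * b c = 1 ->
  exists c0 c1 c2 s p q, [/\ [/\ c0 != c1, c0 != c2 & c1 != c2],
    [/\ s ^+ 2 = 1, p ^+ 2 = 1 & q ^+ 2 = 1],
    a c0 = s, b c0 = s &
    (forall x : C -> int, \sum_c a c * x c = s * x c0 + p * x c1) /\
    (forall x : C -> int, \sum_c b c * x c = s * x c0 + q * x c2)].
Proof.
move=> ha hb hab.
have main c d : c != d -> a c != 0 -> a d != 0 -> b c != 0 -> b d = 0 ->
  exists c0 c1 c2 s p q, [/\ [/\ c0 != c1, c0 != c2 & c1 != c2],
    [/\ s ^+ 2 = 1, p ^+ 2 = 1 & q ^+ 2 = 1],
    a c0 = s, b c0 = s &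
    (forall x : C -> int, \sum_c a c * x c = s * x c0 + p * x c1) /\
    (forall x : C -> int, \sum_c b c * x c = s * x c0 + q * x c2)].
  move=> cd ac ad bc bd; have [d' cd' bd'] := norm2_other hb bc.
  have E : b c = a c.
    have := hab; rewrite (norm2_two ha _ cd ac ad) bd mulr0 addr0.
    by case: (norm2_val ha c) => -> //; case: (norm2_val hb c) => ->.
  exists c, d, d', (a c), (a d), (b d'); split; rewrite ?norm2_sq //.
    by split=> //; apply: contraNneq bd' => <-; rewrite bd.
  split=> x; first exact: norm2_two.
  by rewrite -E; exact: norm2_two.
have [c ac] := norm2_nz ha; have [d cd ad] := norm2_other ha ac.
have := hab; rewrite (norm2_two ha _ cd ac ad).
have [bc0|bc1|bc1] := norm2_val hb c; have [bd0|bd1|bd1] := norm2_val hb d.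
all: try by rewrite ?bc0 ?bd0 ?bc1 ?bd1; move: ac ad; case: (norm2_val ha c) => ->; case: (norm2_val ha d) => ->.
all: try by move=> _; apply: (main c d); rewrite ?bc1 ?bd0.
all: try by move=> _; apply: (main d c); rewrite ?bd1 ?bc0 // 1?eq_sym //.
Qed.

End IntVectors.

Lemma sum3_le2 (x y z : int) : 0 <= x -> 0 <= y -> 0 <= z -> x + y + z <= 2 ->
  [/\ x <= 2, y <= 2 & z <= 2].
Proof. by move=> *; split; lia. Qed.

Section Anchors.
Variables (V : finType) (e : rel V).
Hypotheses (es : symmetric e) (ei : irreflexive e).

(** In any representation of any [T] containing [X], one signed coordinate is the indicator of [S]
    on [T]; this is what allows a path to be grafted along [S]. The same [S] serves all [T] and all
    representations. The third clause keeps [S] within distance one of [X], so that a forbidden copy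
    using the grafted path stays connected with [X]. *)
Definition anchor (X S : {set V}) : Prop :=
  [/\ X :&: S != set0, connected_in e X, forall v, v \in S -> v \in X \/ exists2 x, x \in X & e v x &
    forall T : {set V}, X \subset T -> forall (C : finType) (phi : V -> C -> int),
      {in T &, forall u v, \sum_c phi u c * phi v c = (u == v)%:Z *+ 2 + (e u v)%:Z} ->
      exists c s, s ^+ 2 = 1 /\ {in T, forall v, s * phi v c = (v \in S)%:Z}].

Definition path_side (v1 v2 v3 v4 : V) : {set V} :=
  [set v | [|| v == v2, v == v3 | [&& e v v2, e v v3 & ~~ (e v v1 && e v v4)]]].

(** The coordinate is the one shared by [v2] and [v3]. A vertex adjacent to both of these uses it,
    except a vertex that meets each of them in its other coordinate; the latter is recognized by
    being adjacent to both [v1] and [v4]. *)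
Lemma path_anchor v1 v2 v3 v4 : e v1 v2 -> e v2 v3 -> e v3 v4 -> e v1 v3 = false ->
  e v2 v4 = false -> e v1 v4 = false -> anchor [set v1; v2; v3; v4] (path_side v1 v2 v3 v4).
Proof.
move=> e12 e23 e34 e13 e24 e14.
have adj_neq u v : e u v -> (u == v) = false.
  by move=> uv; apply/negbTE; apply: contraTneq uv => ->; rewrite ei.
have n12 := adj_neq _ _ e12; have n23 := adj_neq _ _ e23; have n34 := adj_neq _ _ e34.
have n13 : (v1 == v3) = false by apply/negbTE; apply: contraTneq e34 => <-; rewrite e14.
have n24 : (v2 == v4) = false by apply/negbTE; apply: contraTneq e12 => ->; rewrite e14.
have n14 : (v1 == v4) = false by apply/negbTE; apply: contraTneq e12 => ->; rewrite es e24.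
split.
- by apply/set0Pn; exists v2; rewrite !inE eqxx ?orbT.
- move=> A AX A0 AN; apply: contrapT => nex.
  have cl u v : u \in [set v1; v2; v3; v4] -> v \in [set v1; v2; v3; v4] -> e u v -> (u \in A) = (v \in A).
    move=> uX vX uv; apply/idP/idP => h; apply: contrapT => /negP nh; apply: nex.
      by exists v; [rewrite inE nh | exists u; rewrite // es].
    by exists u; [rewrite inE nh | exists v].
  have c12 := cl v1 v2; have c23 := cl v2 v3; have c34 := cl v3 v4.
  rewrite !inE !eqxx ?orbT in c12 c23 c34.
  have {}c12 := c12 isT isT e12; have {}c23 := c23 isT isT e23; have {}c34 := c34 isT isT e34.
  case: (boolP (v1 \in A)) => h1; last first.
    case/set0Pn: A0 => a aA; have := subsetP AX a aA; rewrite !inE => /orP[/orP[/orP[]|]|] /eqP ae;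
    by move: aA h1; rewrite ae c12 ?c23 ?c34 => ->.
  move/negP: AN; apply; rewrite eqEsubset AX; apply/subsetP => a; rewrite !inE => /orP[/orP[/orP[]|]|] /eqP ->;
  by move: h1; rewrite c12 ?c23 ?c34 => // ->.
- move=> v; rewrite !inE => /or3P[/eqP ->|/eqP ->|/and3P[h _ _]]; try by left; rewrite eqxx ?orbT.
  by right; exists v2; rewrite // !inE eqxx ?orbT.
move=> T XT C phi gram.
have [t1 t2 t3 t4] : [/\ v1 \in T, v2 \in T, v3 \in T & v4 \in T].
  by split; apply: (subsetP XT); rewrite !inE eqxx ?orbT.
have nrm v : v \in T -> \sum_c phi v c * phi v c = 2 by move=> vT; rewrite gram // eqxx ei.
have ne u v : u \in T -> v \in T -> (u == v) = false -> \sum_c phi u c * phi v c = (e u v)%:Z.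
  by move=> uT vT uv; rewrite gram // uv mul0rn add0r.
have [c0 [c1 [c2 [s [p [q [[n01 n02 n12'] [s2 p2 q2] E2 E3 [d2 d3]]]]]]]] :=
  common_coord (nrm _ t2) (nrm _ t3) (etrans (ne _ _ t2 t3 n23) (congr1 (fun b : bool => b%:Z) e23)).
exists c0, s; split=> //.
have sq1 (x : int) : x ^+ 2 = 1 -> x = 1 \/ x = -1.
  by move=> h; have [|h0|h0|h0] := @sq_int x; rewrite ?h ?h0 //; auto; move: h; rewrite h0.
(* The signed coordinates shared by [v2] and [v3], private to [v2], and private to [v3]. *)
pose X v := s * phi v c0; pose A v := p * phi v c1; pose B v := q * phi v c2.
have sqE (u x : int) : u ^+ 2 = 1 -> (u * x) ^+ 2 = x ^+ 2 by move=> h; rewrite exprMn h mul1r.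
have vals v : v \in T -> [/\ [\/ X v = 0, X v = 1 | X v = -1], [\/ A v = 0, A v = 1 | A v = -1],
    [\/ B v = 0, B v = 1 | B v = -1] & X v ^+ 2 + A v ^+ 2 + B v ^+ 2 <= 2].
  move=> vT; have h3 : X v ^+ 2 + A v ^+ 2 + B v ^+ 2 <= 2.
    by rewrite /X /A /B !sqE //; exact: (norm2_le3 (nrm _ vT) n01 n02 n12').
  have [hX hA hB] := sum3_le2 (sqr_ge0 (X v)) (sqr_ge0 (A v)) (sqr_ge0 (B v)) h3.
  by split=> //; exact: sq_int.
have D2 v : v \in T -> (v == v2) = false -> X v + A v = (e v v2)%:Z.
  by move=> vT nv; rewrite -ne //; rewrite /X /A -d2; apply: eq_bigr => c _; rewrite mulrC.
have D3 v : v \in T -> (v == v3) = false -> X v + B v = (e v v3)%:Z.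
  by move=> vT nv; rewrite -ne //; rewrite /X /B -d3; apply: eq_bigr => c _; rewrite mulrC.
have dXA v w : v \in T -> X v != 0 -> A v != 0 -> \sum_c phi v c * phi w c = X v * X w + A v * A w.
  move=> vT; rewrite /X /A !mulf_eq0 !negb_or => /andP[_ x0] /andP[_ a0].
  rewrite (norm2_two (nrm _ vT) _ n01 x0 a0).
  by rewrite mulrACA -expr2 s2 mul1r mulrACA -expr2 p2 mul1r.
have dXB v w : v \in T -> X v != 0 -> B v != 0 -> \sum_c phi v c * phi w c = X v * X w + B v * B w.
  move=> vT; rewrite /X /B !mulf_eq0 !negb_or => /andP[_ x0] /andP[_ a0].
  rewrite (norm2_two (nrm _ vT) _ n02 x0 a0).
  by rewrite mulrACA -expr2 s2 mul1r mulrACA -expr2 q2 mul1r.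
have dAB v w : v \in T -> A v != 0 -> B v != 0 -> \sum_c phi v c * phi w c = A v * A w + B v * B w.
  move=> vT; rewrite /A /B !mulf_eq0 !negb_or => /andP[_ x0] /andP[_ a0].
  rewrite (norm2_two (nrm _ vT) _ n12' x0 a0).
  by rewrite mulrACA -expr2 p2 mul1r mulrACA -expr2 q2 mul1r.
have hX2 : X v2 = 1 by rewrite /X E2 -expr2.
have hX3 : X v3 = 1 by rewrite /X E3 -expr2.
have d14 := ne _ _ t1 t4 n14; rewrite e14 in d14.
have [a1 a1'] : X v1 + A v1 = 1 /\ X v1 + B v1 = 0 by rewrite D2 // D3 // e12 e13.
have [a4 a4'] : X v4 + A v4 = 0 /\ X v4 + B v4 = 1.
  by rewrite D2 1?eq_sym // D3 1?eq_sym // es e24 es e34.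
have [x1v1 x1a x1b s1] := vals _ t1; have [x4v x4a x4b s4] := vals _ t4.
(* The ends avoid the shared coordinate: otherwise the norm bounds fail or [v1] and [v4] have a
   nonzero product. *)
have [z1 z4] : X v1 = 0 /\ X v4 = 0.
{ case: x1v1 => x1; case: x4v => x4; rewrite x1 in a1 a1' s1; rewrite x4 in a4 a4' s4 => //.
  all: try by exfalso; move: a1 a1' a4 a4' s1 s4; clear; nia.
  all: exfalso.
  - have n1 : X v4 != 0 by rewrite x4.
    have n2 : A v4 != 0 by apply: (contra_eq_neq _ a4) => ->.
    have := dXA v4 v1 t4 n1 n2; rewrite (eq_bigr (fun c => phi v1 c * phi v4 c)) => [|c _]; last by rewrite mulrC.
    by rewrite d14 x4 x1; move: a1 a4; clear; nia.
  - have n1 : X v1 != 0 by rewrite x1.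
    have n2 : B v1 != 0 by apply: (contra_eq_neq _ a1') => ->.
    by have := dXB v1 v4 t1 n1 n2; rewrite d14 x4 x1; move: a1' a4'; clear; nia.
  - have n1 : X v1 != 0 by rewrite x1.
    have n2 : B v1 != 0 by apply: (contra_eq_neq _ a1') => ->.
    by have := dXB v1 v4 t1 n1 n2; rewrite d14 x4 x1; move: a1' a4'; clear; nia. }
rewrite z1 !add0r in a1 a1'; rewrite z4 !add0r in a4 a4'.
move=> v vT; rewrite -/(X v) inE.
case: (eqVneq v v2) => [->|n2]; first by rewrite hX2.
case: (eqVneq v v3) => [->|n3]; first by rewrite hX3.
move/negbTE: n2 => n2; move/negbTE: n3 => n3.
have v2v := D2 v vT n2; have v3v := D3 v vT n3.
have [xv av bv sv] := vals _ vT.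
have ge0 w : w \in T -> 0 <= \sum_c phi v c * phi w c by move=> wT; rewrite gram.
have eq1 w : w \in T -> \sum_c phi v c * phi w c = 1 -> e v w.
  by move=> wT; rewrite gram //; case: (v == w); case: (e v w).
have nz1 (x : int) : x = 1 -> x != 0 by move=> ->.
have nzN1 (x : int) : x = -1 -> x != 0 by move=> ->.
case: xv => xv; rewrite xv in v2v v3v sv.
- rewrite xv; case: (boolP (e v v2)) v2v => //= e2 v2v; case: (boolP (e v v3)) v3v => //= e3 v3v.
  rewrite !add0r in v2v v3v; rewrite !eq1 //.
    by rewrite (dAB v v4 vT (nz1 _ v2v) (nz1 _ v3v)) v2v v3v a4 a4'.
  by rewrite (dAB v v1 vT (nz1 _ v2v) (nz1 _ v3v)) v2v v3v a1 a1'.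
- have A0 : A v = 0.
    case: av => // av; first by move: v2v; rewrite av; case: (e v v2).
    by have := ge0 v1 t1; rewrite (dXA v v1 vT (nz1 _ xv) (nzN1 _ av)) xv av z1 a1.
  have B0 : B v = 0.
    case: bv => // bv; first by move: v3v; rewrite bv; case: (e v v3).
    by have := ge0 v4 t4; rewrite (dXB v v4 vT (nz1 _ xv) (nzN1 _ bv)) xv bv z4 a4'.
  rewrite A0 in v2v; rewrite B0 in v3v.
  case: (boolP (e v v2)) v2v => //= e2 _; case: (boolP (e v v3)) v3v => //= e3 _.
  rewrite xv; case: (boolP (e v v1 && e v v4)) => // /andP[ev1 ev4]; exfalso.
  have nv1 : (v == v1) = false by apply: adj_neq.
  have nv4 : (v == v4) = false by apply: adj_neq.
  (* Adjacent to both ends, [v] would meet them in its second coordinate [d]. The only other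
     coordinate of [v1] is [c1], which [v4] does not use, so [v1] and [v4] would have a nonzero
     product. *)
  have x0 : phi v c0 != 0 by move: (nz1 _ xv); rewrite /X mulf_eq0 negb_or => /andP[].
  have [d nd pd] := norm2_other (nrm _ vT) x0.
  have z0 w : X w = 0 -> phi w c0 = 0.
    by move=> /eqP; rewrite /X mulf_eq0 => /orP[/eqP s0|/eqP //]; move: s2; rewrite s0.
  have w1 := ne v v1 vT t1 nv1; rewrite ev1 (norm2_two (nrm _ vT) _ nd x0 pd) (z0 v1 z1) mulr0 add0r in w1.
  have w4 := ne v v4 vT t4 nv4; rewrite ev4 (norm2_two (nrm _ vT) _ nd x0 pd) (z0 v4 z4) mulr0 add0r in w4.
  have p1d : phi v1 d != 0 by apply: (contra_eq_neq _ w1) => ->; rewrite mulr0.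
  have p4d : phi v4 d != 0 by apply: (contra_eq_neq _ w4) => ->; rewrite mulr0.
  have p1c : phi v1 c1 != 0 by move: (nz1 _ a1); rewrite /A mulf_eq0 negb_or => /andP[].
  have d1 : c1 != d.
    apply: contraNneq pd => <-; move: A0 => /eqP; rewrite /A mulf_eq0 => /orP[/eqP s0|//].
    by move: p2; rewrite s0.
  have p4c : phi v4 c1 = 0.
    by move: a4 => /eqP; rewrite /A mulf_eq0 => /orP[/eqP s0|/eqP //]; move: p2; rewrite s0.
  have := d14; rewrite (norm2_two (nrm _ t1) _ d1 p1c p1d) p4c mulr0 add0r => /eqP.
  by rewrite mulf_eq0 (negPf p1d) (negPf p4d).
- exfalso; have A1 : A v = 1.
    by case: av => // av; move: v2v; rewrite av; case: (e v v2).
  have B1 : B v = 1 by case: bv => // bv; move: v3v; rewrite bv; case: (e v v3).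
  by move: sv; rewrite A1 B1.
Qed.

Definition clique_side (q : 'I_4 -> V) : {set V} := [set v | (3 <= #|[set i | e v (q i)]|)%N].

(** Four vectors with pairwise product 1 have a common coordinate, the fourth excluding the triangle
    pattern, and their other coordinates are distinct. A vertex with entry 1 there has at most one
    further coordinate and hence at least three neighbors in the clique; one with entry 0 has at
    most two. *)
Lemma clique_anchor (q : 'I_4 -> V) : injective q -> (forall i j, i != j -> e (q i) (q j)) ->
  anchor (q @: setT) (clique_side q).
Proof.
move=> qi cq.
have adjq i : [set j | e (q i) (q j)] = [set~ i].
  by apply/setP => j; rewrite !inE; case: (eqVneq j i) => [->|ji]; rewrite ?ei // cq // eq_sym.
have qS i : q i \in clique_side q by rewrite inE adjq cardsC1 card_ord.
split.
- by apply/set0Pn; exists (q ord0); rewrite inE imset_f ?qS.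
- move=> A AX A0 AN; have [a aA] := set0Pn _ A0.
  have [b bX bA] : exists2 b, b \in q @: setT & b \notin A.
    apply/subsetPn; apply: contra AN => h; by rewrite eqEsubset AX.
  exists b; first by rewrite inE bA.
  exists a => //; have /imsetP[i _ Ei] := bX; have /imsetP[j _ Ej] := subsetP AX a aA.
  by rewrite Ei Ej cq //; apply: contraNneq bA => ij; rewrite Ei ij -Ej.
- move=> v; rewrite inE => h; right.
  have /card_gt0P[i] : (0 < #|[set i | e v (q i)]|)%N by apply: leq_trans h.
  by rewrite inE => ei'; exists (q i); rewrite ?imset_f.
move=> T XT C phi gram.
have tq i : q i \in T by apply: (subsetP XT); exact: imset_f.
have nrm v : v \in T -> \sum_c phi v c * phi v c = 2 by move=> vT; rewrite gram // eqxx ei.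
have ne u v : u \in T -> v \in T -> (u == v) = false -> \sum_c phi u c * phi v c = (e u v)%:Z.
  by move=> uT vT uv; rewrite gram // uv mul0rn add0r.
have neq i j : i != j -> (q i == q j) = false by rewrite (inj_eq qi) => /negbTE.
have gq i j : i != j -> \sum_c phi (q i) c * phi (q j) c = 1.
  by move=> ij; rewrite ne ?neq // cq.
pose i0 : 'I_4 := ord0; pose i1 : 'I_4 := lift ord0 ord0.
have [c0 [c1 [c2 [s [p [r [[n01 n02 n12] [s2 p2 r2] E0 E1 [d0 d1]]]]]]]] :=
  common_coord (nrm _ (tq i0)) (nrm _ (tq i1)) (gq i0 i1 isT).
exists c0, s; split=> //.
pose X v := s * phi v c0.
have X01 : X (q i0) = 1 /\ X (q i1) = 1 by rewrite /X E0 E1 -expr2.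
have Xs v : X v = 1 -> phi v c0 = s.
  by move=> h; rewrite -[RHS]mulr1 -h /X mulrA -expr2 s2 mul1r.
have Xval v : v \in T -> [\/ X v = 0, X v = 1 | X v = -1].
  move=> vT; rewrite /X; have [s1|s1] : s = 1 \/ s = -1.
  - by move/eqP: s2; rewrite sqrf_eq1 => /orP[] /eqP ->; [left|right].
  - by rewrite s1 mul1r; exact: norm2_val (nrm _ vT) c0.
  - rewrite s1; case: (norm2_val (nrm _ vT) c0) => ->; rewrite ?mulr0 ?mulr1 ?mulrNN ?mulr1;
    by [constructor 1|constructor 2|constructor 3].
have dAB i : i != i0 -> i != i1 -> p * phi (q i) c1 = 1 - X (q i) /\ r * phi (q i) c2 = 1 - X (q i).
  move=> n0 n1; have := gq i0 i; have := gq i1 i; rewrite d0 d1 -/(X _) ![_ == i]eq_sym => /(_ n1) h1 /(_ n0) h0.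
  by split; [rewrite -h0|rewrite -h1]; rewrite addrC addKr.
have X1 i : X (q i) = 1.
  case: (eqVneq i i0) => [->|n0]; first by case: X01.
  case: (eqVneq i i1) => [->|n1]; first by case: X01.
  have [A B] := dAB i n0 n1; have h3 := norm2_le3 (nrm _ (tq i)) n01 n02 n12.
  have sqE (u x : int) : u ^+ 2 = 1 -> (u * x) ^+ 2 = x ^+ 2 by move=> h; rewrite exprMn h mul1r.
  rewrite -(sqE _ _ s2) -(sqE _ (phi _ c1) p2) -(sqE _ (phi _ c2) r2) -/(X _) A B in h3.
  case: (Xval (q i) (tq i)) => // x; last by move: h3; rewrite x.
  exfalso; rewrite x subr0 in A B.
  have [j [j0 j1 ji]] : exists j, [/\ j != i0, j != i1 & i != j].
    pose Y := [set i0; i1; i]; have : ~~ ([set: 'I_4] \subset Y).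
      apply/negP => /subset_leq_card; rewrite cardsT card_ord; apply/negP; rewrite -ltnNge.
      apply: leq_ltn_trans (leq_card_setU _ _) _; rewrite cards1.
      by rewrite cards2; case: (_ != _).
    by case/subsetPn => j _; rewrite !inE !negb_or -andbA => /and3P[? ? ?]; exists j; split; rewrite // eq_sym.
  have [Aj Bj] := dAB j j0 j1; have := gq i j ji.
  have z1 : phi (q i) c1 != 0 by apply: (contra_eq_neq _ A) => ->; rewrite mulr0.
  have z2 : phi (q i) c2 != 0 by apply: (contra_eq_neq _ B) => ->; rewrite mulr0.
  have E (a u w : int) : a ^+ 2 = 1 -> u * w = (a * u) * (a * w).
    by move=> h; rewrite mulrACA -expr2 h mul1r.
  rewrite (norm2_two (nrm _ (tq i)) _ n12 z1 z2) (E _ _ _ p2) (E _ (phi _ c2) _ r2) A B Aj Bj; clear; lia.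
have qc i : phi (q i) c0 = s by apply: Xs.
have s0 : s != 0 by apply: (contra_eq_neq _ s2) => ->.
have /choice[c hc] : forall i, exists d, c0 != d /\ phi (q i) d != 0.
  by move=> i; have [|d ? ?] := norm2_other (nrm _ (tq i)) (c := c0); [rewrite qc | exists d].
have cne i : c0 != c i by case: (hc i).
have dq i x : \sum_c phi (q i) c * phi x c = X x + phi (q i) (c i) * phi x (c i).
  by case: (hc i) => h1 h2; rewrite (norm2_two (nrm _ (tq i)) _ h1) ?qc.
have cinj : injective c.
  move=> i j ij; apply/eqP; apply: contraT => nij; have := gq i j nij; rewrite dq X1 ij.
  move=> /eqP; rewrite -[X in _ == X]addr0 (inj_eq (addrI _)) mulf_eq0 -{1}ij.
  by rewrite (negPf (proj2 (hc i))) (negPf (proj2 (hc j))).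
move=> v vT; rewrite -/(X v).
case: (boolP [exists i, v == q i]) => [/existsP[i /eqP ->]|]; first by rewrite X1 qS.
rewrite negb_exists => /forallP nq.
pose Y i := phi (q i) (c i) * phi v (c i).
have YE i : (e v (q i))%:Z = X v + Y i.
  rewrite -dq -(ne v (q i)) ?(negbTE (nq i)) //; by apply: eq_bigr => k _; rewrite mulrC.
have cardE : #|[set i | e v (q i)]|%:Z = X v *+ 4 + \sum_i Y i.
  rewrite -sum1_card (big_morph Posz PoszD (erefl _)) big_mkcond /=.
  rewrite (eq_bigr (fun i => X v + Y i)) => [|i _]; last by rewrite -YE inE; case: (e v (q i)).
  by rewrite big_split /= sumr_const card_ord.
have nY : X v ^+ 2 + \sum_i Y i ^+ 2 <= 2.
  have us : uniq (c0 :: map c (enum 'I_4)).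
    rewrite /= map_inj_uniq // enum_uniq andbT; apply/mapP => -[i _ h].
    by have := cne i; rewrite h eqxx.
  have := sum_sq_sub (phi v) us; rewrite big_cons big_map big_enum /=.
  rewrite [X in _ <= X](eq_bigr (fun k => phi v k * phi v k)) => [|k _]; last by rewrite expr2.
  rewrite (nrm v vT) /X exprMn s2 mul1r; congr (_ + _ <= _).
  by apply: eq_bigr => i _; rewrite /Y exprMn (norm2_sq (nrm _ (tq i)) (proj2 (hc i))) mul1r.
have le1 : \sum_i Y i <= \sum_i Y i ^+ 2 by apply: ler_sum => i _; case: (leP (Y i) 0) => ?; nia.
have le2 : - \sum_i Y i <= \sum_i Y i ^+ 2.
  by rewrite -sumrN; apply: ler_sum => i _; case: (leP (Y i) 0) => ?; nia.
rewrite inE; move: cardE nY le1 le2; case: (Xval v vT) => ->; move: #|_| (\sum_i Y i) (\sum_i Y i ^+ 2);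
  by clear => k a b; case: (leqP 3 k) => ? *; lia.
Qed.

End Anchors.

Lemma gram_form (R : realType) (V : finType) (e : rel V) (T : {set V}) (C : finType) (phi : V -> C -> int) (x : V -> R) :
  {in T &, forall u v, \sum_c phi u c * phi v c = (u == v)%:Z *+ 2 + (e u v)%:Z} -> supp_in T x ->
  qform e 2 x = \sum_c (\sum_u (phi u c)%:~R * x u) ^+ 2.
Proof.
move=> gram sx; have E c : (\sum_u (phi u c)%:~R * x u) ^+ 2 =
    \sum_u \sum_v (phi u c * phi v c)%:~R * (x u * x v).
  rewrite expr2 mulr_suml; apply: eq_bigr => u _; rewrite mulr_sumr; apply: eq_bigr => v _.
  by rewrite intrM mulrACA.
rewrite (eq_bigr _ (fun c _ => E c)) exchange_big /= /qform mulr_sumr -big_split /=; apply: eq_bigr => u _.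
rewrite exchange_big /= [RHS](eq_bigr (fun v => (u == v)%:R * (2 * x u * x v) + (e u v)%:R * x u * x v)).
  rewrite big_split /= [X in _ = X + _](bigD1 u) //= eqxx mul1r [X in _ = _ + X + _]big1 ?addr0 => [|v /negPf uv].
    by congr (_ + _); ring.
  by rewrite eq_sym uv mul0r.
move=> v _; rewrite -mulr_suml -rmorph_sum /=.
case: (boolP (u \in T)) => uT; last by rewrite (sx u uT); ring.
case: (boolP (v \in T)) => vT; last by rewrite (sx v vT); ring.
by rewrite gram // intrD; case: (u == v); case: (e u v); ring.
Qed.

Lemma zrep_psd (R : realType) (V : finType) (e : rel V) : zrep e -> psd e (2 : R).
Proof.
move=> [C [phi h]] x; rewrite (@gram_form _ _ _ setT _ phi) // => [|v]; last by rewrite inE.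
by apply: sumr_ge0 => c _; exact: sqr_ge0.
Qed.

Definition index_cut (E : seq (nat * nat)) (n : nat) (m : bitseq) : bool :=
  has (fun i => has (fun j => [&& nth false m i, ~~ nth false m j & adj E i j]) (iota 0 n)) (iota 0 n).

Lemma forbidden_table : all (fun F => (F.1.1 <= 6)%N && all (fun m => [|| ~~ has id m, all id m | index_cut F.1.2 F.1.1 m])
  (bitseqs F.1.1)) forbidden.
Proof. by vm_compute. Qed.

Lemma forbidden_connected F (A : pred 'I_F.1.1) i0 j0 : F \in forbidden -> A i0 -> ~~ A j0 ->
  exists i j, [/\ A i, ~~ A j & adj F.1.2 i j].
Proof.
move=> hF Ai Aj; have /andP[_ /allP h] := allP forbidden_table F hF.
pose m := [seq A i | i <- enum 'I_F.1.1].
have sm : size m = F.1.1 by rewrite size_map size_enum_ord.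
have := mem_bitseqs m; rewrite sm => /h.
have nthm (i : 'I_F.1.1) : nth false m i = A i.
  by rewrite (nth_map i) ?size_enum_ord // nth_ord_enum.
case/or3P => [|/allP am|].
- by move/hasP => []; exists true => //; apply/mapP; exists i0; rewrite ?mem_enum.
- have : A j0 \in m by apply/mapP; exists j0; rewrite ?mem_enum.
  by move/am; rewrite /= (negPf Aj).
rewrite /index_cut; case: {+}m nthm => [|b m'] nthm.
  by rewrite /= => /hasP[i _ /hasP[j _]]; rewrite nth_nil.
move=> /= /hasP[i]; rewrite mem_iota => /= i1 /hasP[j]; rewrite mem_iota => /= j1 /and3P[a b' c].
by exists (Ordinal i1), (Ordinal j1); rewrite -!nthm.
Qed.

Section Lift.
Variables (V : finType) (e : rel V) (T S : {set V}).
Let U : finType := {x | x \in T}.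

Definition emb (X : finType) (v : X) : option (option (option (option X))) := Some (Some (Some (Some v))).

Definition lift4 (w : option (option (option (option U)))) : option (option (option (option V))) :=
  omap (omap (omap (omap val))) w.

Lemma pend4_lift a b : pend4 e S (lift4 a) (lift4 b) = pend4 (@restr _ e T) [set u | val u \in S :&: T] a b.
Proof.
by case: a => [[[[u|]|]|]|]; case: b => [[[[v|]|]|]|];
   rewrite /pend4 /= ?inE ?(valP u) ?(valP v) ?andbT.
Qed.

End Lift.

(** * Grafting along an anchor *)

Section LargeZrep.
Variables (R : realType) (y : R).
Hypotheses (y1 : 1 < y) (yl : y + y^-1 < 20 / 9) (y6 : y ^+ 6 = y ^+ 2 + 1).
Local Notation ls := (y + y^-1).

Let y0 : 0 < y. Proof. by apply: lt_trans y1. Qed.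

Lemma ls_gt2 : 2 < ls.
Proof.
have [g0 g1 gy] := inv_bounds y1.
have : 0 < (1 - y^-1) * (y - 1) by apply: mulr_gt0; have := y1; lra.
rewrite mulrBr !mulrBl gy; lra.
Qed.

Section Anchored.
Variables (V : finType) (e : rel V).
Hypotheses (es : symmetric e) (ei : irreflexive e).
Variables (X S : {set V}).
Hypothesis anch : anchor e X S.

(** The sum over [S] is, up to sign, one coordinate of the represented vector, so its square is at
    most the form at level 2. Strictness comes from [ls > 2], and [y^-1 < 1] absorbs the tail. *)
Lemma anchored_stailed (T : {set V}) : X \subset T -> zrep_on e T -> stailed e ls y^-1 T (S :&: T).
Proof.
move=> XT [C [phi gram]] x sx nz; case: anch => _ _ _ /(_ T XT C phi gram)[c [s [s2 hc]]].
have [g0 g1 gy] := inv_bounds y1; have l2 := ls_gt2.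
have gf := gram_form gram sx.
have : \sum_(v in S :&: T) x v = s%:~R * \sum_u (phi u c)%:~R * x u.
  rewrite mulr_sumr big_mkcond; apply: eq_bigr => u _; rewrite inE mulrA -intrM.
  case: (boolP (u \in T)) => uT; last by rewrite andbF (sx u uT) mulr0.
  by rewrite hc // andbT; case: (u \in S); rewrite ?mul1r ?mul0r.
move=> ->; rewrite exprMn -rmorphXn s2 /= mul1r.
have : (\sum_u (phi u c)%:~R * x u) ^+ 2 <= qform e 2 x.
  by rewrite gf (bigD1 c) //= lerDl; apply: sumr_ge0 => d _; exact: sqr_ge0.
have -> : qform e ls x = qform e 2 x + (ls - 2) * (\sum_v x v ^+ 2) by rewrite /qform; ring.
have := sqr_ge0 (\sum_u (phi u c)%:~R * x u); set Q := _ ^+ 2 => Q0 QF.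
have N0 : 0 < (ls - 2) * \sum_v x v ^+ 2 by apply: mulr_gt0; [lra | exact: sum_sq_gt0].
have : 0 <= (1 - y^-1) * Q by apply: mulr_ge0; lra.
lra.
Qed.

(** A forbidden copy inside the graph is excluded by [tail_attached_no_copy]. For a copy using the
    grafted path, let [P] be its vertices in the graph. The copy is connected, so [P] can leave
    toward the path only through [S], which is in or next to [X]; hence [X :|: P] is connected.
    Being small, it is represented, and the anchor then attaches the infinite path to it along [S]
    itself, which forbids the copy. *)
Lemma anchored_zrep k : (#|X| + 6 <= k)%N -> connected_graph e ->
  (forall T : {set V}, T != set0 -> (#|T| <= k)%N -> tail_attached y e T) -> zrep e.
Proof.
move=> Xk conn hT; case: (anch) => XS0 Xconn SX _.
have S0 : S != set0 by case/set0Pn: XS0 => s; rewrite inE => /andP[_ sS]; apply/set0Pn; exists s.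
apply: (pend4_zrep es ei S0 conn) => F hF [f fi fE].
have n6 : (F.1.1 <= 6)%N by case/andP: (allP forbidden_table F hF).
case: (pselect (forall i, exists v, f i = emb v)) => [/choice[g hg]|].
  case: F hF f fi fE n6 g hg => [[n E] c] hF f fi fE n6 g hg.
  apply: (tail_attached_no_copy y0 y6 hF (e := e)).
    by move=> T T0 T6; apply: hT => //; lia.
  exists g; first by move=> i j h; apply: fi; rewrite !hg h.
  by move=> i j; rewrite -fE !hg.
move=> /existsNP[i0 /forallNP hi0].
pose P := [set v | [exists i, f i == emb v]].
have cP : (#|P| <= 6)%N.
  apply: leq_trans n6; rewrite -[X in (_ <= X)%N]card_ord -cardsT.
  have : P \subset pmap (fun i => if f i is Some (Some (Some (Some v))) then Some v else None) (enum 'I_F.1.1).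
    by apply/subsetP => v; rewrite inE => /existsP[i /eqP h]; rewrite mem_pmap; apply/mapP; exists i; rewrite ?mem_enum ?h.
  by move/subset_leq_card => h; apply: leq_trans h _; apply: leq_trans (card_size _) _;
    rewrite size_pmap (leq_trans (count_size _ _)) // cardsT -cardT.
pose T := X :|: P.
have T0 : T != set0 by apply: contra XS0 => /eqP h; rewrite -subset0 -h subIset // subsetUl.
have Tk : (#|T| <= k)%N.
  by apply: leq_trans (leq_card_setU _ _) _; apply: leq_trans Xk; rewrite leq_add2l.
have disj (A : {set V}) : A \subset T -> A != set0 -> [disjoint X & A] ->
    exists2 p, p \in T :\: A & exists2 q, q \in A & e p q.
  move=> AT A0 dis; have AP a : a \in A -> a \notin X /\ a \in P.
    move=> aA; have aX : a \notin X by apply/negP => aX; have := pred0P dis a; rewrite /= aX aA.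
    by split=> //; have := subsetP AT a aA; rewrite inE (negPf aX).
  have [a aA] := set0Pn _ A0; have [_] := AP a aA; rewrite inE => /existsP[ia /eqP Ea].
  pose B i := if f i is Some (Some (Some (Some v))) then v \in A else false.
  have Bi0 : ~~ B i0.
    rewrite /B; have := hi0; case: (f i0) => [[[[v|]|]|]|] // h; by have := h v.
  have Ba : B ia by rewrite /B Ea.
  have [i [j [Bi Bj]]] := forbidden_connected hF Ba Bi0; rewrite -fE.
  move: Bi Bj (Bi); rewrite /B; case Ei : (f i) => [[[[u|]|]|]|] //; case Ej : (f j) => [[[[v|]|]|]|] //.
  - move=> uA vA _ uv; exists v; last by exists u => //; rewrite es.
    by rewrite !inE vA; apply/orP; right; apply/existsP; exists j; rewrite Ej.
  - move=> uA _ _; rewrite /pend4 /= => uS; have [uX _] := AP u uA.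
    have [|[x xX ux]] := SX u uS; first by rewrite (negPf uX).
    exists x; last by exists u; rewrite // es.
    rewrite !inE xX /= andbT; apply/negP => xA; by have [] := AP x xA; rewrite xX.
  - by move=> uA _ _; rewrite /pend4 /= inE.
  - by move=> uA _ _; rewrite /pend4 /= inE.
  - by move=> uA _ _; rewrite /pend4 /= inE.
have conT : connected_in e T.
  move=> A AT A0 AnT; case: (boolP [disjoint X & A]) => [/disj|XA]; first exact.
  case: (boolP (X \subset A)) => XsA.
    have [|||p pT [q qT epq]] := disj (T :\: A).
    - exact: subsetDl.
    - by rewrite -subset0 subDset setU0; apply: contra AnT => h; rewrite eqEsubset AT.
    - by rewrite disjoints_subset; apply: subset_trans XsA _; rewrite setCD subsetUr.
    exists q; first by [].
    exists p; last by rewrite es.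
    by move: pT; rewrite !inE; case: (p \in A) => //=; case: (_ || _).
  have [|||p] := Xconn (X :&: A); rewrite ?subsetIl //.
  - by rewrite setI_eq0.
  - by apply: contra XsA => /eqP/setIidPl.
  rewrite !inE => /andP[pA pX] [q]; rewrite inE => /andP[_ qA] pq; exists p; last by exists q.
  by move: pA; rewrite !inE pX andbT /= => ->.
have [S' [S'0 S'T hS']] := hT T T0 Tk.
have zT := stailed_zrep_on y0 y6 es ei S'0 S'T conT hS'.
have hst := anchored_stailed (subsetUl X P) zT.
have ST0 : S :&: T != set0.
  case/set0Pn: XS0 => s; rewrite inE => /andP[sX sS]; apply/set0Pn; exists s; by rewrite !inE sS sX.
apply: (restr_forbidden_free y0 y6 es ei ST0 (subsetIr _ _) conT hst hF).
have /choice[f' hf'] : forall i, exists w, lift4 (T := T) w = f i.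
  move=> i; case E : (f i) => [[[[v|]|]|]|].
  - have vT : v \in T by rewrite !inE; apply/orP; right; apply/existsP; exists i; rewrite E.
    by exists (emb (Sub v vT)).
  - by exists (Some (Some (Some None))).
  - by exists (Some (Some None)).
  - by exists (Some None).
  - by exists None.
exists f'; first by move=> i j h; apply: fi; rewrite -!hf' h.
by move=> i j; rewrite -fE -!hf' pend4_lift.
Qed.

End Anchored.

Lemma large_zrep t : t < ls -> exists N, forall (V : finType) (e : rel V),
  symmetric e -> irreflexive e -> connected_graph e -> psd e t -> (N <= #|V|)%N -> zrep e.
Proof.
move=> tl; have l2 := ls_gt2.
have t'l : Num.max t 2 < ls by rewrite gt_max tl.
have [N hN] := large_tail_attached y1 yl 10 t'l.
pose d := (2 ^ (5 + 4))%N.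
exists (N + d ^ 3).+1 => V e es ei conn ps big.
have ps' : psd e (Num.max t 2) by apply: psd_le ps; rewrite le_max lexx.
have hT := hN V e es ei conn ps' (leq_trans (leq_addr _ _) (ltnW big)).
have [v0 _] : exists v0, v0 \in [set: V].
  by apply/set0Pn; rewrite -card_gt0 cardsT; apply: leq_ltn_trans big.
pose T0 : {set V} := [set v0]; have T00 : T0 != set0 by apply/set0Pn; exists v0; rewrite inE.
have finish (X S : {set V}) : (#|X| <= 4)%N -> anchor e X S -> zrep e.
  by move=> X4 an; apply: (anchored_zrep es ei an (k := 10)) => //; lia.
(* A vertex at distance 3 gives an induced path on four vertices. Otherwise the graph has a vertex
   of large degree, and Ramsey's theorem gives a clique of four. *)
case: (pselect (exists v, 3 <= dist e T0 v)%N) => [[v hv]|nex].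
  have par u i : dist e T0 u = i.+1 -> exists2 w, e u w & dist e T0 w = i.
    move=> E; have [|w uw hw] := @dist_parent _ _ es conn T0 T00 u; first by rewrite E.
    by exists w; [rewrite es | move: hw; rewrite E => -[->]].
  have desc : forall i, exists u, dist e T0 u = (dist e T0 v - i)%N.
    elim=> [|n [u hu]]; first by exists v; rewrite subn0.
    case E : (dist e T0 u) => [|j]; first by exists u; rewrite subnS -hu E.
    by have [w _ hw] := par u j E; exists w; rewrite subnS -hu E.
  have [w3 h3] : exists w, dist e T0 w = 3 by have [w hw] := desc (dist e T0 v - 3)%N; exists w; rewrite hw subKn.
  have [w2 e32 h2] := par _ _ h3; have [w1 e21 h1] := par _ _ h2; have [w0 e10 h0] := par _ _ h1.
  have far a b : ((dist e T0 b).+1 < dist e T0 a)%N -> e a b = false.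
    by move=> ab; apply/negbTE/negP => /(dist_edge es conn T00); rewrite leqNgt ab.
  have an := path_anchor es ei e32 e21 e10 (far _ _ _) (far _ _ _) (far _ _ _).
  apply: (finish _ _ _ (an _ _ _)); rewrite ?h3 ?h2 ?h1 ?h0 //.
  do 2!(apply: leq_trans (leq_card_setU _ _) _; rewrite cards1 addn1 ltnS).
  by rewrite cards2; case: (_ != _).
have near v : (dist e T0 v < 3)%N by rewrite ltnNge; apply/negP => h; apply: nex; exists v.
have [c hc] : exists c : V, (d <= #|[set w | e c w]|)%N.
  apply: contrapT => nexc; have d0 : (0 < d)%N by rewrite expn_gt0.
  have deg v : (#|[set w | e v w]| <= d.-1)%N.
    by rewrite -ltnS prednK // ltnNge; apply/negP => h; apply: nexc; exists v.
  have := card_ball_le T0 3 deg; rewrite prednK // cards1 mul1n.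
  have -> : ball e T0 3 = setT.
    by apply/setP => v; rewrite in_setT (mem_ball es conn T00); apply: ltnW; exact: near.
  by rewrite cardsT leqNgt (leq_trans _ big) // ltnS leq_addl.
have [|Q [cQ hQ]] := clique_exists (m := 4) y1 yl es ei t'l ps' (_ : forall v, v \in [set w | e c w] -> e c v) hc.
  by move=> v; rewrite inE.
pose q (i : 'I_4) := enum_val (cast_ord (esym cQ) i).
have qi : injective q by move=> i j /enum_val_inj /cast_ord_inj.
apply: (finish _ _ _ (clique_anchor ei qi _)).
  by rewrite card_imset // cardsT card_ord.
by move=> i j ij; rewrite hQ ?enum_valP // (inj_eq qi).
Qed.

End LargeZrep.

(** * Well-quasi-orders *)

Section Wqo.
Variables (A : Type) (le : A -> A -> Prop).

Definition wqo : Prop := forall f : nat -> A, exists i j, (i < j)%N /\ le (f i) (f j).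

Lemma increasing_lt (g : nat -> nat) : (forall i, g i < g i.+1)%N -> forall i j, (i < j)%N -> (g i < g j)%N.
Proof.
move=> h i; elim=> [//|j IH]; rewrite ltnS leq_eqVlt => /orP[/eqP ->|/IH ij]; first exact: h.
exact: ltn_trans (h j).
Qed.

Hypothesis le_trans : forall a b c, le a b -> le b c -> le a c.

Lemma monotone_subsequence : wqo -> forall f : nat -> A, exists g : nat -> nat,
  forall i j, (i < j)%N -> (g i < g j)%N /\ le (f (g i)) (f (g j)).
Proof.
move=> w f; pose terminal i := forall j, (i < j)%N -> ~ le (f i) (f j).
have [N hN] : exists N, forall i, (N <= i)%N -> ~ terminal i.
  apply: contrapT => /forallNP nex.
  have /choice[h hh] : forall N, exists i, (N <= i)%N /\ terminal i.
    by move=> N; have /existsNP[i /not_implyP[Ni /contrapT ti]] := nex N; exists i.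
  pose g := fix g n := if n is n'.+1 then h (g n').+1 else h 0%N.
  have gi : forall i, (g i < g i.+1)%N by move=> i; case: (hh (g i).+1).
  have gt i : terminal (g i) by case: i => [|i]; [case: (hh 0%N) | case: (hh (g i).+1)].
  have [i [j [ij le_ij]]] := w (f \o g).
  exact: (gt i (g j) (increasing_lt gi ij)).
have /choice[h hh] : forall i, exists j, (N <= i)%N -> (i < j)%N /\ le (f i) (f j).
  move=> i; case: (leqP N i) => [Ni|_]; last by exists 0%N.
  by have /existsNP[j /not_implyP[ij /contrapT l]] := hN i Ni; exists j.
pose g n := iter n h N.
have gN i : (N <= g i)%N by elim: i => //= i IH; have [h1 _] := hh _ IH; exact: leq_trans IH (ltnW h1).
have gi i : (g i < g i.+1)%N /\ le (f (g i)) (f (g i.+1)) by apply: hh.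
exists g => i j ij; split; first by apply: increasing_lt ij => k; case: (gi k).
elim: j ij => [//|j IH]; rewrite ltnS leq_eqVlt => /orP[/eqP ->|/IH ij]; first by case: (gi j).
by apply: le_trans ij _; case: (gi j).
Qed.

Inductive subemb : seq A -> seq A -> Prop :=
| subemb_nil s : subemb [::] s
| subemb_skip s y t : subemb s t -> subemb s (y :: t)
| subemb_cons x s y t : le x y -> subemb s t -> subemb (x :: s) (y :: t).

Lemma subemb_trans s t u : subemb s t -> subemb t u -> subemb s u.
Proof.
move=> st tu; elim: tu s st => {t u} [t s st|t y u _ IH s st|x t y u xy tu IH s st].
- by inversion st; apply: subemb_nil.
- by apply: subemb_skip; exact: IH.
- inversion st; subst; first exact: subemb_nil.
  + by apply: subemb_skip; exact: IH.
  + by apply: subemb_cons; [exact: le_trans xy | exact: IH].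
Qed.

(* Nash-Williams: take a bad sequence that is lexicographically minimal in the lengths. *)
Lemma higman : wqo -> forall f : nat -> seq A, exists i j, (i < j)%N /\ subemb (f i) (f j).
Proof.
move=> w f0; apply: contrapT => bad0.
pose bad (f : nat -> seq A) := forall i j, (i < j)%N -> ~ subemb (f i) (f j).
have {}bad0 : bad f0 by move=> i j ij h; apply: bad0; exists i, j.
have /choice[step hstep] : forall fn : (nat -> seq A) * nat, exists f', bad fn.1 ->
    [/\ bad f', forall i, (i < fn.2)%N -> f' i = fn.1 i & forall g, bad g ->
      (forall i, (i < fn.2)%N -> g i = fn.1 i) -> (size (f' fn.2) <= size (g fn.2))%N].
  move=> [f n] /=; case: (pselect (bad f)) => [bf|nb]; last by exists f.
  have ex : exists k, `[< exists g, [/\ bad g, forall i, (i < n)%N -> g i = f i & size (g n) = k] >].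
    by exists (size (f n)); apply/asboolP; exists f.
  case: (ex_minnP ex) => k /asboolP[g [bg gf gk]] mk; exists g => _; split=> // g' bg' gf'.
  by rewrite gk; apply: mk; apply/asboolP; exists g'.
pose F := fix F n := if n is n'.+1 then step (F n', n') else f0.
have bF n : bad (F n) by elim: n => //= n IH; case: (hstep (F n, n) IH).
have FS n : [/\ forall i, (i < n)%N -> F n.+1 i = F n i & forall g, bad g ->
      (forall i, (i < n)%N -> g i = F n i) -> (size (F n.+1 n) <= size (g n))%N].
  by case: (hstep (F n, n) (bF n)).
pose m n := F n.+1 n.
have Fm k n : (n < k)%N -> F k n = m n.
  elim: k => // k IH; rewrite ltnS leq_eqVlt => /orP[/eqP ->|nk]; first by [].
  by have [h _] := FS k; rewrite h // IH.
have bm : bad m by move=> i j ij; rewrite -(@Fm j.+1 i) -?(@Fm j.+1 j) //; [exact: bF | exact: ltnW].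
have mm n g : bad g -> (forall i, (i < n)%N -> g i = m i) -> (size (m n) <= size (g n))%N.
  by move=> bg gm; case: (FS n) => _; apply=> // i il; rewrite gm // Fm.
have /choice[at_ hat] : forall n, exists at_, m n = at_.1 :: at_.2.
  by move=> n; case E : (m n) => [|a t]; [case: (bm n n.+1 (ltnSn n)); rewrite E; constructor | exists (a, t)].
have [g hg] := monotone_subsequence w (fun n => (at_ n).1).
pose h k := if (k < g 0%N)%N then m k else (at_ (g (k - g 0)%N)).2.
have bh : bad h.
  move=> i j ij; rewrite /h; case: (ltnP i (g 0%N)) => ig; case: (ltnP j (g 0%N)) => jg.
  - exact: bm.
  - move=> s; apply: (bm i (g (j - g 0%N)%N)).
      apply: leq_trans ig _; case: (posnP (j - g 0%N)) => [-> //|j0].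
      by apply: ltnW; case: (hg _ _ j0).
    by rewrite (hat (g _)); constructor.
  - by have := leq_trans ij (leq_trans (ltnW jg) ig); rewrite ltnn.
  - move=> s; have [gij le_ij] := hg (i - g 0)%N (j - g 0)%N (ltn_sub2r (leq_ltn_trans ig ij) ij).
    by apply: (bm _ _ gij); rewrite (hat (g (i - g 0)%N)) (hat (g (j - g 0)%N)); constructor.
have := mm (g 0%N) h bh; rewrite {2}/h ltnn subnn (hat (g 0%N)) /= ltnn => E.
by apply: (negP _ (E _)) => // i il; rewrite /h il.
Qed.

End Wqo.

Lemma wqo_finType (L : finType) : wqo (fun a b : L => a = b).
Proof.
move=> f; apply: contrapT => nex.
have inj : injective (fun i : 'I_#|L|.+1 => f i).
  move=> i j E; apply/val_inj; case: (ltngtP i j) => // ij; exfalso; apply: nex.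
    by exists i, j.
  by exists j, i.
by have := leq_card _ inj; rewrite card_ord ltnn.
Qed.

Section Codes.
Variable L : finType.

(** Ordered labelled trees of depth at most [d], as nested sequences, so that each level costs one
    application of [higman]. *)
Fixpoint tcode (d : nat) : Type := if d is d'.+1 then (L * seq (tcode d'))%type else L.

Fixpoint tcode_le (d : nat) : tcode d -> tcode d -> Prop :=
  if d is d'.+1 then fun a b => a.1 = b.1 /\ subemb (@tcode_le d') a.2 b.2 else fun a b => a = b.

Lemma tcode_le_trans d (a b c : tcode d) : tcode_le a b -> tcode_le b c -> tcode_le a c.
Proof.
elim: d a b c => [a b c -> //|d IH a b c [E ab] [E' bc]]; split; first by rewrite E.
by apply: subemb_trans ab bc; exact: IH.
Qed.

Lemma wqo_tcode d : wqo (@tcode_le d).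
Proof.
elim: d => [|d IH]; first exact: wqo_finType.
move=> f; have tr (a b c : L) : a = b -> b = c -> a = c by move=> ->.
have [g hg] := monotone_subsequence tr (@wqo_finType L) (fun n => (f n).1).
have [i [j [ij le_ij]]] := higman (@tcode_le_trans d) IH (fun n => (f (g n)).2).
by exists (g i), (g j); have [gij E] := hg i j ij.
Qed.

End Codes.

(** * The signed root graph of a representation and its codes *)

Section RootGraph.
Variables (V C : finType) (phi : V -> C -> int).

Definition signb (b : bool) : int := if b then 1 else -1.

(** Coordinates are the vertices of the root graph and the vectors its signed edges; this function
    tells which of the four sign patterns occur on a pair of coordinates. *)
Definition link (c d : C) : {ffun bool * bool -> bool} :=
  [ffun ab => [exists v, (phi v c == signb ab.1) && (phi v d == signb ab.2)]].

Lemma linkP c d a b : reflect (exists v, phi v c = signb a /\ phi v d = signb b) (link c d (a, b)).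
Proof.
rewrite ffunE; apply: (iffP existsP) => -[v].
  by move=> /andP[/eqP ? /eqP ?]; exists v.
by case=> h1 h2; exists v; rewrite /= h1 h2 !eqxx.
Qed.

Lemma link_sym c d a b : link c d (a, b) = link d c (b, a).
Proof. by apply/linkP/linkP => -[v [? ?]]; exists v. Qed.

Definition adjc (c d : C) : bool := (c != d) && [exists v, (phi v c != 0) && (phi v d != 0)].

Lemma adjc_sym c d : adjc c d = adjc d c.
Proof. by rewrite /adjc eq_sym; congr (_ && _); apply: eq_existsb => v; rewrite andbC. Qed.

Lemma link_adjc c d ab : c != d -> link c d ab -> adjc c d.
Proof.
case: ab => a b cd /linkP[v [h1 h2]]; rewrite /adjc cd; apply/existsP; exists v.
by rewrite h1 h2; case: a {h1}; case: b {h2}.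
Qed.

Definition unlinked (D1 D2 : {set C}) := {in D1 & D2, forall c d, ~~ adjc c d}.

Inductive forest (X : Type) (P : {set C} -> X -> Prop) : {set C} -> seq X -> Prop :=
| forest_nil : forest P set0 [::]
| forest_cons D1 D2 a s : P D1 a -> forest P D2 s -> [disjoint D1 & D2] -> unlinked D1 D2 ->
    forest P (D1 :|: D2) (a :: s).

Lemma forest_nilE X P D : @forest X P D [::] -> D = set0.
Proof. by move=> h; inversion h. Qed.

Lemma forest_consE X P D a s : @forest X P D (a :: s) -> exists D1 D2,
  [/\ D = D1 :|: D2, P D1 a, forest P D2 s, [disjoint D1 & D2] & unlinked D1 D2].
Proof. by move=> h; inversion h as [|D1 D2 ? ? ? ? ? ? E1 E2]; exists D1, D2. Qed.

Variable K : nat.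
Definition label : finType := {ffun 'I_K -> {ffun bool * bool -> bool}}.
Definition lab (anc : seq C) (c : C) : label := [ffun i : 'I_K => link c (nth c anc i)].

(* [anc] lists the coordinates on the branch from the current node up to the root of a
   depth-first tree of the root graph; only comparable coordinates can be linked. *)
Fixpoint realizes (d : nat) (anc : seq C) (D : {set C}) : tcode label d -> Prop :=
  if d is d'.+1 then fun t => exists2 c, c \in D & t.1 = lab anc c /\ forest (@realizes d' (c :: anc)) (D :\ c) t.2
  else fun t => exists2 c, D = [set c] & t = lab anc c.

Definition radj (A : {set C}) : rel C := [rel x y | [&& x \in A, y \in A & adjc x y]].

Lemma radj_connect_sym A : connect_sym (radj A).
Proof.
by apply: sym_connect_sym => x y; rewrite /radj /= adjc_sym; case: (x \in A); case: (y \in A).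
Qed.

(** After deletion of [r], each component of the rest contains a neighbor of [r], which becomes its
    root; paths from it are shorter by one, since [r] can be put in front. Different components are
    unlinked, so every link is recorded in the label of a node relative to its ancestors. *)
Lemma realizes_exists d anc (D : {set C}) r : r \in D -> (forall z, z \in D -> connect (radj D) r z) ->
  (forall p, path (radj D) r p -> uniq (r :: p) -> (size p <= d)%N) ->
  exists t : tcode label d, realizes anc D t.
Proof.
elim: d anc D r => [|d IH] anc D r rD cD pD.
  exists (lab anc r); exists r => //; apply/setP => z; rewrite inE; apply/idP/eqP => [|-> //].
  move=> /cD /connectP[p pp ->]; case/shortenP: pp => p' pp' up' _.
  by have := pD p' pp' up'; case: p' {pp' up'}.
pose A := D :\ r.
have clos E x z : (forall x y, x \in E -> y \in A -> radj A x y -> y \in E) -> x \in E ->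
    connect (radj A) x z -> z \in E.
  move=> cl xE /connectP[p]; elim: p x xE => [|y p IHp] x xE /=; first by move=> _ ->.
  by move=> /andP[xy yp] zE; apply: (IHp y) => //; apply: (cl x y) => //; case/and3P: xy.
have forestE : forall n (E : {set C}), (#|E| < n)%N -> E \subset A ->
    (forall x y, x \in E -> y \in A -> radj A x y -> y \in E) ->
    exists s, forest (@realizes d (r :: anc)) E s.
  elim=> // n IHn E; rewrite ltnS => En EA cl.
  case: (set_0Vmem E) => [->|[e eE]]; first by exists [::]; constructor.
  pose Kc := [set z | connect (radj A) e z].
  have eK : e \in Kc by rewrite inE connect0.
  have KE : Kc \subset E by apply/subsetP => z; rewrite inE; exact: clos.
  have Kcl x y : x \in Kc -> radj A x y -> y \in Kc.
    by rewrite !inE => h /connect1; exact: connect_trans h.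
  have eA := subsetP EA e eE; have [er eD] : e != r /\ e \in D by move: eA; rewrite !inE => /andP.
  have [x xK rx] : exists2 x, x \in Kc & adjc r x.
    have /connectP[p pp pe] := cD e eD; case/shortenP: pp pe => -[|x p'] /=.
      by move=> _ _ _ h; rewrite h eqxx in er.
    move=> /andP[rx pp'] /andP[rp _] _ pe; exists x; last by case/and3P: rx.
    rewrite inE radj_connect_sym; apply/connectP; exists p' => //.
    have xr : x \in A by rewrite !inE; case/and3P: rx => _ -> _; rewrite andbT; apply: contra rp => /eqP ->; rewrite inE eqxx.
    have {rp} : r \notin p' by apply: contra rp; rewrite inE orbC => ->.
    elim: p' x xr pp' {rx pe} => //= z p' IHp x xr /andP[xz zp]; rewrite inE negb_or => /andP[rz rp].
    have zA : z \in A by rewrite !inE eq_sym rz; case/and3P: xz.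
    by apply/andP; split; [rewrite /radj /= xr zA; case/and3P: xz | exact: IHp].
  have pK y p : y \in Kc -> path (radj A) y p -> path (radj Kc) y p.
    elim: p y => //= z p IHp y yK /andP[yz zp]; have zK := Kcl y z yK yz.
    by rewrite /radj /= yK zK IHp // andbT; case/and3P: yz.
  have [|p pp up|t ht] := IH (r :: anc) Kc x xK.
  - move=> z zK; have : connect (radj A) x z.
      by move: xK zK; rewrite !inE radj_connect_sym; exact: connect_trans.
    by case/connectP => p pp ->; apply/connectP; exists p => //; exact: pK.
  - have sub z w : radj Kc z w -> radj D z w /\ w != r.
      move=> /and3P[zK wK zw]; have := subsetP EA _ (subsetP KE z zK); have := subsetP EA _ (subsetP KE w wK).
      by rewrite !inE => /andP[wr wD] /andP[zr zD]; rewrite /radj /= zD wD.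
    have xA := subsetP EA _ (subsetP KE x xK).
    have := pD (x :: p); rewrite /= ltnS; apply.
      move: xA; rewrite !inE => /andP[xr xD]; have -> /= : radj D r x by rewrite /radj /= rD xD.
      by apply: sub_path pp => z w /sub[].
    rewrite -[(x \notin p) && _]/(uniq (x :: p)) up andbT inE negb_or.
    apply/andP; split; first by move: xA; rewrite !inE eq_sym => /andP[].
    elim: p x {xK rx xA up} pp => //= z p IHp x /andP[/sub[_ zr] zp]; rewrite inE negb_or eq_sym zr /=; exact: IHp zp.
  have [|||s hs] := IHn (E :\: Kc).
  - apply: leq_trans En; apply: proper_card; apply/properP; split; first exact: subsetDl.
    by exists e; rewrite // inE eK.
  - by apply: subset_trans (subsetDl _ _) EA.
  - move=> u v uEK vA uv; move: uEK; rewrite !inE => /andP[uK uE]; apply/andP; split; last exact: (cl u v).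
    apply: contra uK => vK; apply: connect_trans vK _; rewrite radj_connect_sym; exact: connect1.
  exists (t :: s); have -> : E = Kc :|: (E :\: Kc) by apply/setP => z; have := subsetP KE z; rewrite !inE; case: (connect _ e z) => [->|].
  constructor=> //.
    by rewrite disjoint_sym disjoints_subset; apply/subsetP => z; rewrite !inE => /andP[].
  move=> c z cK; rewrite inE => /andP[zK zE]; apply: contra zK => cz; apply: (Kcl c) => //.
  by rewrite /radj /= cz (subsetP EA z zE) (subsetP EA _ (subsetP KE c cK)).
have [||s hs] := forestE #|A|.+1 A (ltnSn _); first exact: subxx; first by [].
by exists (lab anc r, s); exists r.
Qed.

End RootGraph.

Section Embeddings.
Variables (V C : finType) (phi : V -> C -> int) (V' C' : finType) (phi' : V' -> C' -> int).
Variable K : nat.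

(** Links inside [D] need only be preserved, not reflected: the target may have additional vectors
    on a pair of coordinates, and adjacency between the chosen vectors is decided by their inner
    products. *)
Definition embeds (anc : seq C) (anc' : seq C') (D : {set C}) (D' : {set C'}) (f : C -> C') : Prop :=
  [/\ {in D &, injective f}, {in D, forall c, f c \in D'},
      {in D, forall c i, (i < size anc)%N -> link phi c (nth c anc i) = link phi' (f c) (nth (f c) anc' i)} &
      {in D &, forall c d, c != d -> forall ab, link phi c d ab -> link phi' (f c) (f d) ab}].

Lemma forest_embeds X (le : X -> X -> Prop) P P' anc anc' (c0 : C') (s s' : seq X) D D' :
  (forall D D' a a', P D a -> P' D' a' -> le a a' -> exists f, embeds anc anc' D D' f) ->
  subemb le s s' -> forest phi P D s -> forest phi' P' D' s' -> exists f, embeds anc anc' D D' f.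
Proof.
move=> hP emb; elim: emb D D' => {s s'} [s|s y t _ IH|x s y t xy _ IH] D D' hD hD'.
- by rewrite (forest_nilE hD); exists (fun=> c0); split=> c; rewrite inE.
- have [D1 [D2 [-> _ h2 _ _]]] := forest_consE hD'; have [f [fi fD fl ff]] := IH _ _ hD h2.
  by exists f; split=> // c cD; rewrite inE fD ?orbT.
have [D1 [D2 [-> p1 h2 _ un]]] := forest_consE hD.
have [D3 [D4 [-> p3 h4 dis34 _]]] := forest_consE hD'.
have [f1 [i1 d1 l1 e1]] := hP _ _ _ _ p1 p3 xy; have [f2 [i2 d2 l2 e2]] := IH _ _ h2 h4.
have nD c : c \in D1 :|: D2 -> c \notin D1 -> c \in D2 by rewrite inE => /orP[->|].
have dis a b : a \in D3 -> b \in D4 -> a <> b.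
  by move=> aD bD ab; have := pred0P dis34 a; rewrite /= aD ab bD.
exists (fun c => if c \in D1 then f1 c else f2 c); split.
- move=> a b aD bD; case: ifPn => a1; case: ifPn => b1 E.
  + exact: i1.
  + by case: (dis _ _ (d1 a a1) (d2 b (nD b bD b1))).
  + by case: (dis _ _ (d1 b b1) (d2 a (nD a aD a1))).
  + by apply: i2; rewrite ?nD.
- by move=> a aD; rewrite inE; case: ifPn => a1; rewrite ?d1 // d2 ?orbT ?nD.
- by move=> a aD i ia; case: ifPn => a1; [exact: l1 | apply: l2; rewrite ?nD].
- move=> a b aD bD ab xy'; case: ifPn => a1; case: ifPn => b1 l.
  + exact: e1.
  + by exfalso; apply: (negP (un a b a1 (nD b bD b1))); exact: link_adjc l.
  + exfalso; apply: (negP (un b a b1 (nD a aD a1))); rewrite adjc_sym; exact: link_adjc l.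
  + by apply: e2; rewrite ?nD.
Qed.

Lemma realizes_embeds d anc anc' D D' (t t' : tcode (label K) d) :
  size anc = size anc' -> (size anc + d <= K)%N -> realizes phi anc D t -> realizes phi' anc' D' t' ->
  tcode_le t t' -> exists f, embeds anc anc' D D' f.
Proof.
elim: d anc anc' D D' t t' => [|d IH] anc anc' D D' t t' sz szK.
  move=> [c -> ->] [c' -> ->] /= E; exists (fun=> c'); split.
  - by move=> x y /set1P -> /set1P ->.
  - by move=> x _; rewrite inE.
  - move=> x /set1P -> i ia; have iK : (i < K)%N by apply: leq_trans szK; rewrite addn0.
    have /ffunP/(_ (Ordinal iK)) := E; by rewrite !ffunE.
  - by move=> x y /set1P -> /set1P ->; rewrite eqxx.
move=> [c cD [E hs]] [c' cD' [E' hs']] [Et sub].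
have [a b|f [fi fD fl ff]] := @forest_embeds _ _ _ _ (c :: anc) (c' :: anc') c' _ _ _ _ _ sub hs hs'.
  by move=> u u' h h' le; apply: IH h h' le; rewrite /= ?sz // addSnnS -sz.
rewrite E E' in Et.
have lc i : (i < size anc)%N -> link phi c (nth c anc i) = link phi' c' (nth c' anc' i).
  move=> ia; have iK : (i < K)%N by apply: leq_trans szK; apply: leq_trans ia _; rewrite leq_addr.
  by have /ffunP/(_ (Ordinal iK)) := Et; rewrite !ffunE.
have inD x : x \in D -> x != c -> x \in D :\ c by rewrite !inE => -> ->.
have fc x : x \in D -> x != c -> f x != c' /\ f x \in D'.
  by move=> xD xc; have := fD x (inD x xD xc); rewrite !inE => /andP.
exists (fun x => if x == c then c' else f x); split.
- move=> x z xD zD; case: eqVneq => [->|xc]; case: eqVneq => [->|zc] // h.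
  + by case: (fc z zD zc); rewrite -h eqxx.
  + by case: (fc x xD xc); rewrite h eqxx.
  + by apply: fi => //; exact: inD.
- by move=> x xD; case: eqVneq => [_|xc] //; case: (fc x xD xc).
- move=> x xD i ia; case: eqVneq => [->|xc]; first exact: lc.
  exact: (fl x (inD x xD xc) i.+1).
have f0 x a b : x \in D -> x != c -> link phi x c (a, b) = link phi' (f x) c' (a, b).
  by move=> xD xc; rewrite (fl x (inD x xD xc) 0%N).
move=> x z xD zD xz [a b]; case: (eqVneq x c) => [Ex|xc]; case: (eqVneq z c) => [Ez|zc].
- by move: xz; rewrite Ex Ez eqxx.
- by rewrite Ex link_sym f0 // link_sym.
- by rewrite Ez f0.
- by apply: ff => //; exact: inD.
Qed.

End Embeddings.

Definition gram (V : finType) (e : rel V) (C : finType) (phi : V -> C -> int) : Prop :=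
  forall u v, \sum_c phi u c * phi v c = (u == v)%:Z *+ 2 + (e u v)%:Z.

Definition coords (V C : finType) (phi : V -> C -> int) : {set C} := [set c | [exists v, phi v c != 0]].

Lemma coordsP (V C : finType) (phi : V -> C -> int) v c : phi v c != 0 -> c \in coords phi.
Proof. by move=> h; rewrite inE; apply/existsP; exists v. Qed.

Section OneGram.
Variables (V : finType) (e : rel V) (C : finType) (phi : V -> C -> int).
Hypotheses (es : symmetric e) (ei : irreflexive e) (hg : gram e phi).

Lemma gram_norm v : \sum_c phi v c * phi v c = 2.
Proof. by rewrite hg eqxx ei. Qed.

Lemma gram_third v c d x : c != d -> phi v c != 0 -> phi v d != 0 -> x != c -> x != d -> phi v x = 0.
Proof.
rewrite (eq_sym x c) (eq_sym x d) => cd hc hd xc xd; have := norm2_le3 (gram_norm v) cd xc xd.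
rewrite (norm2_sq (gram_norm v) hc) (norm2_sq (gram_norm v) hd) => h.
apply/eqP; rewrite -sqrf_eq0; have := sqr_ge0 (phi v x); move: h; set z := _ ^+ 2; clear; lia.
Qed.

Lemma coords_connect r z : connected_graph e -> r \in coords phi -> z \in coords phi ->
  connect (radj phi (coords phi)) r z.
Proof.
move=> conn rD zD; pose K := [set z | connect (radj phi (coords phi)) r z].
have Kcl v c d : c \in K -> phi v c != 0 -> phi v d != 0 -> d \in K.
  case: (eqVneq c d) => [-> //|cd]; rewrite !inE => h hc hd; apply: connect_trans h _.
  apply: connect1; rewrite /radj /= !(coordsP (v := v)) //= /adjc cd; apply/existsP; exists v.
  by rewrite hc hd.
have rK : r \in K by rewrite inE connect0.
pose A := [set v | [exists c in K, phi v c != 0]].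
have AT : A = setT.
  apply/eqP; apply: contraT => AnT; have [|p pA [q qA epq]] := conn A _ AnT.
    move: rD; rewrite inE => /existsP[v hv]; apply/set0Pn; exists v; rewrite inE; apply/existsP; exists r.
    by rewrite rK.
  have [c hc] : exists c, phi p c * phi q c != 0.
    apply: contrapT => nex; have := hg p q; rewrite epq big1 => [|c _].
      by case: (p == q).
    by apply/eqP; apply: contraT => h; case: nex; exists c.
  move: hc; rewrite mulf_eq0 negb_or => /andP[pc qc].
  move: qA; rewrite inE => /existsP[c' /andP[cK qc']]; have cK' := Kcl q c' c cK qc' qc.
  by case/negP: pA; rewrite inE; apply/existsP; exists c; rewrite cK'.
move: zD; rewrite inE => /existsP[v vz]; have : v \in A by rewrite AT inE.
rewrite inE => /existsP[c /andP[cK vc]]; have := Kcl v c z cK vc vz; by rewrite inE.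
Qed.

(** Edges along a path of the root graph are combined with signs that cancel every inner coordinate,
    leaving the two ends. The support clause shows in the induction that the edge put in front has
    not occurred yet, so the squares of the coefficients add up to the length. *)
Lemma path_combination (A : {set C}) c p : path (radj phi A) c p -> uniq (c :: p) ->
  exists (X : V -> int) (s : int), [/\ s ^+ 2 = 1,
    forall x, \sum_v X v * phi v x = (x == c)%:Z + s * (x == last c p)%:Z,
    \sum_v X v ^+ 2 = (size p)%:Z & forall v x, X v != 0 -> phi v x != 0 -> x \in c :: p].
Proof.
elim: p c => [|y p IH] c /=.
  move=> _ _; exists (fun=> 0), (-1); split=> //.
  - by move=> x; rewrite big1 => [|v _]; [rewrite mulN1r subrr | rewrite mul0r].
  - by rewrite big1.
move=> /andP[/and3P[_ _ /andP[cy /existsP[v0 /andP[h0 hy]]]] pp] /andP[cp up].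
have [X' [s [s2 hX nX sX]]] := IH y pp up.
pose sg := - phi v0 y; pose r := sg * phi v0 c.
have n2 := norm2_sq (gram_norm v0); have r2 : r ^+ 2 = 1 by rewrite /r /sg exprMn sqrrN !n2.
have v0E x : phi v0 x = phi v0 c * (x == c)%:Z + phi v0 y * (x == y)%:Z.
  case: (eqVneq x c) => [->|xc]; first by rewrite (negPf cy) mulr1 mulr0 addr0.
  case: (eqVneq x y) => [->|xy]; first by rewrite mulr1 mulr0 add0r.
  by rewrite (gram_third cy h0 hy xc xy) !mulr0.
have X0 : X' v0 = 0.
  by apply/eqP; apply: contraT => h; have := sX v0 c h h0; rewrite (negPf cp).
exists (fun u => r * (X' u + sg * (u == v0)%:Z)), (r * s); split.
- by rewrite exprMn r2 s2.
- move=> x; rewrite (eq_bigr (fun u => r * (X' u * phi u x) + r * sg * ((u == v0)%:Z * phi u x))); last by move=> u _; ring.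
  rewrite big_split /= -!mulr_sumr hX (bigD1 v0) //= eqxx mul1r big1 ?addr0 => [|u /negPf ->]; last by rewrite mul0r.
  have : sg * phi v0 y = -1 by rewrite /sg mulNr -expr2 n2.
  rewrite (v0E x); set P := phi v0 c; set Q := phi v0 y => sQ.
  transitivity (r * s * (x == last y p)%:Z + r * (1 + sg * Q) * (x == y)%:Z + r * (sg * P) * (x == c)%:Z); first by ring.
  by rewrite sQ -/r -expr2 r2; ring.
- rewrite (eq_bigr (fun u => X' u ^+ 2 + (u == v0)%:Z)) => [|u _].
    by rewrite big_split /= nX (bigD1 v0) //= eqxx big1 ?addr0 => [|u /negPf ->] //; rewrite -addn1 PoszD.
  rewrite exprMn r2 mul1r; case: (eqVneq u v0) => [->|_]; last by rewrite mulr0 !addr0.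
  by rewrite X0 expr0n !add0r mulr1 /sg sqrrN n2.
- move=> v x; case: (eqVneq v v0) => [->|vv0].
    move=> _ h; rewrite inE; case: (eqVneq x c) => //= xc.
    case: (eqVneq x y) => [->|xy]; first by rewrite inE eqxx.
    by move: h; rewrite (gram_third cy h0 hy xc xy) eqxx.
  by rewrite mulr0 addr0 mulf_eq0 negb_or => /andP[_ h] h'; rewrite inE (sX v x h h') orbT.
Qed.

(** On the combination of [path_combination] the form at level 2 is the squared norm of a vector
    living on the two ends, at most 4, whereas its squared length is the number of edges. For
    [t < 2] this bounds all paths. *)
Lemma root_path_bound (R : realType) (t : R) (A : {set C}) c p : psd e t -> path (radj phi A) c p -> uniq (c :: p) ->
  (2 - t) * (size p)%:R <= 4.
Proof.
move=> ps pp up; have [X [s [s2 hX nX _]]] := path_combination pp up.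
pose x v : R := (X v)%:~R.
have := ps x; have -> : qform e t x = qform e 2 x - (2 - t) * \sum_v x v ^+ 2 by rewrite /qform; ring.
have -> : \sum_v x v ^+ 2 = (size p)%:R.
  rewrite -[RHS]/((size p)%:Z%:~R) -nX rmorph_sum /=; apply: eq_bigr => v _; by rewrite rmorphXn.
rewrite subr_ge0 => h; apply: le_trans h _.
rewrite (@gram_form _ _ _ setT _ phi) => [|u v _ _|v]; [|exact: hg|by rewrite inE].
rewrite (eq_bigr (fun c0 => (((c0 == c)%:Z + s * (c0 == last c p)%:Z) ^+ 2)%:~R)) => [|i _]; last first.
  by rewrite rmorphXn /= -hX rmorph_sum /=; congr (_ ^+ 2); apply: eq_bigr => v _; rewrite mulrC -intrM.
rewrite -rmorph_sum /= -[4]/(4%:Z%:~R) ler_int.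
apply: le_trans (_ : \sum_i (2 * (i == c)%:Z + 2 * (i == last c p)%:Z) <= _).
  have s1 : s = 1 \/ s = -1.
    by have /eqP := s2; rewrite sqrf_eq1 => /orP[] /eqP ->; [left|right].
  by case: s1 => ->; apply: ler_sum => i _; case: (i == c); case: (i == last c p).
rewrite big_split /= -!mulr_sumr (bigD1 c) //= eqxx big1 => [|i /negPf -> //].
by rewrite (bigD1 (last c p)) //= eqxx big1 => [|i /negPf -> //].
Qed.

End OneGram.

(** A vector of norm 2 is determined by its two coordinates and their signs, and [link] provides a
    vector with this pattern on the image coordinates. Inner products are kept, and they decide both
    equality and adjacency. *)
Lemma gram_embedding (V : finType) (e : rel V) (C : finType) (phi : V -> C -> int)
    (V' : finType) (e' : rel V') (C' : finType) (phi' : V' -> C' -> int) f :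
  irreflexive e -> irreflexive e' -> gram e phi -> gram e' phi' ->
  embeds phi phi' [::] [::] (coords phi) (coords phi') f ->
  exists2 h : V -> V', injective h & forall u v, e' (h u) (h v) = e u v.
Proof.
move=> ei ei' hg hg' [fi fD _ fl].
have sgzE v c : phi v c != 0 -> exists a, phi v c = signb a.
  by case: (norm2_val (gram_norm ei hg v) c) => -> // _; [exists true|exists false].
have /choice[h hh] : forall v, exists v', {in coords phi, forall x, phi' v' (f x) = phi v x}.
  move=> v; have [c hc] := norm2_nz (gram_norm ei hg v).
  have [d cd hd] := norm2_other (gram_norm ei hg v) hc.
  have [a Ea] := sgzE v c hc; have [b Eb] := sgzE v d hd.
  have lcd : link phi c d (a, b) by apply/linkP; exists v.
  have cD := coordsP hc; have dD := coordsP hd.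
  have /linkP[v' [Ec Ed]] := fl c d cD dD cd (a, b) lcd; exists v' => x xD.
  case: (eqVneq x c) => [->|xc]; first by rewrite Ec Ea.
  case: (eqVneq x d) => [->|xd]; first by rewrite Ed Eb.
  rewrite (gram_third ei hg cd hc hd xc xd).
  have inj_ne y z : y \in coords phi -> z \in coords phi -> y != z -> f y != f z.
    by move=> yD zD; apply: contra => /eqP /fi ->.
  by apply: (gram_third ei' hg' (inj_ne _ _ cD dD cd)); rewrite ?Ec ?Ed -?Ea -?Eb ?inj_ne.
have prod u v : \sum_c phi' (h u) c * phi' (h v) c = \sum_c phi u c * phi v c.
  have [c hc] := norm2_nz (gram_norm ei hg u); have [d cd hd] := norm2_other (gram_norm ei hg u) hc.
  have cD := coordsP hc; have dD := coordsP hd.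
  rewrite (norm2_two (gram_norm ei hg u) _ cd hc hd) (norm2_two (gram_norm ei' hg' (h u)) _ (c := f c) (d := f d)) ?hh //.
  by apply: contra cd => /eqP /fi ->.
have key u v : (h u == h v) = (u == v) /\ e' (h u) (h v) = e u v.
  have := prod u v; rewrite hg hg'.
  case: (eqVneq u v) => [->|_]; first by rewrite eqxx ei ei'.
  by case: (h u == h v); case: (e' _ _); case: (e u v).
exists h; first by move=> u v /eqP; case: (key u v) => -> _ /eqP.
by move=> u v; case: (key u v).
Qed.

Lemma zrep_wqo (R : realType) (t : R) (G : nat -> graph) : t < 2 ->
  (forall n, connected_graph (@edge (G n)) /\ zrep (@edge (G n)) /\ psd (@edge (G n)) t) ->
  exists i j, (i < j)%N /\ induced_subgraph (G i) (G j).
Proof.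
move=> t2 hG; pose d := Num.bound (4 / (2 - t)).
have /choice[code hcode] : forall n, exists x : tcode (label d) d,
    exists (C : finType) (phi : _ -> C -> int), gram (@edge (G n)) phi /\ realizes phi [::] (coords phi) x.
  move=> n; have [conn [[C [phi hg]] ps]] := hG n.
  have es := @edge_sym (G n); have ei := @edge_irr (G n).
  have [r hr] := norm2_nz (gram_norm ei hg (Ordinal (gorder_gt0 (G n)))).
  have rD := coordsP hr.
  have [z zD|p pp up|x hx] := @realizes_exists _ _ phi d d [::] (coords phi) r rD.
  - exact: coords_connect hg _ _ conn rD zD.
  - have := root_path_bound ei hg ps pp up; rewrite -(ler_nat R) => h.
    have t2' : 0 < 2 - t by rewrite subr_gt0.
    have : 4 / (2 - t) < d%:R by apply: archi_boundP; apply: divr_ge0 => //; exact: ltW.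
    by rewrite ltr_pdivrMr // => h'; rewrite -(ler_pM2l t2'); apply: ltW; apply: le_lt_trans h _; rewrite mulrC.
  by exists x, C, phi.
have [i [j [ij le_ij]]] := @wqo_tcode (label d) d code; exists i, j; split=> //.
have [C [phi [hg hr]]] := hcode i; have [C' [phi' [hg' hr']]] := hcode j.
have [f hf] := realizes_embeds (erefl : size (Nil C) = size (Nil C')) (leqnn d) hr hr' le_ij.
exact: (gram_embedding (@edge_irr (G i)) (@edge_irr (G j)) hg hg' hf).
Qed.

(** * Minimal graphs *)

Section Induced.
Variables (R : realType) (t : R).

Lemma qform_induced (U V : finType) (e' : rel U) (e : rel V) (f : U -> V) (X : U -> R) : injective f ->
  (forall i j, e (f i) (f j) = e' i j) -> qform e t (push f X) = qform e' t X.
Proof.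
move=> fi fE; rewrite qform_push //; congr (_ + _).
by apply: eq_bigr => i _; apply: eq_bigr => j _; rewrite fE.
Qed.

Lemma psd_induced (H G : graph) : induced_subgraph H G -> psd (@edge G) t -> psd (@edge H) t.
Proof. by move=> [f fi fE] ps x; rewrite -(qform_induced x fi fE). Qed.

(** Minimality is stated through supports, so that deleting vertices needs no new graph. *)
Definition minimal_not_psd (V : finType) (e : rel V) : Prop :=
  ~ psd e t /\ forall T : {set V}, T != setT -> forall x, supp_in T x -> 0 <= qform e t x.

Section OneGraph.
Variables (V : finType) (e : rel V).
Hypotheses (es : symmetric e) (ei : irreflexive e) (mi : minimal_not_psd e).

Lemma minimal_connected : connected_graph e.
Proof.
move=> T T0 TT; apply: contrapT => nex; case: mi => nps hT; apply: nps => x.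
have ne u v : u \in T -> v \notin T -> e u v = false.
  by move=> uT vT; apply/negP => uv; apply: nex; exists v => //; exists u; rewrite // es.
pose x1 v := if v \in T then x v else 0; pose x2 v := if v \in T then 0 else x v.
have -> : qform e t x = qform e t (x1 \+ x2).
  by apply: eq_qform => v /=; rewrite /x1 /x2; case: ifP; rewrite ?addr0 ?add0r.
rewrite qformD // (_ : _ + bform e x1 x2 = 0) ?mulr0 ?addr0; last first.
  rewrite big1 => [|v _]; last by rewrite /x1 /x2; case: ifP; rewrite ?mul0r ?mulr0.
  rewrite mulr0 add0r; apply: big1 => u _; apply: big1 => v _; rewrite /x1 /x2.
  case: ifPn => uT; last by rewrite mulr0 mul0r.
  by case: ifPn => vT; [rewrite mulr0 | rewrite ne ?mul0r].
apply: addr_ge0.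
  by apply: (hT T TT) => v vT; rewrite /x1 (negPf vT).
apply: (hT (~: T)); last by move=> v; rewrite inE negbK /x2 => ->.
by apply: contra T0 => /eqP h; rewrite -[T]setCK h setCT.
Qed.

(* Average the form over the deletions of one vertex. *)
Lemma minimal_psd : (2 < #|V|)%N -> psd e (t * (#|V|%:R - 1) / (#|V|%:R - 2)).
Proof.
move=> n2 x; case: mi => _ hT.
have n2' : 0 < #|V|%:R - 2 :> R by rewrite subr_gt0 ltr_nat.
have : 0 <= \sum_p qform e t (x \+ ((- x p) \*o ind R [set p])).
  apply: sumr_ge0 => p _; apply: (hT (~: [set p])).
    by apply/eqP => /setP/(_ p); rewrite !inE eqxx.
  move=> v; rewrite !inE negbK => /eqP ->; by rewrite /= /ind inE eqxx mulr1 subrr.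
rewrite (eq_bigr (fun p => qform e t x - t * x p ^+ 2 - 2 * (x p * (\sum_u x u * (e u p)%:R)))) => [|p _].
  rewrite !sumrB sumr_const -mulr_sumr -mulr_sumr.
  have -> : \sum_p x p * (\sum_u x u * (e u p)%:R) = bform e x x.
    rewrite /bform exchange_big /=; apply: eq_bigr => p _; rewrite mulr_sumr; apply: eq_bigr => u _; by rewrite mulrA mulrC mulrCA mulrC mulrAC.
  rewrite !qformE -[_ *+ _]mulr_natr => h.
  rewrite -(pmulr_rge0 _ n2'); apply: le_trans h _; rewrite le_eqVlt; apply/orP; left; apply/eqP.
  by field; rewrite gt_eqF.
rewrite qformD // qformZ // qform_ind1 //.
have -> : \sum_v x v * ((- x p) \*o ind R [set p]) v = - x p ^+ 2.
  rewrite (bigD1 p) //= big1 => [|v /negPf vp]; first by rewrite /= /ind inE eqxx mulr1; ring.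
  by rewrite /= /ind inE vp !mulr0.
have -> : bform e x ((- x p) \*o ind R [set p]) = - x p * \sum_u x u * (e u p)%:R.
  rewrite bformC // bformZl bformC // bform_ind; congr (_ * _); apply: eq_bigr => u _; by rewrite big_set1.
by ring.
Qed.

End OneGraph.

(** Take a vector of negative form with the smallest possible support, and the subgraph induced on
    that support. *)
Lemma exists_minimal (G : graph) : ~ psd (@edge G) t ->
  exists2 H, induced_subgraph H G & minimal_not_psd (@edge H).
Proof.
move=> nps; pose P k := `[< exists (T : {set 'I_(gorder G)}) x, [/\ #|T| = k, supp_in T x & qform (@edge G) t x < 0] >].
have ex : exists k, P k.
  have /existsNP[x /negP] := nps; rewrite -ltNge => h.
  by exists #|[set: 'I_(gorder G)]|; apply/asboolP; exists setT, x; split=> // v; rewrite inE.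
case: (ex_minnP ex) => k /asboolP[T [x [Tk sx hx]]] mk.
have T0 : (0 < #|T|)%N.
  rewrite card_gt0; apply/eqP => h; move: hx; suff -> : qform (@edge G) t x = 0 by rewrite ltxx.
  have x0 v : x v = 0 by apply: sx; rewrite h inE.
  rewrite /qform !big1 ?mulr0 ?addr0 // => u _; last by rewrite x0 expr0n.
  by rewrite big1 // => v _; rewrite x0 mulr0 mul0r.
pose f (i : 'I_#|T|) : 'I_(gorder G) := enum_val i.
have fi : injective f by exact: enum_val_inj.
have Hs : symmetric (fun i j => edge (f i) (f j)) by move=> i j; exact: edge_sym.
have Hi : irreflexive (fun i j => edge (f i) (f j)) by move=> i; exact: edge_irr.
exists (Graph T0 Hs Hi); first by exists f.
split=> /=.
  move=> /(_ (fun i => x (f i))); apply/negP; rewrite -ltNge.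
  rewrite -(qform_induced (e := @edge G) _ fi (fun i j => erefl)).
  suff -> : push f (fun i => x (f i)) = x by [].
  apply/funext => v; case: (boolP (v \in T)) => vT.
    by rewrite -(enum_rankK_in vT vT) push_f.
  rewrite (sx v vT); apply: push_supp; apply: contra vT => /imsetP[i _ ->]; exact: enum_valP.
move=> U UT z sz; rewrite -(qform_induced (e := @edge G) _ fi (fun i j => erefl)) leNgt; apply/negP => hz.
have : (k <= #|f @: U|)%N.
  apply: mk; apply/asboolP; exists (f @: U), (push f z); split=> // v vU.
  case: (boolP (v \in f @: setT)) => [/imsetP[i _ E]|]; last exact: push_supp.
  by rewrite E (push_f z fi); apply: sz; apply: contra vU => iU; rewrite E; exact: imset_f.
rewrite card_imset // -Tk leqNgt -[X in (_ < X)%N]card_ord -cardsT => /negP; apply.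
by apply: proper_card; rewrite properEneq UT subsetT.
Qed.

End Induced.

Section FiniteGraphs.
Local Open Scope classical_set_scope.

Definition edge_table n (H : graph) : {ffun 'I_n * 'I_n -> bool} :=
  [ffun ij => if insub (val ij.1) is Some i then if insub (val ij.2) is Some j then @edge H i j else false else false].

Lemma finite_graphs N : finite_set [set H : graph | (gorder H <= N)%N].
Proof.
have -> : [set H : graph | (gorder H <= N)%N] = \bigcup_(n in `I_N.+1) [set H | gorder H = n].
  apply/seteqP; split=> H /=; first by move=> h; exists (gorder H).
  by case=> n /= nN ->.
apply: bigcup_finite => [|n _]; first exact: finite_II.
have ci : {in [set H | gorder H = n] &, injective (edge_table n)}.
  move=> [m m0 e es ei] [m' m0' e' es' ei'] /set_mem /= E /set_mem /= E'.
  move: n E m' E' m0' e' es' ei' => _ <- _ -> m0' e' es' ei' /ffunP h.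
  have Ee : e = e'.
    apply/funext => i; apply/funext => j; have := h (i, j); rewrite !ffunE /=.
    by rewrite !valK.
  move: es' ei' {h}; rewrite -Ee => es' ei'.
  by rewrite (Prop_irrelevance es es') (Prop_irrelevance ei ei') (Prop_irrelevance m0 m0').
have : finite_set (edge_table n @` [set H | gorder H = n]) by exact: finite_finset.
by rewrite (eq_finite_set (inj_card_eq ci)).
Qed.

End FiniteGraphs.

Section Bounded.
Variables (R : realType) (y : R).
Hypotheses (y1 : 1 < y) (yl : y + y^-1 < 20 / 9) (y6 : y ^+ 6 = y ^+ 2 + 1).
Local Notation ls := (y + y^-1).

Lemma large_minimal (lam t : R) : lam < t -> t < ls -> exists N, forall G : graph,
  minimal_not_psd lam (@edge G) -> (N <= gorder G)%N ->
  [/\ connected_graph (@edge G), zrep (@edge G) & psd (@edge G) t].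
Proof.
move=> lt tl; have [N hN] := large_zrep y1 yl y6 tl.
(* The level [lam * (n - 1) / (n - 2)] obtained by averaging exceeds [lam] by [lam / (n - 2)]; from
   order [m] on it is at most [t]. *)
pose m := (Num.bound (`|lam| / (t - lam))).+3.
exists (N + m)%N => G mG big; have es := @edge_sym G; have ei := @edge_irr G.
have conn := minimal_connected es mG.
have mb : (m <= gorder G)%N by apply: leq_trans big; rewrite leq_addl.
have ps : psd (@edge G) t.
  apply: psd_le (minimal_psd es ei mG _); rewrite card_ord; last by apply: leq_trans mb.
  have m2 : m%:R - 2 <= (gorder G)%:R - 2 :> R by rewrite lerD2r ler_nat.
  have mE : m%:R - 2 = (Num.bound (`|lam| / (t - lam)))%:R + 1 :> R.
    by rewrite /m -!natr1; ring.
  have tl0 : 0 < t - lam by rewrite subr_gt0.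
  have : `|lam| / (t - lam) < (Num.bound (`|lam| / (t - lam)))%:R.
    by apply: archi_boundP; apply: divr_ge0 => //; exact: ltW.
  rewrite ltr_pdivrMr // => h.
  have bp : 0 <= (Num.bound (`|lam| / (t - lam)))%:R :> R by exact: ler0n.
  have np : 0 < (gorder G)%:R - 2 :> R by lra.
  rewrite ler_pdivrMr //.
  have : lam <= (gorder G)%:R * (t - lam) - 2 * (t - lam).
    apply: le_trans (ler_norm _) _; apply: ltW; apply: lt_le_trans h _.
    by rewrite -mulrBl ler_pM2r //; lra.
  lra.
split=> //; apply: hN => //; rewrite card_ord; by apply: leq_trans big; rewrite leq_addr.
Qed.

Lemma minimal_bounded (lam : R) : lam < ls -> exists N, forall G : graph,
  minimal_not_psd lam (@edge G) -> (gorder G <= N)%N.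
Proof.
move=> ll; have l2 := ls_gt2 y1; case: (leP 2 lam) => lam2.
  have [||N hN] := @large_minimal lam ((lam + ls) / 2); [by lra | by lra |].
  exists N => G mG; rewrite leqNgt; apply/negP => big.
  have [_ z _] := hN G mG (ltnW big); case: mG => nps _; apply: nps.
  exact: (psd_le lam2 (@zrep_psd R _ _ z)).
have [||N hN] := @large_minimal lam ((lam + 2) / 2); [by lra | by lra |].
apply: contrapT => /forallNP nb.
have /choice[h hh] : forall n, exists G : graph, minimal_not_psd lam (@edge G) /\ (n < gorder G)%N.
  by move=> n; have /existsNP[G /not_implyP[mG /negP]] := nb n; rewrite -ltnNge => lt; exists G.
pose G := fix G n := if n is n'.+1 then h (N + gorder (G n'))%N else h N.
have hG n : minimal_not_psd lam (@edge (G n)) /\ (N <= gorder (G n))%N.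
  case: n => [|n] /=; first by case: (hh N) => ? /ltnW.
  by case: (hh (N + gorder (G n))%N) => mG lt; split=> //; apply: leq_trans (ltnW lt); rewrite leq_addr.
have Gi n : (gorder (G n) < gorder (G n.+1))%N.
  by case: (hh (N + gorder (G n))%N) => _; apply: leq_ltn_trans; rewrite leq_addl.
have [||i [j [ij [f fi fE]]]] := @zrep_wqo R ((lam + 2) / 2) G; first by lra.
  by move=> n; case: (hG n) => mG nN; case: (hN _ mG nN).
have oij := increasing_lt Gi ij.
case: (hG i) => [[nps _] _]; case: (hG j) => [[_ hT] _]; apply: nps => x.
rewrite -(qform_induced lam x fi fE); apply: (hT (f @: setT)); last exact: push_supp.
by apply: contraTneq oij => h'; rewrite -leqNgt -[X in (_ <= X)%N]card_ord -[X in (X <= _)%N]card_ord -cardsT -h' card_imset ?cardsT.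
Qed.

Lemma finite_characterization (lam : R) : lam < ls ->
  exists2 F : set graph, finite_set F & forbidden_subgraph_characterization F (family_ge lam).
Proof.
move=> /minimal_bounded[N hN].
exists (fun H => (gorder H <= N)%N /\ ~ psd (@edge H) lam).
  by apply: sub_finite_set (finite_graphs N) => H [].
move=> G; rewrite family_geP; split=> [ps [H [_ nps] /psd_induced/(_ ps)] //|nH].
apply: contrapT => nps; have [H HG mH] := exists_minimal nps.
by apply: nH; exists H => //; split; [exact: hN | case: mH].
Qed.

End Bounded.

(** * Graphs with smallest eigenvalue in a given interval *)

Section Machine.
Variables (R : realType) (l l' : R).
Hypotheses (l2 : 2 < l') (ll : l' < l).
(** The negation of the separation sought, assumed for contradiction. It keeps [h'] nonnegative as
    long as [h] is. *)
Hypothesis transfer : forall (U : finType) (e : rel U), symmetric e -> irreflexive e -> (0 < #|U|)%N ->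
  psd e l -> psd e l'.

(* A graph with a distinguished set [S]: the least value of the form at level [l] under
   [\sum_(v in S) x v = 1] is at least [h], and at level [l'] it is at most [h']. *)
Definition state (h h' : R) : Prop := exists (U : finType) (e : rel U) (S : {set U}),
  [/\ symmetric e, irreflexive e, forall x, h * (\sum_(v in S) x v) ^+ 2 <= qform e l x &
    exists2 x, \sum_(v in S) x v = 1 & qform e l' x <= h'].

Lemma state_single : state l l'.
Proof.
exists unit, (fun _ _ => false), setT; split=> // [x|].
  rewrite (eq_bigl predT) => [|v]; last by rewrite inE.
  rewrite /qform !(big_pred1 tt) //=; [|by case..]; by rewrite !mul0r addr0.
exists (fun=> 1); first by rewrite (big_pred1 tt) // => -[]; rewrite inE.
rewrite /qform !(big_pred1 tt) //=; [|by case..]; by rewrite !mul0r addr0 expr1n mulr1.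
Qed.

Lemma state_nonneg h h' : state h h' -> 0 <= h -> 0 <= h'.
Proof.
move=> [U [e [S [es ei lo [x x1 up]]]]] h0; apply: le_trans up.
apply: transfer => // [|z]; last by apply: le_trans (lo z); rewrite mulr_ge0 ?sqr_ge0.
rewrite lt0n; apply/eqP => U0; have := oner_neq0 R; rewrite -x1 big1 ?eqxx // => v _.
by have := fintype0 v U0.
Qed.

(** A new vertex joined to [S] becomes the only distinguished vertex, and minimizing over the old
    graph gives [l - h^-1]. When this is nonnegative the enlarged graph is psd at [l], hence at
    [l'], which forces [h'] to be positive. *)
Lemma state_root h h' : state h h' -> 0 < h -> 0 <= l - h^-1 -> 0 < h' /\ state (l - h^-1) (l' - h'^-1).
Proof.
move=> [U [e [S [es ei lo [x x1 up]]]]] h0 lh; have k2 := l2.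
have lo' z : (l - h^-1) * (\sum_(v in [set None]) z v) ^+ 2 <= qform (pend e S) l z.
  rewrite big_set1 qform_pend; have := lo (fun u => z (Some u)).
  set s := \sum_(u in S) _; set w := z None => hs.
  have : 0 <= h * (s + h^-1 * w) ^+ 2 by rewrite mulr_ge0 ?sqr_ge0 // ltW.
  rewrite (_ : h * _ = h * s ^+ 2 + 2 * w * s + h^-1 * w ^+ 2); last by field; rewrite gt_eqF.
  lra.
pose z c w (u : option U) := if u is Some u' then c * x u' else w.
have qz c w : qform (pend e S) l' (z c w) = c ^+ 2 * qform e l' x + 2 * w * c + l' * w ^+ 2.
  rewrite qform_pend /= -mulr_sumr x1 mulr1; congr (_ + _ + _).
  by rewrite -[LHS]/(qform e l' (c \*o x)) qformZ //.
have h'0 : 0 < h'.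
  have hp : psd (pend e S) l'.
    apply: transfer; [exact: pend_sym | exact: pend_irr | by rewrite card_option |].
    by move=> w; apply: le_trans (lo' w); rewrite mulr_ge0 ?sqr_ge0.
  have := hp (z (- l') 1); rewrite qz ltNge => hz; apply/negP => h'n.
  have : (- l') ^+ 2 * qform e l' x <= 0 by rewrite mulr_ge0_le0 ?sqr_ge0 // (le_trans up).
  by move: hz; rewrite expr1n; lra.
split=> //; exists (option U), (pend e S), [set None]; split=> //.
- exact: pend_sym.
- exact: pend_irr.
exists (z (- h'^-1) 1); first by rewrite big_set1.
rewrite qz; have := ler_wpM2l (sqr_ge0 (- h'^-1)) up.
rewrite (_ : (- h'^-1) ^+ 2 * h' = h'^-1); last by field; rewrite gt_eqF.
by rewrite expr1n; lra.
Qed.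

Lemma sum_setU1_option (U : finType) (S : {set U}) (z : option U -> R) :
  \sum_(v in None |: Some @: S) z v = z None + \sum_(v in S) z (Some v).
Proof.
rewrite big_setU1 /=; last by apply/imsetP => -[].
by congr (_ + _); rewrite big_imset // => a b _ _ [].
Qed.

Lemma state_leaf h h' : state h h' -> state (h - l^-1) (h' - l'^-1).
Proof.
move=> [U [e [S [es ei lo [x x1 up]]]]]; have k2 := l2; have kl := ll.
have l0 : 0 < l by lra. have l'0 : 0 < l' by lra.
exists (option U), (pend e S), (Some @: S); split.
- exact: pend_sym.
- exact: pend_irr.
- move=> z; rewrite big_imset => [|a b _ _ []] //=; rewrite qform_pend.
  have := lo (fun u => z (Some u)); set s := \sum_(u in S) _; set w := z None => hs.
  have : 0 <= l * (w + l^-1 * s) ^+ 2 by rewrite mulr_ge0 ?sqr_ge0 // ltW.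
  rewrite (_ : l * _ = l * w ^+ 2 + 2 * w * s + l^-1 * s ^+ 2); last by field; rewrite gt_eqF.
  lra.
exists (fun u => if u is Some u' then x u' else - l'^-1).
  by rewrite big_imset => [|a b _ _ []].
rewrite qform_pend /= x1 mulr1 -[X in qform e l' X]/x.
rewrite (_ : l' * _ = l'^-1); last by field; rewrite gt_eqF.
lra.
Qed.

(** The new vertex is joined to [S] and then added to it. After subtraction of [(w + s) ^+ 2] the
    lower bound is diagonal, [(h - 1) * s ^+ 2 + (l - 1) * w ^+ 2], and its least value under
    [w + s = 1] is the parallel sum of [h - 1] and [l - 1]. *)
Lemma state_clique h h' : state h h' -> 0 <= h ->
  state (1 + (h - 1) * (l - 1) / (h + l - 2)) (1 + (h' - 1) * (l' - 1) / (h' + l' - 2)).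
Proof.
move=> st h0; have h'0 := state_nonneg st h0; case: st => U [e [S [es ei lo [x x1 up]]]].
have k2 := l2; have kl := ll; have p0 : 0 < h + l - 2 by lra. have p'0 : 0 < h' + l' - 2 by lra.
exists (option U), (pend e S), (None |: Some @: S); split.
- exact: pend_sym.
- exact: pend_irr.
- move=> z; rewrite sum_setU1_option qform_pend.
  have := lo (fun u => z (Some u)); set s := \sum_(u in S) _; set w := z None => hs.
  have : 0 <= ((h - 1) * s - (l - 1) * w) ^+ 2 / (h + l - 2) by rewrite divr_ge0 ?sqr_ge0 // ltW.
  have -> : ((h - 1) * s - (l - 1) * w) ^+ 2 / (h + l - 2) =
      (h - 1) * s ^+ 2 + (l - 1) * w ^+ 2 - (h - 1) * (l - 1) / (h + l - 2) * (w + s) ^+ 2.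
    by field; rewrite gt_eqF.
  set Q := _ / _; have -> : (1 + Q) * (w + s) ^+ 2 = w ^+ 2 + 2 * w * s + s ^+ 2 + Q * (w + s) ^+ 2 by ring.
  lra.
pose c := (l' - 1) / (h' + l' - 2).
exists (fun u => if u is Some u' then c * x u' else 1 - c).
  by rewrite sum_setU1_option /= -mulr_sumr x1 mulr1 subrK.
rewrite qform_pend /= -mulr_sumr x1 mulr1 -[X in X + _ + _]/(qform e l' (c \*o x)) qformZ //.
have := ler_wpM2l (sqr_ge0 c) up.
have -> : 1 + (h' - 1) * (l' - 1) / (h' + l' - 2) = c ^+ 2 * h' + 2 * (1 - c) * c + l' * (1 - c) ^+ 2.
  by rewrite /c; field; rewrite gt_eqF.
lra.
Qed.

End Machine.

Lemma escape (R : realType) (P : R -> Prop) (g0 eta B : R) : 0 < eta -> P g0 ->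
  (forall x, g0 <= x -> P x -> exists2 x', x + eta <= x' & P x') -> (forall x, P x -> x <= B) -> False.
Proof.
move=> eta0 P0 step bd.
have grow n : exists2 x, g0 + n%:R * eta <= x & P x.
  elim: n => [|n [x hx Px]]; first by exists g0; rewrite // mul0r addr0.
  have nn : 0 <= n%:R * eta by rewrite mulr_ge0 // ltW.
  have [|x' xx' Px'] := step x _ Px; first by lra.
  exists x' => //; apply: le_trans xx'; rewrite -natr1 mulrDl mul1r; lra.
have [x hx /bd xB] := grow (Num.bound (`|B - g0| / eta)).
have : `|B - g0| / eta < (Num.bound (`|B - g0| / eta))%:R.
  by apply: archi_boundP; apply: divr_ge0 => //; exact: ltW.
rewrite ltr_pdivrMr // => h; have := ler_norm (B - g0); lra.
Qed.

(** Subtracting [k] as long as possible brings [h] into a window of width [k]; since [k <= k'], the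
    gap [h - h'] never shrinks. *)
Lemma greedy (R : realType) (Q : R -> R -> Prop) (b k k' : R) : 0 < k -> k <= k' ->
  (forall h h', Q h h' -> b + k <= h -> Q (h - k) (h' - k')) ->
  forall h h', Q h h' -> b <= h -> exists h1 h1', [/\ Q h1 h1', b <= h1, h1 < b + k & h - h' <= h1 - h1'].
Proof.
move=> k0 kk step; have : forall n h h', Q h h' -> b <= h -> h < b + n%:R * k ->
    exists h1 h1', [/\ Q h1 h1', b <= h1, h1 < b + k & h - h' <= h1 - h1'].
  elim=> [|n IH] h h' hQ bh hn; first by move: hn; rewrite mul0r; lra.
  case: (ltP h (b + k)) => hk; first by exists h, h'.
  move: hn; rewrite -natr1 mulrDl mul1r => hn.
  have [|||h1 [h1' [q1 b1 k1 g1]]] := IH (h - k) (h' - k'); [exact: step | by lra | by lra |].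
  by exists h1, h1'; split=> //; lra.
move=> h2 h h' hQ bh; apply: (h2 (Num.bound ((h - b) / k)) h h' hQ bh).
have : (h - b) / k < (Num.bound ((h - b) / k))%:R.
  by apply: archi_boundP; apply: divr_ge0; rewrite ?subr_ge0 // ltW.
rewrite ltr_pdivrMr //; lra.
Qed.

Lemma moebius_diff (F : fieldType) (m s s' : F) : 1 - m * s != 0 -> 1 - m * s' != 0 ->
  s / (1 - m * s) - s' / (1 - m * s') = (s - s') / ((1 - m * s) * (1 - m * s')).
Proof. by move=> h h'; field; rewrite h h'. Qed.

(** The step [h -> t - h^-1] of [state_root], written in the coordinate [v = (1 - h)^-1]. *)
Lemma root_transfer (F : fieldType) (t v : F) : v != 0 -> v - 1 != 0 ->
  t - (1 - v^-1)^-1 = 1 - ((v - 1) / (1 - (t - 2) * (v - 1)))^-1.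
Proof. by move=> v0 v1; rewrite invf_div; field; rewrite v0 v1. Qed.

(** * Expansion of the gap along a caterpillar *)

Section Dynamics.
Variables (R : realType) (a l' : R).
Hypotheses (a0 : 0 < a) (a1 : a < 1).
Local Notation l := (a + a^-1).
Hypotheses (l2 : 2 < l') (ll : l' < l).
Hypothesis transfer : forall (U : finType) (e : rel U), symmetric e -> irreflexive e -> (0 < #|U|)%N ->
  psd e l -> psd e l'.
Local Notation state := (state l l').

Lemma inv_l : l^-1 = a / (1 + a ^+ 2).
Proof.
have : 0 < 1 + a ^+ 2 by have := sqr_ge0 a; lra.
by move=> h; field; rewrite ?gt_eqF // -expr2 addrC.
Qed.

(* Caterpillars with as many leaves as possible at each vertex. *)
Lemma tree_contradiction : a + l^-1 < 1 -> False.
Proof.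
move=> hb; have k2 := l2; have kl := ll; have p0 := a0; have p1 := a1.
have l0 : 0 < l by lra. have l'0 : 0 < l' by lra.
have i0 : 0 < l^-1 by rewrite invr_gt0.
have ii : l^-1 <= l'^-1 by rewrite lef_pV2 ?posrE //; lra.
pose b := a + l^-1; have bp : 0 < b by rewrite /b; lra.
pose P x := exists h h', [/\ state h h', a <= h, h <= l & h - h' = x].
(* Leaves bring [h1] into [[a, b)] with [b < 1]. The root step then multiplies the gap by
   [1 / (h1 * h1')], at least [1 / b], so it grows by at least this amount. *)
have eta0 : 0 < (l - l') * (b^-1 - 1).
  by apply: mulr_gt0; rewrite ?subr_gt0 // invf_gt1.
apply: (@escape R P (l - l') _ l eta0).
- by exists l, l'; split=> //; [exact: state_single | have := invr_gt0 a; lra].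
- move=> x gx [h [h' [st ah hl E]]].
  have [h1 [h1' [st1 ah1 hb1 g1]]] := @greedy R state a l^-1 l'^-1 i0 ii (fun h h' s _ => state_leaf l2 ll s) h h' st ah.
  have h10 : 0 < h1 by lra.
  have inv1 : h1^-1 <= a^-1 by rewrite lef_pV2.
  have [|h1'0 st2] := state_root l2 transfer st1 h10; first by lra.
  exists (l - h1^-1 - (l' - h1'^-1)); last first.
    have ih1 : 0 < h1^-1 by rewrite invr_gt0.
    by exists (l - h1^-1), (l' - h1'^-1); split=> //; lra.
  have E2 : h1'^-1 - h1^-1 = (h1 - h1') / (h1 * h1') by field; rewrite !gt_eqF.
  have : (h1 - h1') / b <= (h1 - h1') / (h1 * h1').
    apply: ler_wpM2l; first by lra.
    rewrite lef_pV2 ?posrE ?mulr_gt0 //.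
    have : h1 * h1' <= b * 1 by apply: ler_pM; rewrite /b; lra.
    by rewrite mulr1.
  have : (l - l') * (b^-1 - 1) <= (h1 - h1') * (b^-1 - 1).
    apply: ler_wpM2r; last by lra.
    by rewrite subr_ge0 invf_ge1 // ltW.
  rewrite -E2; lra.
- move=> x [h [h' [st ah hl <-]]]; have := state_nonneg transfer st (_ : 0 <= h); lra.
Qed.

(* Caterpillars of cliques, in the coordinate [u = 1 / (1 - h)]: a pendant vertex in a clique
   translates [u], and passing to the next clique expands. *)
Lemma clique_contradiction h0 h0' : 1 / 2 <= a -> state h0 h0' -> a <= h0 -> h0 < 1 -> h0' < h0 -> False.
Proof.
move=> ha st0 ah0 h01 gap0; have k2 := l2; have kl := ll; have p0 := a0; have p1 := a1.
pose u0 := (1 - a)^-1; pose k := (l - 1)^-1; pose k' := (l' - 1)^-1.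
have a1p : 0 < 1 - a by lra.
have k0 : 0 < k by rewrite invr_gt0; lra.
have kk : k <= k' by rewrite lef_pV2 ?posrE; lra.
have k'1 : k' < 1 by rewrite invf_lt1; lra.
have u01 : 1 < u0 by rewrite invf_gt1 //; lra.
have aa : a * a^-1 = 1 by rewrite mulfV // gt_eqF.
have ai0 : 0 < a^-1 by rewrite invr_gt0.
(* At [u0], the image of [a], the denominator of the root step is [a], and [(u0 - 1) / a = u0]: this
   is the fixed point. *)
have mu0 : (l - 2) * (u0 - 1) = 1 - a by rewrite /u0; field; rewrite ?gt_eqF.
(* Keeps the denominator [D] positive on the whole window from [u0] to [u0 + k]. *)
have muk : (l - 2) * k < a.
  rewrite ltr_pdivrMr; last by lra.
  have : a * (l - 2) < a * (a * (l - 1)); last by rewrite ltr_pM2l.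
  rewrite !(mulrBr, mulrDr, mulrDl) aa; nra.
pose Q u u' := [/\ 1 <= u, 0 < u' & state (1 - u^-1) (1 - u'^-1)].
have Qge1 u u' : Q u u' -> 1 <= u'.
  move=> [u1 u'0 st]; have := state_nonneg transfer st; rewrite !subr_ge0 => hh.
  by rewrite -invf_le1 //; apply: hh; rewrite invf_le1 //; lra.
have stepQ u u' : Q u u' -> u0 + k <= u -> Q (u - k) (u' - k').
  move=> hQ uk; have u'1 := Qge1 _ _ hQ; case: hQ => u1 u'0 st; split; [lra | lra |].
  have := state_clique l2 ll transfer st; rewrite subr_ge0 invf_le1; last by lra.
  move=> /(_ u1); have l1 : 0 < l - 1 by lra. have l'1 : 0 < l' - 1 by lra.
  have E (t v : R) : 1 < t -> 0 < v -> 0 < v - (t - 1)^-1 ->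
      1 + (1 - v^-1 - 1) * (t - 1) / (1 - v^-1 + t - 2) = 1 - (v - (t - 1)^-1)^-1.
    move=> t1 v0 vt; have : 0 < (t - 1) * v - 1.
      have : 0 < (t - 1) * (v - (t - 1)^-1) by rewrite mulr_gt0 // subr_gt0.
      by rewrite mulrBr mulfV // gt_eqF // subr_gt0.
    move=> hp; have t1' : 0 < t - 1 by lra.
    field; rewrite !gt_eqF //; lra.
  by rewrite !E //; rewrite -/k -/k'; lra.
pose P x := exists v v', [/\ Q v v', u0 <= v, v < u0 + k & v - v' = x].
have greedyP u u' : Q u u' -> u0 <= u -> exists2 x, u - u' <= x & P x.
  move=> hQ uu; have [v [v' [hv uv vk g]]] := greedy k0 kk stepQ hQ uu.
  by exists (v - v') => //; exists v, v'.
have h0'0 := state_nonneg transfer st0 (_ : 0 <= h0).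
have iE (h : R) : h < 1 -> 1 - ((1 - h)^-1)^-1 = h by move=> hh; rewrite invrK; lra.
have [||x0 gx0 Px0] := @greedyP (1 - h0)^-1 (1 - h0')^-1.
- split; first by rewrite invf_ge1; lra.
    by rewrite invr_gt0; lra.
  by rewrite !iE //; lra.
- by rewrite lef_pV2 ?posrE; lra.
have x00 : 0 < x0.
  by apply: lt_le_trans gx0; rewrite subr_gt0 ltf_pV2 ?posrE; lra.
apply: (@escape R P x0 (x0 * (a^-1 - 1)) (u0 + k)) => //.
- by apply: mulr_gt0; rewrite // subr_gt0 invf_gt1.
- move=> x gx [v [v' [hQ uv vk E]]]; have v'1 := Qge1 _ _ hQ; case: hQ => v1 v'0 st.
  have s1 : (l - 2) * (u0 - 1) <= (l - 2) * (v - 1) by apply: ler_wpM2l; lra.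
  have s2 : (l - 2) * (v - 1) < (l - 2) * (u0 - 1 + k) by rewrite ltr_pM2l; lra.
  rewrite [X in _ < X]mulrDr mu0 in s2; rewrite mu0 in s1.
  pose D := 1 - (l - 2) * (v - 1); pose D' := 1 - (l' - 2) * (v' - 1); pose D2 := 1 - (l - 2) * (v' - 1).
  have D0 : 0 < D by rewrite /D; lra.
  have Da : D <= a by rewrite /D; lra.
  have D2D : D <= D2.
    by rewrite /D /D2 lerD2l lerN2; apply: ler_wpM2l; lra.
  have D'D : D2 <= D' by rewrite /D' /D2 lerD2l lerN2; apply: ler_wpM2r; lra.
  have D21 : D2 <= 1 by rewrite /D2 gerBl; apply: mulr_ge0; lra.
  have vv : 0 < v - 1 by lra.
  have hv : 0 < 1 - v^-1 by rewrite subr_gt0 invf_lt1; lra.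
  have E1 : l - (1 - v^-1)^-1 = 1 - ((v - 1) / D)^-1.
    by apply: root_transfer; rewrite gt_eqF //; lra.
  have unew : u0 <= (v - 1) / D.
    have : (u0 - 1) / a <= (v - 1) / D by apply: ler_pM; rewrite ?invr_ge0 ?lef_pV2 ?posrE; lra.
    apply: le_trans; rewrite le_eqVlt; apply/orP; left; apply/eqP.
    by rewrite /u0; field; rewrite ?gt_eqF.
  have [|hv' st2] := state_root l2 transfer st hv.
    by rewrite E1 subr_ge0 invf_le1; lra.
  have v'1' : 1 < v' by move: hv'; rewrite subr_gt0 invf_lt1.
  have E1' : l' - (1 - v'^-1)^-1 = 1 - ((v' - 1) / D')^-1.
    by apply: root_transfer; rewrite gt_eqF //; lra.
  rewrite E1 E1' in st2.
  have [||x' gx' Px'] := @greedyP ((v - 1) / D) ((v' - 1) / D').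
  + split=> //; first by lra.
    by apply: divr_gt0; lra.
  + by [].
  exists x' => //; apply: le_trans gx'.
  have le1 : (v' - 1) / D' <= (v' - 1) / D2.
    apply: ler_wpM2l; first by lra.
    by rewrite lef_pV2 ?posrE //; lra.
  have E3 : (v - 1) / D - (v' - 1) / D2 = (v - v') / (D * D2).
    rewrite /D /D2 moebius_diff -/D -/D2 ?gt_eqF //; last by exact: lt_le_trans D2D.
    by congr (_ / _); ring.
  have le2 : (v - v') / a <= (v - v') / (D * D2).
    apply: ler_wpM2l; first by lra.
    rewrite lef_pV2 ?posrE //; last by rewrite mulr_gt0 //; lra.
    have : D * D2 <= a * 1 by apply: ler_pM; lra.
    by rewrite mulr1.
  have le3 : x0 * (a^-1 - 1) <= (v - v') * (a^-1 - 1).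
    by apply: ler_wpM2r; [rewrite subr_ge0 invf_ge1 //; lra | lra].
  lra.
- move=> x [v [v' [hQ uv vk <-]]]; have := Qge1 _ _ hQ; lra.
Qed.

End Dynamics.

(** * Rooted graphs from which the caterpillars of cliques start *)

Section Starters.
Variables (R : realType) (a l' : R).
Hypotheses (a0 : 0 < a) (a1 : a < 1).
Local Notation l := (a + a^-1).
Hypotheses (l2 : 2 < l') (ll : l' < l).
Hypothesis transfer : forall (U : finType) (e : rel U), symmetric e -> irreflexive e -> (0 < #|U|)%N ->
  psd e l -> psd e l'.
Local Notation state := (state l l').

Let d0 : 0 < 1 + a ^+ 2. Proof. by have := sqr_ge0 a; lra. Qed.

Lemma state_edge : state ((l + 1) / 2) ((l' + 1) / 2).
Proof.
have := state_clique l2 ll transfer (state_single l l'); have k2 := l2; have kl := ll.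
have E (t : R) : 2 < t -> 1 + (t - 1) * (t - 1) / (t + t - 2) = (t + 1) / 2.
  by move=> t2; field; rewrite gt_eqF //; lra.
by rewrite !E; [apply| |]; lra.
Qed.

Lemma state_triangle : state ((l + 2) / 3) ((l' + 2) / 3).
Proof.
have := state_clique l2 ll transfer state_edge; have k2 := l2; have kl := ll.
have E (t : R) : 2 < t -> 1 + ((t + 1) / 2 - 1) * (t - 1) / ((t + 1) / 2 + t - 2) = (t + 2) / 3.
  by move=> t2; field; rewrite gt_eqF //; lra.
by rewrite !E; [apply| |]; lra.
Qed.

Lemma ll_inv : l^-1 < l'^-1.
Proof. by have k2 := l2; have kl := ll; rewrite ltf_pV2 ?posrE; lra. Qed.

(** The clique on four vertices with three of them distinguished. The starters of this section place
    the complement in [[a, 1)] on overlapping ranges of [a]; the ends of the ranges are rational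
    points where the resulting polynomial inequalities hold. *)
Lemma state_triangle_leaf : 6 / 10 <= a -> a <= 8 / 10 ->
  exists h h', [/\ state h h', a <= h, h < 1 & h' < h].
Proof.
move=> ha hb; have h := state_leaf l2 ll state_triangle; have li := ll_inv; have kl := ll; have k := d0.
exists ((l + 2) / 3 - l^-1), ((l' + 2) / 3 - l'^-1); split=> //; last by lra.
- rewrite inv_l // -subr_ge0; have -> : (l + 2) / 3 - a / (1 + a ^+ 2) - a =
      (1 + 2 * a - 4 * a ^+ 2 + 2 * a ^+ 3 - 2 * a ^+ 4) / (3 * a * (1 + a ^+ 2)).
    by field; rewrite ?gt_eqF // ?mulr_gt0.
  apply: divr_ge0; last by rewrite !mulr_ge0 // ltW.
  have -> : 1 + 2 * a - 4 * a ^+ 2 + 2 * a ^+ 3 - 2 * a ^+ 4 =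
     1 + 2 * a - 4 * a ^+ 2 + 2 * (a ^+ 3 * (1 - a)) by ring.
  have : 0 <= a ^+ 3 * (1 - a) by rewrite mulr_ge0 ?exprn_ge0 ?subr_ge0 // ltW.
  nra.
- rewrite inv_l // -subr_gt0; have -> : 1 - ((l + 2) / 3 - a / (1 + a ^+ 2)) =
      (a + a ^+ 2 + a ^+ 3 - a ^+ 4 - 1) / (3 * a * (1 + a ^+ 2)).
    by field; rewrite ?gt_eqF // ?mulr_gt0.
  apply: divr_gt0; last by rewrite !mulr_gt0.
  have -> : a + a ^+ 2 + a ^+ 3 - a ^+ 4 - 1 = a + a ^+ 2 - 1 + a ^+ 2 * (a * (1 - a)) by ring.
  have p : 4 / 25 <= a * (1 - a) by nra.
  have : a ^+ 2 * (4 / 25) <= a ^+ 2 * (a * (1 - a)) by apply: ler_wpM2l => //; exact: sqr_ge0.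
  nra.
Qed.

(** The distinguished set is an edge, with two nonadjacent vertices joined to both of its ends. *)
Lemma state_edge_leaves : 56 / 100 <= a -> a <= 65 / 100 ->
  exists h h', [/\ state h h', a <= h, h < 1 & h' < h].
Proof.
move=> ha hb; have h := state_leaf l2 ll (state_leaf l2 ll state_edge).
have li := ll_inv; have kl := ll; have k := d0.
exists ((l + 1) / 2 - l^-1 - l^-1), ((l' + 1) / 2 - l'^-1 - l'^-1); split=> //; last by lra.
- rewrite inv_l // -subr_ge0; have -> : (l + 1) / 2 - a / (1 + a ^+ 2) - a / (1 + a ^+ 2) - a =
      (1 + a - 4 * a ^+ 2 + a ^+ 3 - a ^+ 4) / (2 * a * (1 + a ^+ 2)).
    by field; rewrite ?gt_eqF // ?mulr_gt0.
  apply: divr_ge0; last by rewrite !mulr_ge0 // ltW.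
  have -> : 1 + a - 4 * a ^+ 2 + a ^+ 3 - a ^+ 4 = 1 + a - 4 * a ^+ 2 + a ^+ 2 * (a * (1 - a)) by ring.
  have p : 22 / 100 <= a * (1 - a) by nra.
  have : a ^+ 2 * (22 / 100) <= a ^+ 2 * (a * (1 - a)) by apply: ler_wpM2l => //; exact: sqr_ge0.
  nra.
- rewrite inv_l // -subr_gt0; have -> : 1 - ((l + 1) / 2 - a / (1 + a ^+ 2) - a / (1 + a ^+ 2)) =
      (a + 2 * a ^+ 2 + a ^+ 3 - a ^+ 4 - 1) / (2 * a * (1 + a ^+ 2)).
    by field; rewrite ?gt_eqF // ?mulr_gt0.
  apply: divr_gt0; last by rewrite !mulr_gt0.
  have -> : a + 2 * a ^+ 2 + a ^+ 3 - a ^+ 4 - 1 = a + 2 * a ^+ 2 - 1 + a ^+ 3 * (1 - a) by ring.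
  have : 0 <= a ^+ 3 * (1 - a) by rewrite mulr_ge0 ?exprn_ge0 ?subr_ge0 // ltW.
  nra.
Qed.

(* At [lambda_star] the second hypothesis and [a <= h] both become equalities. *)
Lemma state_path_leaf : 75 / 100 <= a -> a ^+ 4 + a ^+ 6 <= 1 ->
  exists h h', [/\ state h h', a <= h, h < 1 & h' < h].
Proof.
move=> ha hb; have k2 := l2; have kl := ll; have k := d0; have p0 := a0; have p1 := a1.
have l0 : 0 < l by lra. have l'0 : 0 < l' by lra.
have li := ll_inv.
have sm (t : R) : 2 < t -> t^-1 < 1 / 2.
  by move=> t2; rewrite -[1/2]invrK ltf_pV2 ?posrE ?invr_gt0; rewrite ?invf_div; lra.
have s1 := sm _ k2; have s2 : l^-1 < 1 / 2 by apply: sm; lra.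
have [|h1 st1] := state_root l2 transfer (state_single l l') l0; first by lra.
have g1 : 0 < l - l^-1 by lra.
have g1' : 0 < l' - l'^-1 by lra.
have i1 : (l - l^-1)^-1 < (l' - l'^-1)^-1 by rewrite ltf_pV2 ?posrE; lra.
have b1 : (l - l^-1)^-1 < 1 by rewrite invf_lt1; lra.
have [|h2 st2] := state_root l2 transfer st1 g1; first by lra.
have h := state_leaf l2 ll st2.
exists (l - (l - l^-1)^-1 - l^-1), (l' - (l' - l'^-1)^-1 - l'^-1); split=> //; last by lra.
all: have k3 : 0 < 1 + a ^+ 2 + a ^+ 4 by have := sqr_ge0 (a ^+ 2); rewrite -exprM; lra.
all: have -> : (l - l^-1)^-1 = a * (1 + a ^+ 2) / (1 + a ^+ 2 + a ^+ 4).
1,3: by rewrite inv_l //; field; rewrite !gt_eqF.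
all: rewrite inv_l //.
- rewrite -subr_ge0; have -> : l - a * (1 + a ^+ 2) / (1 + a ^+ 2 + a ^+ 4) - a / (1 + a ^+ 2) - a =
      (1 - (a ^+ 4 + a ^+ 6)) / (a * (1 + a ^+ 2) * (1 + a ^+ 2 + a ^+ 4)).
    by field; rewrite ?gt_eqF.
  by apply: divr_ge0; rewrite ?subr_ge0 // !mulr_ge0 // ltW.
- rewrite -subr_gt0; have -> : 1 - (l - a * (1 + a ^+ 2) / (1 + a ^+ 2 + a ^+ 4) - a / (1 + a ^+ 2)) =
      (a * (1 + 2 * a ^+ 2 + 2 * a ^+ 4 + a ^+ 6) - (1 + a ^+ 2 + a ^+ 4 + a ^+ 6 + a ^+ 8)) /
         (a * (1 + a ^+ 2) * (1 + a ^+ 2 + a ^+ 4)).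
    by field; rewrite ?gt_eqF.
  apply: divr_gt0; last by rewrite !mulr_gt0.
  have [b Eb] : exists b, b = a ^+ 2 by exists (a ^+ 2).
  have E6 : a ^+ 6 = b ^+ 3 by rewrite Eb -exprM.
  have E4 : a ^+ 4 = b ^+ 2 by rewrite Eb -exprM.
  have E8 : a ^+ 8 = b ^+ 4 by rewrite Eb -exprM.
  rewrite E4 E6 in hb; rewrite -Eb E4 E6 E8 subr_gt0.
  have bl : 9 / 16 <= b by rewrite Eb; nra.
  have bu : b <= 77 / 100 by rewrite leNgt; apply/negP => hh; nra.
  have b2 : 0 <= b ^+ 2 by exact: sqr_ge0.
  have b0 : 0 <= b by lra.
  have b3 : b ^+ 3 = b * b ^+ 2 by rewrite -exprS.
  have b4 : b ^+ 4 = b * (b * b ^+ 2) by rewrite -!exprS.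
  have mono (c : R) : c <= a -> c * (1 + 2 * b + 2 * b ^+ 2 + b ^+ 3) <= a * (1 + 2 * b + 2 * b ^+ 2 + b ^+ 3).
    by move=> ca; apply: ler_wpM2r => //; rewrite b3; have := mulr_ge0 b0 b2; lra.
  case: (leP a (8 / 10)) => ha8.
    have bu' : b <= 64 / 100 by rewrite Eb; nra.
    apply: lt_le_trans (mono _ ha).
    have c3 : b * b ^+ 2 <= 64 / 100 * b ^+ 2 by apply: ler_wpM2r.
    have c4 : b * (b * b ^+ 2) <= 64 / 100 * (b * b ^+ 2) by apply: ler_wpM2r => //; exact: mulr_ge0.
    rewrite b3 b4; nra.
  apply: lt_le_trans (mono _ (ltW ha8)).
  have bl' : 64 / 100 <= b by rewrite Eb; nra.
  have c3 : b * b ^+ 2 <= 77 / 100 * b ^+ 2 by apply: ler_wpM2r.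
  have c4 : b * (b * b ^+ 2) <= 77 / 100 * (b * b ^+ 2) by apply: ler_wpM2r => //; exact: mulr_ge0.
  rewrite b3 b4; nra.
Qed.

End Starters.

(** * Separating any two levels from [lambda_star] on *)

Section Conclusion.
Variables (R : realType) (y : R).
Hypotheses (y1 : 1 < y) (y6 : y ^+ 6 = y ^+ 2 + 1).

Lemma no_spectral_gap (l l' : R) : y + y^-1 <= l' -> l' < l ->
  exists2 G : graph, psd (@edge G) l & ~ psd (@edge G) l'.
Proof.
move=> yl' ll; apply: contrapT => nex.
have tr (G : graph) : psd (@edge G) l -> psd (@edge G) l'.
  by move=> h; apply: contrapT => h'; apply: nex; exists G.
have transfer (U : finType) (e : rel U) : symmetric e -> irreflexive e -> (0 < #|U|)%N -> psd e l -> psd e l'.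
  move=> es ei U0 ps; pose f (i : 'I_#|U|) : U := enum_val i.
  have fi : injective f by exact: enum_val_inj.
  have Hs : symmetric (fun i j => e (f i) (f j)) by move=> i j; exact: es.
  have Hi : irreflexive (fun i j => e (f i) (f j)) by move=> i; exact: ei.
  have /tr/= psG : psd (@edge (Graph U0 Hs Hi)) l.
    by move=> x; rewrite -(qform_induced (e := e) l x fi (fun i j => erefl)).
  move=> x; have := psG (fun i => x (f i)).
  rewrite -(qform_induced (e := e) l' _ fi (fun i j => erefl)).
  suff -> : push f (fun i => x (f i)) = x by [].
  by apply/funext => u; rewrite -(enum_rankK u) push_f.
have l2 := ls_gt2 y1; have [g0 g1 gy] := inv_bounds y1; have hy := y1.
have l'2 : 2 < l' by lra.
have d4 : 0 < l ^+ 2 - 4 by nra.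
pose s := Num.sqrt (l ^+ 2 - 4); have s0 : 0 < s by rewrite sqrtr_gt0.
have s2 : s ^+ 2 = l ^+ 2 - 4 by rewrite sqr_sqrtr // ltW.
have sl : s < l by rewrite -(ltr_pXn2r (n := 2)) ?nnegrE ?s2 //; lra.
(* [a] is the smaller root of [a + a^-1 = l], that is, the fixed point of [h -> l - h^-1] at which
   this map expands. *)
have [a Ea] : exists a, a = (l - s) / 2 by exists ((l - s) / 2).
have a0 : 0 < a by lra.
have al : a * (l - a) = 1 by rewrite Ea; move: s2; clear; nra.
have an : a != 0 by rewrite gt_eqF.
have ai : a^-1 = l - a by apply: (mulfI an); rewrite mulfV // al.
have a1 : a < 1.
  rewrite ltNge; apply/negP => ha; have : 1 * (l - a) <= a * (l - a) by apply: ler_wpM2r; lra.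
  by rewrite al mul1r; lra.
have ag : a < y^-1.
  rewrite ltNge; apply/negP => ha.
  have p1 : 0 <= (a - y^-1) * (y - a) by apply: mulr_ge0; lra.
  have p2 : 0 < a * (l - (y + y^-1)) by apply: mulr_gt0; lra.
  have E : (a - y^-1) * (y - a) + a * (l - (y + y^-1)) = a * (l - a) - y^-1 * y by ring.
  by move: E; rewrite al gy; lra.
have a46 : a ^+ 4 + a ^+ 6 <= 1.
  (* This is [y6] divided by [y ^+ 6]; together with [a < y^-1] it gives the hypothesis of
     [state_path_leaf]. *)
  have E : (y^-1) ^+ 4 + (y^-1) ^+ 6 = 1.
    transitivity ((y^-1) ^+ 4 * (y^-1 * y) ^+ 2 + (y^-1) ^+ 6); first by rewrite gy expr1n mulr1.
    transitivity ((y^-1) ^+ 6 * (y ^+ 2 + 1)); first by ring.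
    by rewrite -y6 -exprMn gy expr1n.
  rewrite -E; apply: lerD; apply: lerXn2r; rewrite ?nnegrE; lra.
have lE : l = a + a^-1 by rewrite ai addrC subrK.
rewrite {}lE in ll transfer.
(* For such [a] the greedy window satisfies [a + l^-1 < 1], and leaves alone suffice. For larger [a]
   the window in terms of [h] may reach 1, and cliques take the place of leaves. *)
case: (leP a (56 / 100)) => h1.
  apply: (tree_contradiction a0 a1 l'2 ll transfer).
  have d0 : 0 < 1 + a ^+ 2 by have := sqr_ge0 a; lra.
  rewrite (inv_l a0) -subr_gt0 (_ : 1 - _ = (1 + a ^+ 2 - 2 * a - a * a ^+ 2) / (1 + a ^+ 2)); last by field; rewrite gt_eqF.
  apply: divr_gt0 => //.
  have : a * a ^+ 2 <= 56 / 100 * a ^+ 2 by apply: ler_wpM2r; rewrite ?sqr_ge0.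
  nra.
have fin : (exists h h', [/\ state (a + a^-1) l' h h', a <= h, h < 1 & h' < h]) -> False.
  move=> [h [h' [st ah hh gap]]].
  by apply: (clique_contradiction a0 a1 l'2 ll transfer _ st ah hh gap); lra.
apply: fin; case: (leP a (65 / 100)) => h2; first by apply: state_edge_leaves => //; exact: ltW.
case: (leP a (8 / 10)) => h3; first by apply: state_triangle_leaf => //; lra.
by apply: state_path_leaf => //; lra.
Qed.

End Conclusion.

Lemma sqrt_rho_spec (R : realType) (y := Num.sqrt (rho R)) : 1 < y /\ y ^+ 6 = y ^+ 2 + 1.
Proof.
have E := rhoE R; have r1 : 1 < rho R.
  rewrite ltNge; apply/negP => r1; have : rho R * (rho R ^+ 2 - 1) = 1 by rewrite mulrBr -exprS E; ring.
  have x2 := sqr_ge0 (rho R); case: (leP 0 (rho R)) => r0 h.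
    have : 0 <= rho R * (1 - rho R ^+ 2) by apply: mulr_ge0 => //; rewrite subr_ge0 expr_le1.
    lra.
  case: (leP (-1) (rho R)) => r2.
    have : 0 <= (- rho R) * rho R ^+ 2 by apply: mulr_ge0; lra.
    nra.
  have : 0 <= (- rho R) * (rho R ^+ 2 - 1) by apply: mulr_ge0; nra.
  lra.
have r0 : 0 <= rho R by lra.
split; first by rewrite -sqrtr1 ltr_sqrt //; lra.
by rewrite (exprM y 2 3) sqr_sqrtr.
Qed.

Section FiniteFamilies.
Local Open Scope classical_set_scope.

Lemma finite_lower_bound (R : realType) (T : Type) (F : set T) (f : T -> R) : finite_set F ->
  (forall x, 0 < f x) -> exists2 eps, 0 < eps & forall x, F x -> eps <= f x.
Proof.
move=> finF f0; have /finite_seqP[s Es] := finite_image f finF.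
have [eps e0 he] : exists2 eps : R, 0 < eps & forall r, r \in s -> 0 < r -> eps <= r.
  elim: s {Es} => [|r s [eps e0 he]]; first by exists 1.
  case: (ltP 0 r) => r0; last first.
    exists eps => // r'; rewrite inE => /orP[/eqP -> /(le_lt_trans r0)|]; [by rewrite ltxx | exact: he].
  exists (Num.min eps r); first by rewrite lt_min e0.
  move=> r'; rewrite inE ge_min => /orP[/eqP -> _|h1 h2]; first by rewrite lexx orbT.
  by rewrite he.
exists eps => // x Fx; apply: he => //.
by have : [set` s] (f x) by rewrite -Es; exists x.
Qed.

Lemma not_psd_open (R : realType) (V : finType) (e : rel V) (t : R) : ~ psd e t ->
  exists2 eps, 0 < eps & ~ psd e (t + eps).
Proof.
move=> /existsNP[x /negP]; rewrite -ltNge => hx; pose N := \sum_v x v ^+ 2.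
have N0 : 0 <= N by apply: sumr_ge0 => v _; exact: sqr_ge0.
have N1 : 0 < N + 1 by lra.
exists (- qform e t x / (N + 1)); first by rewrite divr_gt0 // oppr_gt0.
move=> /(_ x); apply/negP; rewrite -ltNge.
have -> : qform e (t + - qform e t x / (N + 1)) x = qform e t x / (N + 1).
  rewrite {1}/qform -/N; transitivity (qform e t x + - qform e t x / (N + 1) * N); first by rewrite /qform -/N; ring.
  by field; rewrite gt_eqF.
by rewrite pmulr_llt0 // invr_gt0.
Qed.

(** Failing to be psd is an open condition on the level, so the finitely many members of [F] all
    still fail at [lam + eps] for a common [eps]. A graph psd at [lam + eps] then contains none of
    them, and the characterization makes it psd at [lam], against [no_spectral_gap]. *)
Lemma characterization_bound (R : realType) (y lam : R) (F : set graph) : 1 < y -> y ^+ 6 = y ^+ 2 + 1 ->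
  finite_set F -> forbidden_subgraph_characterization F (family_ge lam) -> lam < y + y^-1.
Proof.
move=> y1 y6 finF char; rewrite ltNge; apply/negP => yl.
have /choice[f hf] : forall H : graph, exists eps : R, 0 < eps /\ (~ psd (@edge H) lam -> ~ psd (@edge H) (lam + eps)).
  move=> H; case: (pselect (psd (@edge H) lam)) => [ps|/not_psd_open[eps e0 he]]; first by exists 1.
  by exists eps.
have [eps e0 he] := finite_lower_bound finF (fun H => proj1 (hf H)).
have [|G psG] := no_spectral_gap y1 y6 yl (_ : lam < lam + eps); first by rewrite ltrDl.
apply; apply/family_geP/char => -[H FH HG].
have nH : ~ psd (@edge H) lam.
  move=> /family_geP/char; apply; exists H => //; by exists id.
apply: (proj2 (hf H) nH); apply: psd_le (psd_induced HG psG); by rewrite lerD2l he.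
Qed.

End FiniteFamilies.

Local Open Scope classical_set_scope.

Theorem theorem1p3 (R : realType) (lambda : R) :
  (exists2 F : set graph, finite_set F &
     forbidden_subgraph_characterization F (family_ge lambda)) <->
  lambda < lambda_star R.
Proof.
have [y1 y6] := sqrt_rho_spec R; rewrite /lambda_star; split=> [[F]|].
  exact: characterization_bound.
apply: finite_characterization => //.
have y0 : 0 < Num.sqrt (rho R) by lra.
have [b1 b2 _] := root_bounds y0 y6.
have : (Num.sqrt (rho R))^-1 <= 53 / 61 by rewrite -[53 / 61]invf_div lef_pV2 ?posrE //; lra.
lra.
Qed.
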